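(* Let $V(\varphi)\subset L^2(\mathbb{R})$ be a sampling space. Then a finite set $\mathcal{F}=\{f_1,\dots,f_m\}\subset V(\varphi)$ is a determining set for $V(\varphi)$ if and only if the set $$Z=\Bigl(\bigcup_{i=1}^m E_{f_i}\Bigr)\,\triangle\, E_\varphi$$ has Lebesgue measure zero, where $\triangle$ denotes the symmetric difference of sets. Moreover, if $\mathcal{F}$ is a determining set for $V(\varphi)$, then $$V(\varphi)=S(f_1)+\dots+S(f_m).$$
   Context: Fourier transform: $\hat f(\omega)=\int_{-\infty}^{+\infty} f(x)e^{-2\pi i x\omega}\,dx$ (extended to $L^2(\mathbb{R})$). For $f\in L^2(\mathbb{R})$, $S(f)$ is the closure in $L^2(\mathbb{R})$ of the linear span of $\{f(\cdot-k):k\in\mathbb{Z}\}$. One writes $V(\varphi)$ for $S(\varphi)$ when $\{\varphi(\cdot-k)\}_{k\in\mathbb{Z}}$ is a frame of $S(\varphi)$. Grammian: $G_f(\omega)=\sum_{k\in\mathbb{Z}}|\hat f(\omega+k)|^2$, and $E_f=\{\omega\in\mathbb{R}: G_f(\omega)>0\}$. Sampling space: a closed subspace $V(\varphi)$ of $L^2(\mathbb{R})$ is a sampling space if there is a function $s$ such that (1) the translates $\{s(\cdot-k)\}_{k\in\mathbb{Z}}$ are a frame for $V(\varphi)$; (2) for every $\{c_k\}\in\ell^2(\mathbb{Z})$ the series $\sum_{k}c_k s(\cdot-k)$ converges pointwise to a continuous function; (3) for every $f\in V(\varphi)$, $f(x)=\sum_{k\in\mathbb{Z}}f(k)s(x-k)$,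 with convergence in $L^2(\mathbb{R})$ and uniformly on $\mathbb{R}$ (elements of a sampling space are identified with their continuous representatives). Determining set: a set $\{f_1,\dots,f_m\}\subset V(\varphi)$ is a determining set for $V(\varphi)$ if for every $g\in V(\varphi)$ there exist 1-periodic measurable functions $\hat\alpha_1,\dots,\hat\alpha_m$ such that $\hat g=\hat\alpha_1\hat f_1+\cdots+\hat\alpha_m\hat f_m$. *)

(* Defs.v *)
From HB Require Import structures.
From mathcomp Require Import all_boot all_order all_algebra complex.
From mathcomp Require Import all_classical all_reals all_analysis.

Set Implicit Arguments.
Unset Strict Implicit.
Unset Printing Implicit Defensive.
Import Order.TTheory GRing.Theory Num.Theory.
Import numFieldNormedType.Exports.
Local Open Scope classical_set_scope.
Local Open Scope complex_scope.
Local Open Scope ring_scope.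

(* Elements of L^2(R) are represented by Borel functions R -> C; identities in
   L^2(R) are stated almost everywhere or through the L^2 norm, so that every
   set of functions called a subspace below is stable under modification of
   its elements on null sets (within Borel functions). *)
Section ShiftInvariant.
Context {R : realType}.
Local Notation C := R[i].
Local Notation mu := (@lebesgue_measure R).
Implicit Types (f g h s phi : R -> C) (V : set (R -> C)).

Definition cmeasurable f :=
  measurable_fun setT (fun x => complex.Re (f x)) /\
  measurable_fun setT (fun x => complex.Im (f x)).

Definition cLnorm (p : \bar R) f : \bar R :=
  ('N[mu]_p[EFin \o (@Normc.normc R \o f)])%E.

Definition cLfun (p : \bar R) : set (R -> C) :=
  [set f | cmeasurable f /\ (cLnorm p f < +oo)%E].

Definition L2 : set (R -> C) := cLfun 2%:E.

Definition L2_cvg (u : nat -> R -> C) g :=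
  cLnorm 2%:E (u n \- g) @[n --> \oo] --> 0%E.

Definition cintegral f : C :=
  (\int[mu]_x complex.Re (f x)) +i* (\int[mu]_x complex.Im (f x)).

Definition L2_inner f g : C := cintegral (fun x => f x * (g x)^*).

Definition expi (t : R) : C := cos t +i* sin t.

Definition fourier_integral f (w : R) : C :=
  cintegral (fun x => f x * expi (- (2 * pi * x * w))).

(* The extension by continuity of [fourier_integral] from the intersection of
   L^1 and L^2 to L^2. *)
Definition is_fourier f g :=
  L2 g /\ exists u : nat -> R -> C,
    [/\ forall n, cLfun 1%:E (u n) /\ L2 (u n),
        L2_cvg u f &
        L2_cvg (fun n => fourier_integral (u n)) g].

(* A representative of the Fourier transform of f, unique up to null sets; the
   default value 0 is never used when f is in L^2, by Plancherel's theorem. *)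
Definition fourier f : R -> C := xget (cst 0) [set g | is_fourier f g].

Definition shift f (k : int) : R -> C := fun x => f (x - k%:~R).

Definition shift_span f : set (R -> C) :=
  [set g | exists (r : seq int) (c : int -> C),
     g = fun x => \sum_(k <- r) c k * shift f k x].

(* S(f), the closure in L^2 of the span of the integer translates of f. *)
Definition shift_space f : set (R -> C) :=
  [set g | L2 g /\ forall e : R, 0 < e ->
     exists2 h, shift_span f h & (cLnorm 2%:E (g \- h)%R < e%:E)%E].

Definition sqmod (z : C) : \bar R := ((Normc.normc z) ^+ 2)%:E.

Definition shift_frame phi V :=
  (forall k, V (shift phi k)) /\
  exists A B : R, [/\ 0 < A, 0 < B & forall f, V f ->
    (A%:E * cLnorm 2%:E f ^+ 2 <=
       \esum_(k in [set: int]) sqmod (L2_inner f (shift phi k)))%E /\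
    (\esum_(k in [set: int]) sqmod (L2_inner f (shift phi k)) <=
       B%:E * cLnorm 2%:E f ^+ 2)%E].

(* Series indexed by the integers are limits of these symmetric sums, over
   -n <= k <= n. *)
Definition shift_partial_sum (c : int -> C) s (n : nat) : R -> C^o :=
  fun x => \sum_(j < n.*2.+1) c (j%:Z - n%:Z) * shift s (j%:Z - n%:Z) x.

Definition square_summable (c : int -> C) :=
  (\esum_(k in [set: int]) sqmod (c k) < +oo)%E.

(* In the last clause, f0 is the continuous representative of f. *)
Definition sampling_space V :=
  exists s, [/\ shift_frame s V,
    forall c, square_summable c ->
      exists2 h : R -> C^o, continuous h &
        forall x, shift_partial_sum c s n x @[n --> \oo] --> h x &
    forall f, V f -> exists f0 : R -> C^o,
      [/\ continuous f0, f0 = f %[ae mu],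
          L2_cvg (shift_partial_sum (fun k => f0 k%:~R) s) f0 &
          {uniform, shift_partial_sum (fun k => f0 k%:~R) s @ \oo --> f0}]].

Definition grammian f (w : R) : \bar R :=
  (\esum_(k in [set: int]) sqmod (fourier f (w + k%:~R)))%E.

Definition grammian_support f : set R := [set w | (0 < grammian f w)%E].

Definition determining_set V m (F : 'I_m -> R -> C) :=
  forall g, V g -> exists alpha : 'I_m -> R -> C,
    (forall i, cmeasurable (alpha i) /\ periodic (alpha i) 1) /\
    {ae mu, forall w, fourier g w = \sum_(i < m) alpha i w * fourier (F i) w}.

Definition subspace_sum m (W : 'I_m -> set (R -> C)) : set (R -> C) :=
  [set g | L2 g /\ exists h : 'I_m -> R -> C,
     (forall i, W i (h i)) /\ {ae mu, forall x, g x = \sum_(i < m) h i x}].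

End ShiftInvariant.

(* Main.v *)
Require Import Defs.
From HB Require Import structures.
From mathcomp Require Import all_boot all_order all_algebra complex.
From mathcomp Require Import all_classical all_reals all_analysis.
From mathcomp Require Import measurable_realfun ring lra.

(** Write hat f for the Fourier transform of f. On the Fourier side, the space
    S(phi) consists of periodic multiples of hat phi, and both assertions are
    read off from the periodic factors.

    An element g of S(phi) is a limit of functions whose transforms are
    products p_n * hat phi with trigonometric polynomials p_n. Along a rapidly
    convergent sequence the p_n converge almost everywhere where hat phi does
    not vanish, so that hat g = a * hat phi with a periodic
    ([shift_space_fourier]). In particular hat F_i = b_i * hat phi, hence the
    support of the Grammian of F_i is contained in that of phi up to a null
    set; if the F_i form a determining set, hat phi is a combination of the
    hat F_i and the converse inclusion holds for the union
    ([determining_same_support]). If conversely the supports agree, some b_i is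
    nonzero at almost every point where hat phi is, and
      alpha_i = a * conj b_i / (sum_j |b_j| ^ 2)
    solves hat g = sum_i alpha_i * hat F_i. With this choice
    |alpha_i * hat F_i| <= |hat g|, so that every term is square-integrable
    ([same_support_multipliers]).

    The decomposition of S(phi) as a sum needs in addition that
    alpha_i * hat F_i is the transform of an element of S(F_i). The transforms
    of the elements of S(F_i) form a closed subspace stable under the
    characters w |-> exp (- 2 i pi k w) ([fourier_image_closed_invariant]). The
    bounded real functions that multiply such a subspace into itself form an
    algebra that is closed under bounded pointwise limits. It contains the
    trigonometric polynomials of degree one; iterating x |-> x (3 - x^2) / 2,
    which converges to the sign, it contains the indicators of arcs of the
    circle, hence those of all periodic measurable sets, and finally all
    bounded periodic measurable functions. A truncation then gives unbounded
    multipliers ([closed_invariant_periodic]).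

    All this rests on the completeness of L^2 ([L2_complete]) and on
    Plancherel's theorem. For a real function a the latter follows from
      int |hat a|^2 exp (- e |w|) dw
        + 1/2 int K_e(t) int (a(x) - a(t + x))^2 dx dt = int a^2
    where K_e is the transform of exp (- e |w|), a positive kernel with
    integral 1 ([trig_abel_identity]). The second term tends to 0 with e since
    translations act continuously on L^2 ([translation_continuity]), which is
    checked on truncated continuous functions and extended by density. *)

Set Implicit Arguments.
Unset Strict Implicit.
Unset Printing Implicit Defensive.
Import Order.TTheory GRing.Theory Num.Theory.
Import numFieldNormedType.Exports.
Local Open Scope classical_set_scope.
Local Open Scope ring_scope.


(** * Real and imaginary parts *)

Section ComplexComponents.
Context {R : realType}.
Implicit Types (x y : R[i]).

Lemma complex_ReD x y : complex.Re (x + y) = complex.Re x + complex.Re y.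
Proof. by case: x y => [a b] [c d]. Qed.
Lemma complex_ImD x y : complex.Im (x + y) = complex.Im x + complex.Im y.
Proof. by case: x y => [a b] [c d]. Qed.
Lemma complex_ReB x y : complex.Re (x - y) = complex.Re x - complex.Re y.
Proof. by case: x y => [a b] [c d]. Qed.
Lemma complex_ImB x y : complex.Im (x - y) = complex.Im x - complex.Im y.
Proof. by case: x y => [a b] [c d]. Qed.
Lemma complex_ReM x y : complex.Re (x * y) =
  complex.Re x * complex.Re y - complex.Im x * complex.Im y.
Proof. by case: x y => [a b] [c d]. Qed.
Lemma complex_ImM x y : complex.Im (x * y) =
  complex.Re x * complex.Im y + complex.Im x * complex.Re y.
Proof. by case: x y => [a b] [c d]. Qed.

Lemma normc_ge0 x : 0 <= Normc.normc x.
Proof. by case: x => a b; exact: sqrtr_ge0. Qed.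

Lemma normc_sqr x :
  Normc.normc x ^+ 2 = complex.Re x ^+ 2 + complex.Im x ^+ 2.
Proof. by case: x => a b /=; rewrite sqr_sqrtr// addr_ge0// sqr_ge0. Qed.

Lemma normcB x y : Normc.normc (x - y) = Normc.normc (y - x).
Proof. by rewrite -[RHS]normcN opprB. Qed.

Lemma normc_eq0 x : (Normc.normc x == 0) = (x == 0).
Proof.
by apply/eqP/eqP => [/Normc.eq0_normc//|->]; rewrite Normc.normc0.
Qed.

Lemma ler_Re_normc x : `|complex.Re x| <= Normc.normc x.
Proof.
by rewrite -(@ler_pXn2r _ 2)// ?nnegrE ?normc_ge0// normc_sqr
  real_normK ?num_real// lerDl sqr_ge0.
Qed.

Lemma ler_Im_normc x : `|complex.Im x| <= Normc.normc x.
Proof.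
by rewrite -(@ler_pXn2r _ 2)// ?nnegrE ?normc_ge0// normc_sqr
  real_normK ?num_real// lerDr sqr_ge0.
Qed.

Lemma ler_normc_ReIm x :
  Normc.normc x <= `|complex.Re x| + `|complex.Im x|.
Proof.
rewrite -(@ler_pXn2r _ 2)// ?nnegrE ?normc_ge0 ?addr_ge0// normc_sqr sqrrD.
by rewrite !real_normK ?num_real// lerD2r lerDl mulrn_wge0// mulr_ge0.
Qed.

Lemma normc_real (r : R) : Normc.normc (r%:C)%C = `|r|.
Proof. by rewrite /= expr0n addr0 sqrtr_sqr. Qed.

End ComplexComponents.

(** * The L^2 norm of complex-valued functions *)

Section L2Norm.
Context {R : realType}.
Local Notation C := R[i].
Local Notation mu := (@lebesgue_measure R).
Local Notation N f := (cLnorm 2%:E f).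
Implicit Types (f g h : R -> C).

Lemma ae_imp (P Q : R -> Prop) : (forall x, P x -> Q x) ->
  {ae mu, forall x, P x} -> {ae mu, forall x, Q x}.
Proof. by apply: filterS; exact: (ae_filter_ringOfSetsType mu). Qed.

Lemma ae_imp2 (P Q S : R -> Prop) : (forall x, P x -> Q x -> S x) ->
  {ae mu, forall x, P x} -> {ae mu, forall x, Q x} -> {ae mu, forall x, S x}.
Proof. by apply: filterS2; exact: (ae_filter_ringOfSetsType mu). Qed.

Lemma ae_all (P : R -> Prop) : (forall x, P x) -> {ae mu, forall x, P x}.
Proof.
by move=> HP; apply: filterE => //; exact: (ae_filter_ringOfSetsType mu).
Qed.

Lemma cmeasurableD f g :
  cmeasurable f -> cmeasurable g -> cmeasurable (fun x => f x + g x).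
Proof.
move=> [f1 f2] [g1 g2]; split.
  by under eq_fun do rewrite complex_ReD; exact: measurable_funD.
by under eq_fun do rewrite complex_ImD; exact: measurable_funD.
Qed.

Lemma cmeasurableB f g :
  cmeasurable f -> cmeasurable g -> cmeasurable (fun x => f x - g x).
Proof.
move=> [f1 f2] [g1 g2]; split.
  by under eq_fun do rewrite complex_ReB; exact: measurable_funB.
by under eq_fun do rewrite complex_ImB; exact: measurable_funB.
Qed.

Lemma cmeasurableM f g :
  cmeasurable f -> cmeasurable g -> cmeasurable (fun x => f x * g x).
Proof.
move=> [f1 f2] [g1 g2]; split.
  by under eq_fun do rewrite complex_ReM; apply: measurable_funB;
    exact: measurable_funM.
by under eq_fun do rewrite complex_ImM; apply: measurable_funD;
    exact: measurable_funM.
Qed.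

Lemma cmeasurable_cst (c : C) : cmeasurable (fun=> c).
Proof. by split; exact: measurable_cst. Qed.

Lemma cmeasurable_real (a : R -> R) :
  measurable_fun setT a -> cmeasurable (fun x => (a x)%:C%C).
Proof. by move=> ma; split => //=; exact: measurable_cst. Qed.

Lemma cmeasurable_sum I (r : seq I) (F : I -> R -> C) :
  (forall i, cmeasurable (F i)) -> cmeasurable (fun x => \sum_(i <- r) F i x).
Proof.
move=> mF; elim: r => [|i r IH].
  by under eq_fun do rewrite big_nil; exact: cmeasurable_cst.
by under eq_fun do rewrite big_cons; exact: cmeasurableD.
Qed.

Lemma measurable_normc_sqr f : cmeasurable f ->
  measurable_fun setT (fun x => Normc.normc (f x) ^+ 2).
Proof.
move=> [f1 f2]; under eq_fun do rewrite normc_sqr.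
by apply: measurable_funD; exact: measurable_funX.
Qed.

Lemma measurable_normc f : cmeasurable f ->
  measurable_fun setT (fun x => Normc.normc (f x)).
Proof.
move=> mf.
rewrite (_ : (fun x => _) = (@Num.sqrt R) \o (fun x => Normc.normc (f x) ^+ 2)).
  apply: measurableT_comp; last exact: measurable_normc_sqr.
  by apply: continuous_measurable_fun; exact: sqrt_continuous.
by apply/funext => x /=; rewrite sqrtr_sqr ger0_norm// normc_ge0.
Qed.

Local Open Scope ereal_scope.

Lemma cLnorm_ge0 f : 0 <= N f. Proof. exact: Lnorm_ge0. Qed.

Lemma cLnorm_sqrt f : N f = sqrte (\int[mu]_x (Normc.normc (f x) ^+ 2)%:E).
Proof.
rewrite /cLnorm Lnorm.unlock poweR12_sqrt; last first.
  by apply: integral_ge0 => x _; exact: poweR_ge0.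
congr sqrte; apply: eq_integral => x _ /=.
by rewrite powR_mulrn// ger0_norm// normc_ge0.
Qed.

Lemma int_normc_sqr_ge0 f : 0 <= \int[mu]_x (Normc.normc (f x) ^+ 2)%:E.
Proof. by apply: integral_ge0 => x _; rewrite lee_fin sqr_ge0. Qed.

Lemma cLnorm_sqr f : N f ^+ 2 = \int[mu]_x (Normc.normc (f x) ^+ 2)%:E.
Proof. by rewrite cLnorm_sqrt sqr_sqrte// int_normc_sqr_ge0. Qed.

Lemma measurable_EFin_normc_sqr f : cmeasurable f ->
  measurable_fun setT (fun x => (Normc.normc (f x) ^+ 2)%:E).
Proof. by move=> mf; apply/measurable_EFinP; exact: measurable_normc_sqr. Qed.

Lemma ae_eq_cLnorm f g : cmeasurable f -> cmeasurable g ->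
  {ae mu, forall x, f x = g x} -> N f = N g.
Proof.
move=> mf mg fg; rewrite !cLnorm_sqrt; congr sqrte.
apply: ge0_ae_eq_integral => //.
- exact: measurable_EFin_normc_sqr.
- exact: measurable_EFin_normc_sqr.
- by move=> x _; rewrite lee_fin sqr_ge0.
- by move=> x _; rewrite lee_fin sqr_ge0.
- by apply: ae_imp fg => x -> _.
Qed.

Lemma le_cLnorm f g : cmeasurable f -> cmeasurable g ->
  (forall x, Normc.normc (f x) <= Normc.normc (g x))%R -> N f <= N g.
Proof.
move=> mf mg fg; rewrite !cLnorm_sqrt lee_sqrt ?int_normc_sqr_ge0//.
apply: ge0_le_integral => //.
- by move=> x _; rewrite lee_fin sqr_ge0.
- exact: measurable_EFin_normc_sqr.
- exact: measurable_EFin_normc_sqr.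
- by move=> x _; rewrite lee_fin ler_pXn2r// nnegrE normc_ge0.
Qed.

Lemma cLnormD f g : cmeasurable f -> cmeasurable g ->
  N (fun x => f x + g x)%R <= N f + N g.
Proof.
move=> mf mg.
have := @minkowski_EFin _ _ R mu (@Normc.normc R \o f) (@Normc.normc R \o g) 2
  (measurable_normc mf) (measurable_normc mg).
rewrite ler1n => /(_ isT); apply: le_trans.
have -> : 'N[mu]_2%:E[EFin \o ((@Normc.normc R \o f) \+ (@Normc.normc R \o g))%R]
    = N (fun x => (Normc.normc (f x) + Normc.normc (g x))%:C%C).
  rewrite /cLnorm; congr Lnorm; apply/funext => x.
  by rewrite /comp normc_real ger0_norm// addr_ge0// normc_ge0.
apply: le_cLnorm.
- exact: cmeasurableD.
- by apply: cmeasurable_real; apply: measurable_funD; exact: measurable_normc.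
- move=> x; rewrite normc_real ger0_norm ?addr_ge0 ?normc_ge0//.
  exact: le_normcD.
Qed.

Lemma cLnormZ (c : C) f : cmeasurable f ->
  N (fun x => c * f x)%R = (Normc.normc c)%:E * N f.
Proof.
move=> mf; rewrite !cLnorm_sqrt.
under eq_integral do rewrite Normc.normcM exprMn EFinM.
rewrite ge0_integralZl//; last first.
- by rewrite lee_fin sqr_ge0.
- by move=> x _; rewrite lee_fin sqr_ge0.
- exact: measurable_EFin_normc_sqr.
rewrite sqrteM ?lee_fin ?sqr_ge0// EFin_expe sqrte_sqr abse_EFin ger0_norm//.
exact: normc_ge0.
Qed.

Lemma cLnormB f g : N (fun x => f x - g x)%R = N (fun x => g x - f x)%R.
Proof.
rewrite !cLnorm_sqrt; congr sqrte; apply: eq_integral => x _.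
by rewrite normcB.
Qed.

Lemma cLnorm_triangle f g h :
  cmeasurable f -> cmeasurable g -> cmeasurable h ->
  N (fun x => f x - h x)%R <= N (fun x => f x - g x)%R + N (fun x => g x - h x)%R.
Proof.
move=> mf mg mh.
rewrite [leLHS](_ : _ = N (fun x => (f x - g x) + (g x - h x))%R); last first.
  by congr (cLnorm 2%:E _); apply/funext => x; rewrite addrA subrK.
by apply: cLnormD; exact: cmeasurableB.
Qed.

Lemma cLnorm0 : N (fun=> 0%R : C) = 0.
Proof.
rewrite cLnorm_sqrt; under eq_integral do rewrite Normc.normc0 expr0n/=.
by rewrite integral0 sqrte0.
Qed.

Lemma cLnorm_eq0 f : cmeasurable f -> N f = 0 -> {ae mu, forall x, f x = 0%R}.
Proof.
move=> mf f0.
have : \int[mu]_x `|(Normc.normc (f x) ^+ 2)%:E| = 0.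
  have f2 := cLnorm_sqr f; rewrite f0 expe2 mul0e in f2; rewrite f2.
  by apply: eq_integral => x _; rewrite gee0_abs// lee_fin sqr_ge0.
move/(ae_eq_integral_abs mu measurableT (measurable_EFin_normc_sqr mf)).1.
apply: ae_imp => x /(_ Logic.I) /= [] /eqP.
by rewrite sqrf_eq0 normc_eq0 => /eqP.
Qed.

Lemma L2D f g : L2 f -> L2 g -> L2 (fun x => f x + g x)%R.
Proof.
move=> [mf Nf] [mg Ng]; split; first exact: cmeasurableD.
by rewrite (le_lt_trans (cLnormD mf mg))// lte_add_pinfty.
Qed.

Lemma L2Z (c : C) f : L2 f -> L2 (fun x => c * f x)%R.
Proof.
move=> [mf Nf]; split; first by apply: cmeasurableM => //; exact: cmeasurable_cst.
by rewrite cLnormZ// lte_mul_pinfty// lee_fin normc_ge0.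
Qed.

Lemma L2B f g : L2 f -> L2 g -> L2 (fun x => f x - g x)%R.
Proof.
move=> Lf Lg; rewrite (_ : (fun x => _) = (fun x => f x + (-1) * g x)%R).
  by apply: L2D => //; exact: L2Z.
by apply/funext => x; rewrite mulN1r.
Qed.

Lemma L2_0 : L2 (fun=> 0%R : C).
Proof. by split; [exact: cmeasurable_cst | rewrite cLnorm0]. Qed.

Lemma L2_sum I (r : seq I) (F : I -> R -> C) :
  (forall i, L2 (F i)) -> L2 (fun x => \sum_(i <- r) F i x)%R.
Proof.
move=> mF; elim: r => [|i r IH].
  by under eq_fun do rewrite big_nil; exact: L2_0.
by under eq_fun do rewrite big_cons; exact: L2D.
Qed.

Lemma L2_le f g : cmeasurable f -> L2 g ->
  (forall x, Normc.normc (f x) <= Normc.normc (g x))%R -> L2 f.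
Proof.
move=> mf [mg Ng] fg; split => //.
by rewrite (le_lt_trans _ Ng)//; exact: le_cLnorm.
Qed.

Lemma L2_ae_eq f g : cmeasurable f -> L2 g ->
  {ae mu, forall x, f x = g x} -> L2 f.
Proof.
move=> mf [mg Ng] fg; split => //.
by rewrite (ae_eq_cLnorm mf mg fg).
Qed.

Lemma L2_bounded_mul (M : R) (c f : R -> C) : cmeasurable c ->
  (forall x, Normc.normc (c x) <= M)%R -> L2 f ->
  L2 (fun x => c x * f x)%R /\ N (fun x => c x * f x)%R <= M%:E * N f.
Proof.
move=> mc cM Lf; have [mf _] := Lf.
have M0 : (0 <= M)%R by apply: le_trans (cM 0%R); exact: normc_ge0.
have cf x : (Normc.normc (c x * f x) <= Normc.normc ((M%:C)%C * f x))%R.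
  by rewrite !Normc.normcM ler_wpM2r ?normc_ge0// normc_real ger0_norm.
have mM : cmeasurable (fun x => (M%:C)%C * f x)%R.
  by apply: cmeasurableM => //; exact: cmeasurable_cst.
split; first by apply: L2_le (L2Z (M%:C)%C Lf) cf; exact: cmeasurableM.
have -> : M%:E = (Normc.normc (M%:C)%C)%:E by rewrite normc_real ger0_norm.
by rewrite -cLnormZ//; apply: le_cLnorm => //; exact: cmeasurableM.
Qed.

Lemma L2_cvgP (u : nat -> R -> C) g : L2_cvg u g <->
  forall e : R, (0 < e)%R -> \forall n \near \oo, N (fun x => u n x - g x)%R < e%:E.
Proof.
split=> [/fine_cvgP[ufin /cvgr0Pnorm_lt u0] e e0|u0].
  near=> n.
  have fn : N (u n \- g)%R \is a fin_num by near: n.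
  rewrite -(fineK fn) lte_fin (le_lt_trans (ler_norm _))//.
  by near: n; exact: u0.
apply/fine_cvgP; split.
  near=> n; rewrite ge0_fin_numE ?cLnorm_ge0//.
  by rewrite (@lt_trans _ _ 1%:E) ?ltry//; near: n; exact: u0.
apply/cvgr0Pnorm_lt => e e0; near=> n => /=.
rewrite ger0_norm ?fine_ge0 ?cLnorm_ge0//.
have ne : N (u n \- g)%R < e%:E by near: n; exact: u0.
rewrite -lte_fin fineK// ge0_fin_numE ?cLnorm_ge0//.
by rewrite (lt_trans ne)// ltry.
Unshelve. all: by end_near. Qed.

Lemma cLnorm_lt f (e : R) : (0 < e)%R ->
  \int[mu]_x (Normc.normc (f x) ^+ 2)%:E < (e ^+ 2)%:E -> N f < e%:E.
Proof.
move=> e0; rewrite -cLnorm_sqr => fe.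
by apply: lte_sqrE; [rewrite lee_fin ltW | rewrite -EFin_expe].
Qed.

Lemma L2_integrable_sqr f : L2 f ->
  mu.-integrable setT (fun x => (Normc.normc (f x) ^+ 2)%:E).
Proof.
move=> [mf Nf]; apply/integrableP; split; first exact: measurable_EFin_normc_sqr.
under eq_integral do rewrite gee0_abs ?lee_fin ?sqr_ge0//.
rewrite -cLnorm_sqr expe2 lte_mul_pinfty ?cLnorm_ge0//.
by rewrite ge0_fin_numE ?cLnorm_ge0.
Qed.

(** Every truncation argument below is an instance of this form of
    dominated convergence. *)
Lemma cLnorm_dominated (u : nat -> R -> C) (h : R -> C) :
  (forall n, cmeasurable (u n)) -> L2 h ->
  (forall n x, Normc.normc (u n x) <= Normc.normc (h x))%R ->
  {ae mu, forall x, Normc.normc (u n x) @[n --> \oo] --> (0 : R)%R} ->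
  forall e : R, (0 < e)%R -> \forall n \near \oo, N (u n) < e%:E.
Proof.
move=> mu_ Lh uh u0 e e0.
have [] := @dominated_convergence _ _ R mu setT measurableT
  (fun n x => (Normc.normc (u n x) ^+ 2)%:E) (cst 0)
  (fun x => (Normc.normc (h x) ^+ 2)%:E).
- by move=> n; exact: measurable_EFin_normc_sqr.
- exact: measurable_cst.
- apply: ae_imp u0 => x ux _.
  apply/fine_cvgP; split; first by apply: nearW.
  rewrite (_ : fine \o _ = (fun n => Normc.normc (u n x) * Normc.normc (u n x))%R).
    by rewrite -[X in _ --> X](mulr0 0%R); exact: cvgM.
  by apply/funext => n /=; rewrite expr2.
- exact: L2_integrable_sqr.
- apply: ae_all => x n _; rewrite gee0_abs ?lee_fin ?sqr_ge0//.
  by rewrite ler_pXn2r// nnegrE normc_ge0.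
move=> _ _; rewrite integral_cst// mul0e => /fine_cvgP[ufin /cvgr0Pnorm_lt uc].
near=> n; apply: cLnorm_lt => //.
rewrite -(@fineK _ (\int[mu]_x _)); last by near: n.
rewrite lte_fin (le_lt_trans (ler_norm _))//.
by near: n; apply: uc; rewrite exprn_gt0.
Unshelve. all: by end_near. Qed.

End L2Norm.


(** * Rapid convergence and completeness of L^2 *)

Section RieszFischer.
Context {R : realType}.
Local Notation C := R[i].
Local Notation mu := (@lebesgue_measure R).
Local Notation N f := (cLnorm 2%:E f).
Implicit Types (f g h : R -> C).
Local Open Scope ereal_scope.

(** The weighted squares [2 ^+ n * d_n ^+ 2] of the norms have a summable
    integral, and [d <= 2 ^- n + 2 ^+ n * d ^+ 2] passes from them to the norms
    themselves. *)
Lemma cLnorm_fast_ae (f : nat -> R -> C) : (forall n, cmeasurable (f n)) ->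
  (forall n, N (f n) <= (2^-1 ^+ n)%:E) ->
  {ae mu, forall x, cvgn (series (fun n => Normc.normc (f n x)))}.
Proof.
move=> mf Nf.
pose S x := \sum_(0 <= n <oo) (2 ^+ n * Normc.normc (f n x) ^+ 2)%:E.
have mS n : measurable_fun setT (fun x => (2 ^+ n * Normc.normc (f n x) ^+ 2)%:E).
  apply/measurable_EFinP; apply: measurable_funM => //.
  exact: measurable_normc_sqr.
have S0 n x : 0 <= (2 ^+ n * Normc.normc (f n x) ^+ 2)%:E.
  by rewrite lee_fin mulr_ge0// sqr_ge0.
have intS : mu.-integrable setT S.
  apply/integrableP; split.
    by apply: ge0_emeasurable_sum => [n x _ _|n _]; [exact: S0|exact: mS].
  under eq_integral do rewrite gee0_abs ?nneseries_ge0//.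
  rewrite integral_nneseries//.
  apply: (@le_lt_trans _ _ (\sum_(0 <= n <oo) (2^-1 ^+ n)%:E)).
    apply: lee_nneseries => n _; first by move=> _; exact: integral_ge0.
    under eq_integral do rewrite EFinM.
    rewrite ge0_integralZl//; last 2 first.
    - exact: measurable_EFin_normc_sqr.
    - by move=> x _; rewrite lee_fin sqr_ge0.
    rewrite -cLnorm_sqr (_ : (2^-1 ^+ n)%:E = (2 ^+ n)%:E * (2^-1 ^+ n)%:E ^+ 2).
      rewrite lee_pmul2l// ?lte_fin ?exprn_gt0//.
      by rewrite lee_sqr ?cLnorm_ge0// lee_fin exprn_ge0.
    rewrite -EFin_expe -EFinM; congr EFin.
    by rewrite expr2 mulrA -exprMn divff// expr1n mul1r.
  apply: (@le_lt_trans _ _ 2%:E); last by rewrite ltry.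
  apply: lime_le; first by apply: is_cvg_nneseries => n _ _; rewrite lee_fin.
  apply: nearW => n; rewrite sumEFin lee_fin.
  have /(_ n) := @geometric_le_lim R _ 1 2^-1 ler01.
  rewrite invr_gt0 ger0_norm// invf_lt1// ltr0n ltr1n => /(_ isT isT).
  rewrite [X in (_ <= X)%R -> _](_ : _ = 2%R); last by field.
  apply: le_trans; rewrite /series/= le_eqVlt; apply/orP; left; apply/eqP.
  by apply: eq_bigr => i _; rewrite mul1r.
have := integrable_ae measurableT intS.
apply: ae_imp => x /(_ Logic.I) Sx.
have c1 : cvgn (series (fun n => 2 ^+ n * Normc.normc (f n x) ^+ 2)%R).
  apply: nnseries_is_cvg => [n|]; first by rewrite mulr_ge0// sqr_ge0.
  by rewrite ltey_eq Sx.
have c2 : cvgn (series (geometric (1 : R) 2^-1)).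
  by apply: is_cvg_geometric_series; rewrite ger0_norm// invf_lt1// ltr1n.
apply: (series_le_cvg _ _ _ (is_cvg_seriesD c2 c1)) => n.
- exact: normc_ge0.
- apply: addr_ge0; first by rewrite /geometric/= mul1r exprn_ge0.
  by rewrite mulr_ge0// sqr_ge0.
- rewrite [leRHS](_ : _ = (2^-1) ^+ n + 2 ^+ n * Normc.normc (f n x) ^+ 2)%R;
    last by rewrite fctE /geometric /= mul1r.
  set d := Normc.normc _; set t := (2 ^+ n : R)%R.
  have t0 : (0 < t)%R by rewrite exprn_gt0.
  rewrite exprVn -/t -(ler_pM2l t0) mulrDr mulfV ?gt_eqF//.
  nra.
Qed.

Lemma normc_cvg0 (z : nat -> C) : Normc.normc (z n) @[n --> \oo] --> (0 : R)%R ->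
  complex.Re (z n) @[n --> \oo] --> (0 : R)%R /\
  complex.Im (z n) @[n --> \oo] --> (0 : R)%R.
Proof.
move=> z0; split; apply/cvgr0Pnorm_lt => e e0;
  move/cvgr0Pnorm_lt : z0 => /(_ e e0); apply: filterS => n;
  rewrite [X in (X < _)%R -> _]ger0_norm ?normc_ge0//; apply: le_lt_trans.
- exact: ler_Re_normc.
- exact: ler_Im_normc.
Qed.

Lemma cvg0_normc (z : nat -> C) : complex.Re (z n) @[n --> \oo] --> (0 : R)%R ->
  complex.Im (z n) @[n --> \oo] --> (0 : R)%R ->
  Normc.normc (z n) @[n --> \oo] --> (0 : R)%R.
Proof.
move=> /cvgr0Pnorm_lt re0 /cvgr0Pnorm_lt im0; apply/cvgr0Pnorm_lt => e e0.
near=> n; rewrite ger0_norm ?normc_ge0// (le_lt_trans (ler_normc_ReIm _))//.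
rewrite [ltRHS](splitr e) ltrD//; near: n; [apply: re0|apply: im0];
  by rewrite divr_gt0.
Unshelve. all: by end_near. Qed.

Lemma cLnorm_fast_cvg (f : nat -> R -> C) g : (forall n, cmeasurable (f n)) ->
  cmeasurable g -> (forall n, N (fun x => f n x - g x)%R <= (2^-1 ^+ n)%:E) ->
  {ae mu, forall x, Normc.normc (f n x - g x)%R @[n --> \oo] --> (0 : R)%R}.
Proof.
move=> mf mg fg.
have := cLnorm_fast_ae (fun n => cmeasurableB (mf n) mg) fg.
by apply: ae_imp => x; exact: cvg_series_cvg_0.
Qed.

(** The limit superior serves as a total limit operator that preserves
    measurability; its value matters only where the sequence converges. *)
Definition rlim (u : nat -> R -> R) (x : R) : R :=
  fine (limn_esup (fun n => (u n x)%:E)).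

Lemma measurable_rlim u : (forall n, measurable_fun setT (u n)) ->
  measurable_fun setT (rlim u).
Proof.
move=> mu_; apply: measurableT_comp => //.
by apply: measurable_fun_limn_esup => n; apply/measurable_EFinP.
Qed.

Lemma rlim_cvg (u : nat -> R -> R) x l : u n x @[n --> \oo] --> l -> rlim u x = l.
Proof.
move=> ul; rewrite /rlim is_cvg_limn_esupE; last first.
  by apply/cvg_ex; exists l%:E; apply/fine_cvgP; split => //; apply: nearW.
suff -> : limn (fun n => (u n x)%:E) = l%:E by [].
by apply/cvg_lim => //; apply/fine_cvgP; split => //; apply: nearW.
Qed.

Lemma limn_einf_le (u : nat -> \bar R) c : (forall n, u n <= c) -> limn_einf u <= c.
Proof.
move=> uc; rewrite limn_einf_lim; apply: lime_le; first exact: is_cvg_einfs.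
apply: nearW => n; apply: le_trans (uc n).
by apply: ereal_inf_lbound; exists n => /=.
Qed.

Lemma cLnorm_fast_dist (f : nat -> R -> C) : (forall n, cmeasurable (f n)) ->
  (forall n, N (fun x => f n.+1 x - f n x)%R <= (2^-1 ^+ n)%:E) ->
  forall n m, N (fun x => f (n + m)%N x - f n x)%R <= (2 * 2^-1 ^+ n)%:E.
Proof.
move=> mf Nf n m.
suff : N (fun x => f (n + m)%N x - f n x)%R <=
    (2 * 2^-1 ^+ n - 2 * 2^-1 ^+ (n + m))%:E.
  by move/le_trans; apply; rewrite lee_fin gerBl mulr_ge0// exprn_ge0.
elim: m => [|m IH].
  rewrite addn0 subrr (_ : (fun x => _) = fun=> 0%R) ?cLnorm0//.
  by apply/funext => x; rewrite subrr.
rewrite (le_trans (cLnorm_triangle (mf _) (mf (n + m)%N) (mf n)))//.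
rewrite addnS.
apply: le_trans (leeD (Nf _) IH) _.
by rewrite -EFinD lee_fin exprS; lra.
Qed.

(** The differences are absolutely summable almost everywhere, which gives
    the limit, and Fatou's lemma transfers the norm bounds to it. *)
Lemma L2_complete (f : nat -> R -> C) : (forall n, L2 (f n)) ->
  (forall n, N (fun x => f n.+1 x - f n x)%R <= (2^-1 ^+ n)%:E) ->
  exists2 g, L2 g & forall n, N (fun x => f n x - g x)%R <= (2 * 2^-1 ^+ n)%:E.
Proof.
move=> Lf Nf; have mf n : cmeasurable (f n) by have [] := Lf n.
pose re n x := complex.Re (f n x); pose im n x := complex.Im (f n x).
pose g x : C := Complex (rlim re x) (rlim im x).
have mg : cmeasurable g.
  by split; apply: measurable_rlim => n; have [] := mf n.
have fg : {ae mu, forall x, Normc.normc (f n x - g x)%R @[n --> \oo] --> (0 : R)%R}.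
  have := cLnorm_fast_ae (fun n => cmeasurableB (mf n.+1) (mf n)) Nf.
  apply: ae_imp => x cx.
  have cR (p : C -> R) : (forall z, `|p z| <= Normc.normc z)%R ->
      (forall z w, p (z - w) = p z - p w)%R -> cvgn (fun n => p (f n x)).
    move=> ple pB.
    have : cvgn (series (fun n => p (f n.+1 x - f n x)%R)).
      apply: normed_cvg; apply: series_le_cvg cx => n //=; exact: normc_ge0.
    rewrite (_ : series _ = fun n => (p (f n x) - p (f 0%N x))%R); last first.
      apply/funext => n; rewrite /series/=.
      under eq_bigr do rewrite pB.
      by rewrite telescope_sumr.
    move=> c; have := is_cvgD c (is_cvg_cst (p (f 0%N x))).
    rewrite (_ : _ + _ = fun n => p (f n x))%R; first exact.
    by apply/funext => n; rewrite fctE /= subrK.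
  have /cvg_ex[a fa] := cR _ (@ler_Re_normc R) (@complex_ReB R).
  have /cvg_ex[b fb] := cR _ (@ler_Im_normc R) (@complex_ImB R).
  apply: cvg0_normc.
    under eq_fun do rewrite complex_ReB /= (rlim_cvg fa).
    by apply/subr_cvg0.
  under eq_fun do rewrite complex_ImB /= (rlim_cvg fb).
  by apply/subr_cvg0.
have Ng n : N (fun x => f n x - g x)%R <= (2 * 2^-1 ^+ n)%:E.
  apply: lee_sqrE; first by rewrite lee_fin mulr_ge0// exprn_ge0.
  rewrite cLnorm_sqr.
  pose h m x := (Normc.normc (f n x - f (n + m)%N x) ^+ 2)%:E.
  have mh m : measurable_fun setT (h m).
    by apply: measurable_EFin_normc_sqr; exact: cmeasurableB.
  have -> : \int[mu]_x (Normc.normc (f n x - g x)%R ^+ 2)%:E =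
      \int[mu]_x limn_einf (h^~ x).
    apply: ge0_ae_eq_integral => //.
    - by apply: measurable_EFin_normc_sqr; exact: cmeasurableB.
    - rewrite [X in measurable_fun _ X](_ : _ =
          (fun x => - limn_esup (fun m => - h m x))) //.
      apply: measurableT_comp => //.
      apply: (@measurable_fun_limn_esup _ _ _ _ (fun m x => - h m x)) => m.
      by apply: measurableT_comp => //; exact: mh.
    - by move=> x _; rewrite lee_fin sqr_ge0.
    - move=> x _; rewrite limn_einf_lim; apply: lime_ge; first exact: is_cvg_einfs.
      apply: nearW => m; apply: le_ereal_inf_tmp => _ [k _ <-].
      by rewrite lee_fin sqr_ge0.
    apply: ae_imp fg => x fgx _.
    have hc : (fun m => h m x) @ \oo --> (Normc.normc (f n x - g x)%R ^+ 2)%:E.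
      apply/fine_cvgP; split; first by apply: nearW.
      have nc : Normc.normc (f n x - f (n + m)%N x)%R @[m --> \oo] -->
          Normc.normc (f n x - g x)%R.
        apply/cvgrPdist_lt => e e0.
        move/cvgr0Pnorm_lt : fgx => /(_ e e0)[k _ kP].
        exists k => // m /= km.
        have /= := kP (n + m)%N (leq_trans km (leq_addl _ _)).
        rewrite ger0_norm ?normc_ge0//; apply: le_lt_trans.
        rewrite ler_norml; apply/andP; split.
          rewrite lerBrDl lerBlDr.
          rewrite [X in (Normc.normc X <= _)%R](_ : _ =
            (f n x - g x) - (f (n + m)%N x - g x))%R; last by ring.
          by rewrite (le_trans (le_normcD _ _))// normcN.
        rewrite lerBlDr [X in (Normc.normc X <= _)%R](_ : _ =
            (f (n + m)%N x - g x) + (f n x - f (n + m)%N x))%R; last by ring.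
        exact: le_normcD.
      rewrite (_ : fine \o _ = (fun m => Normc.normc (f n x - f (n + m)%N x) *
        Normc.normc (f n x - f (n + m)%N x))%R); last first.
        by apply/funext => m /=; rewrite expr2.
      by rewrite expr2; exact: cvgM.
    by rewrite is_cvg_limn_einfE ?(cvg_lim _ hc)//; apply/cvg_ex; eexists; exact: hc.
  apply: le_trans (fatou mu measurableT mh _) _.
    by move=> m x _; rewrite lee_fin sqr_ge0.
  apply: limn_einf_le => m.
  rewrite -cLnorm_sqr cLnormB lee_sqr ?cLnorm_ge0// ?lee_fin ?mulr_ge0 ?exprn_ge0//.
  exact: cLnorm_fast_dist.
exists g => //; split => //.
have -> : g = (fun x => f 0%N x + (g x - f 0%N x))%R.
  by apply/funext => x; rewrite addrC subrK.
apply: le_lt_trans (cLnormD (mf 0%N) (cmeasurableB mg (mf 0%N))) _.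
rewrite lte_add_pinfty//; first by have [] := Lf 0%N.
by rewrite cLnormB (le_lt_trans (Ng 0%N))// ltry.
Qed.

End RieszFischer.


(** * Translation invariance of Lebesgue measure *)

Section Translation.
Context {R : realType}.
Local Notation mu := (@lebesgue_measure R).
Local Open Scope ereal_scope.

Lemma measurable_shift (c : R) :
  measurable_fun setT ((fun x => x + c)%R : measurableTypeR R -> measurableTypeR R).
Proof.
by apply: (@measurable_funD _ (measurableTypeR R) R setT id (cst c)) => //;
  exact: measurable_cst.
Qed.

Lemma lebesgue_measure_shift (c : R) (A : set R) : measurable A ->
  pushforward mu ((fun x => x + c)%R : measurableTypeR R -> measurableTypeR R) A =
  mu A.
Proof.
move=> mA; apply/esym.
have mc := measurable_shift c.
apply: (lebesgue_measure_unique (mu := [the measure _ _ of pushforward mu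
  ((fun x => x + c)%R : measurableTypeR R -> measurableTypeR R)])) => //.
move=> _ [[a b]] _ <-.
rewrite /= /pushforward.
rewrite (_ : _ @^-1` _ = `]a - c, b - c]%classic)%R; last first.
  by apply/seteqP; split=> x /=; rewrite !in_itv/= ltrBlDr lerBrDr.
rewrite !lebesgue_measure_itv/= !lte_fin ltrD2r.
by case: ifPn => // _; rewrite -?EFinD; congr (_%:E); ring.
Qed.

Lemma ge0_integral_shift (c : R) (f : R -> \bar R) : measurable_fun setT f ->
  (forall x, 0 <= f x) -> \int[mu]_x f (x + c)%R = \int[mu]_x f x.
Proof.
move=> mf f0; have mc := measurable_shift c.
rewrite -[LHS]/(\int[mu]_(x in ((fun x => x + c)%R :
  measurableTypeR R -> measurableTypeR R) @^-1` setT) (f \o (fun x => x + c)%R) x).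
rewrite -ge0_integral_pushforward//=.
by apply: eq_measure_integral => //= A mA _; exact: lebesgue_measure_shift.
Qed.

End Translation.

(** * The Abel weight and the Poisson kernel *)

Section PoissonKernel.
Context {R : realType}.
Local Notation mu := (@lebesgue_measure R).

(** [abel] and [poisson] form a Fourier pair for the normalization with 2 pi
    in the exponent; the parameter e is meant to tend to 0. *)
Definition abel (e w : R) : R := expR (- (e * `|w|)).
Definition poisson (e t : R) : R := 2 * e / (e ^+ 2 + (2 * pi * t) ^+ 2).

Lemma abel_gt0 e w : 0 < abel e w. Proof. exact: expR_gt0. Qed.

Lemma continuous_abel e : continuous (abel e).
Proof.
move=> w; apply: (@continuous_comp _ _ _ (fun w : R => - (e * `|w|)) expR).
  by apply: cvgN; apply: cvgMl_tmp; exact: norm_continuous.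
exact: continuous_expR.
Qed.

Lemma poisson_den_gt0 (e b : R) : 0 < e -> 0 < e ^+ 2 + b ^+ 2.
Proof. by move=> e0; rewrite ltr_pwDl ?sqr_ge0// exprn_gt0. Qed.

Lemma poisson_gt0 e t : 0 < e -> 0 < poisson e t.
Proof. by move=> e0; rewrite divr_gt0 ?poisson_den_gt0// mulr_gt0. Qed.

Lemma continuous_poisson e : 0 < e -> continuous (poisson e).
Proof.
move=> e0 t; apply: cvgMl_tmp; apply: cvgV; first by rewrite gt_eqF ?poisson_den_gt0.
apply: cvgD; first exact: cvg_cst.
apply: (@continuous_comp _ _ _ (fun t : R => 2 * pi * t) (fun y : R => y ^+ 2)).
  exact: mulrl_continuous.
exact: exprn_continuous.
Qed.

Lemma poissonN e t : poisson e (- t) = poisson e t.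
Proof. by rewrite /poisson mulrN sqrrN. Qed.

Local Lemma set_ge0_itv : [set x : R | 0 <= x] = `[0, +oo[%classic.
Proof. by rewrite set_itvcy. Qed.

Lemma integral_poisson e : 0 < e -> (\int[mu]_t (poisson e t)%:E = 1)%E.
Proof.
move=> e0; rewrite ge0_symfun_integralT; last 3 first.
- by move=> t; exact/ltW/poisson_gt0.
- exact: continuous_poisson.
- by move=> t /=; rewrite poissonN.
rewrite set_ge0_itv.
pose F t : R := pi^-1 * atan (2 * pi / e * t).
have pi0 := pi_gt0 R.
have dF (x : R) : is_derive x (1 : R) F (poisson e x).
  rewrite /F; apply: is_derive_eq.
  rewrite /poisson /GRing.scale/=.
  have /lt0r_neq0 d0 := poisson_den_gt0 (2 * pi * x) e0.
  have /lt0r_neq0 e1 := e0.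
  have /lt0r_neq0 pi1 := pi0.
  clear F; move: (@pi R) d0 pi1 pi0 => p d0 pi1 _.
  rewrite (_ : 1 + _ = (e ^+ 2 + (2 * p * x) ^+ 2) / e ^+ 2); last by field.
  by field; rewrite d0 e1 pi1.
have F0 : F 0 = 0 by rewrite /F mulr0 atan0 mulr0.
have Fy : F x @[x --> +oo] --> (2^-1 : R).
  rewrite (_ : 2^-1 = pi^-1 * (pi / 2)); last by rewrite mulrA mulVf ?mul1r// gt_eqF.
  apply: cvgMl_tmp; apply: (@cvg_comp _ _ _ (fun t => 2 * pi / e * t) (@atan R) _ +oo%R).
    by apply: gt0_cvgMry => //; rewrite divr_gt0// mulr_gt0.
  exact: cvgy_atan.
rewrite (ge0_continuous_FTC2y _ _ Fy)/=.
- by rewrite F0 sube0 -EFinM divff.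
- by move=> x _; exact/ltW/poisson_gt0.
- apply/continuous_within_itvcyP; split.
    by move=> x _; exact: continuous_poisson.
  by apply: cvg_at_right_filter; exact: continuous_poisson.
- by move=> x _; apply: ex_derive; exact: dF.
- apply: cvg_at_right_filter; apply: differentiable_continuous.
  by apply/derivable1_diffP; exact: ex_derive.
- by move=> x _; rewrite derive1E; exact: derive_val.
Qed.

Let abel_cos_primitive (e b w : R) : R :=
  expR (- (e * w)) * ((b * sin (b * w) - e * cos (b * w)) / (e ^+ 2 + b ^+ 2) - e^-1).

(** Adding 1 to the cosine makes the integrand nonnegative, so that the
    fundamental theorem of calculus on a half-line applies. *)
Lemma integral_abel_1cos e b : 0 < e ->
  (\int[mu]_w (abel e w * (1 + cos (b * w)))%:E =
   (2 * (e^-1 + e / (e ^+ 2 + b ^+ 2)))%:E)%E.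
Proof.
move=> e0.
have cf : continuous (fun w : R => abel e w * (1 + cos (b * w))).
  move=> w; apply: cvgM; first exact: continuous_abel.
  apply: cvgD; first exact: cvg_cst.
  apply: (@continuous_comp _ _ _ (fun w : R => b * w) (@cos R)).
    exact: mulrl_continuous.
  exact: continuous_cos.
have f0 w : 0 <= abel e w * (1 + cos (b * w)).
  by rewrite mulr_ge0 ?(ltW (abel_gt0 _ _))// -lerBlDl sub0r cos_geN1.
rewrite ge0_symfun_integralT//; last first.
  by move=> w /=; rewrite /abel normrN mulrN cosN.
rewrite set_ge0_itv.
have /lt0r_neq0 d0 := poisson_den_gt0 b e0.
have /lt0r_neq0 e1 := e0.
pose F := abel_cos_primitive e b.
pose f w : R := expR (- (e * w)) * (1 + cos (b * w)).
have dF (x : R) : is_derive x (1 : R) F (f x).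
  rewrite /F /abel_cos_primitive /f; apply: is_derive_eq.
  by rewrite /GRing.scale/=; field; rewrite e1 d0.
have Fy : F x @[x --> +oo] --> (0 : R).
  pose M := (`|b| + e) / (e ^+ 2 + b ^+ 2) + e^-1.
  have E0 : expR (- (e * x)) * M @[x --> +oo] --> (0 : R).
    rewrite -[X in _ --> X](mul0r M); apply: cvgMr_tmp.
    apply: (@cvg_comp _ _ _ (fun t => e * t) (fun t => expR (- t)) _ +oo%R).
      exact: gt0_cvgMry.
    exact: cvgr_expR.
  apply/cvgr0Pnorm_lt => r r0; move/cvgr0Pnorm_lt : E0 => /(_ r r0).
  apply: filterS => x; apply: le_lt_trans.
  rewrite /F /abel_cos_primitive !normrM ler_pM2l ?normr_gt0 ?gt_eqF ?expR_gt0//.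
  rewrite [leRHS]ger0_norm; last first.
    by rewrite /M addr_ge0 ?invr_ge0 ?(ltW e0)// divr_ge0 ?addr_ge0 ?(ltW e0) ?sqr_ge0.
  rewrite (le_trans (ler_normB _ _))// /M lerD//; last first.
    by rewrite ger0_norm// invr_ge0 ltW.
  rewrite normrM normfV (ger0_norm (ltW (poisson_den_gt0 b e0))).
  rewrite ler_pM2r ?invr_gt0 ?poisson_den_gt0//.
  rewrite (le_trans (ler_normB _ _))// !normrM lerD//.
    by rewrite ler_piMr// ler_norml sin_geN1 sin_le1.
  by rewrite (ger0_norm (ltW e0)) ler_piMr ?(ltW e0)// ler_norml cos_geN1 cos_le1.
have fE x : 0 <= x -> abel e x * (1 + cos (b * x)) = f x.
  by move=> x0; rewrite /abel ger0_norm.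
rewrite [X in (_ * X)%E](_ : _ = \int[mu]_(x in `[0%R, +oo[) (f x)%:E)%E; last first.
  by apply: eq_integral => x; rewrite inE/= in_itv/= andbT => x0; rewrite fE.
have cff : continuous f.
  move=> w; apply: cvgM.
    apply: (@continuous_comp _ _ _ (fun w : R => - (e * w)) expR).
      by apply: cvgN; exact: mulrl_continuous.
    exact: continuous_expR.
  apply: cvgD; first exact: cvg_cst.
  apply: (@continuous_comp _ _ _ (fun w : R => b * w) (@cos R)).
    exact: mulrl_continuous.
  exact: continuous_cos.
rewrite (ge0_continuous_FTC2y _ _ Fy)/=.
- rewrite /F /abel_cos_primitive !mulr0 oppr0 expR0 sin0 cos0 mulr0 mulr1 sub0r.
  by congr (_%:E); field; rewrite e1 d0.
- by move=> x x0; rewrite -fE.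
- apply/continuous_within_itvcyP; split; first by move=> x _; exact: cff.
  by apply: cvg_at_right_filter; exact: cff.
- by move=> x _; apply: ex_derive; exact: dF.
- apply: cvg_at_right_filter; apply: differentiable_continuous.
  by apply/derivable1_diffP; exact: ex_derive.
- by move=> x _; rewrite derive1E; exact: derive_val.
Qed.

Lemma integral_abel e : 0 < e -> (\int[mu]_w (abel e w)%:E = (2 / e)%:E)%E.
Proof.
move=> e0.
transitivity (\int[mu]_w ((2^-1)%:E * (abel e w * (1 + cos (0 * w)))%:E))%E.
  by apply: eq_integral => w _; rewrite mul0r cos0 -EFinM; congr EFin; field.
rewrite ge0_integralZl//; last 2 first.
- apply/measurable_EFinP; apply: measurable_funM.
    by apply: continuous_measurable_fun; exact: continuous_abel.
  by under eq_fun do rewrite mul0r cos0; exact: measurable_cst.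
- by move=> w _; rewrite lee_fin mul0r cos0 mulr_ge0// ltW// abel_gt0.
rewrite integral_abel_1cos// -EFinM; congr EFin.
by field; rewrite gt_eqF.
Qed.

Lemma integrable_abel e : 0 < e -> mu.-integrable setT (EFin \o abel e).
Proof.
move=> e0; apply/integrableP; split.
  by apply/measurable_EFinP; apply: continuous_measurable_fun; exact: continuous_abel.
under eq_integral do rewrite /= ger0_norm ?(ltW (abel_gt0 _ _))//.
by rewrite integral_abel// ltry.
Qed.

Lemma integral_abel_cos e b : 0 < e ->
  \int[mu]_w (abel e w * cos (b * w)) = 2 * e / (e ^+ 2 + b ^+ 2).
Proof.
move=> e0; have /lt0r_neq0 d0 := poisson_den_gt0 b e0.
have i1 : mu.-integrable setT (fun w => (abel e w * (1 + cos (b * w)))%:E).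
  apply/integrableP; split.
    apply/measurable_EFinP; apply: continuous_measurable_fun.
    move=> w; apply: cvgM; first exact: continuous_abel.
    apply: cvgD; first exact: cvg_cst.
    apply: (@continuous_comp _ _ _ (fun w : R => b * w) (@cos R)).
      exact: mulrl_continuous.
    exact: continuous_cos.
  under eq_integral do rewrite gee0_abs ?lee_fin ?mulr_ge0
    ?(ltW (abel_gt0 _ _))// -?lerBlDl ?sub0r ?cos_geN1//.
  by rewrite integral_abel_1cos// ltry.
have -> : (fun w => abel e w * cos (b * w)) =
    (fun w => abel e w * (1 + cos (b * w)) - abel e w).
  by apply/funext => w; rewrite mulrDr mulr1 addrAC subrr add0r.
rewrite RintegralB//; last exact: integrable_abel.
rewrite /Rintegral integral_abel_1cos// integral_abel//=.
by field; rewrite d0 gt_eqF.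
Qed.

End PoissonKernel.


(** * Cosine and sine transforms of integrable functions *)

Section TrigTransforms.
Context {R : realType}.
Local Notation mu := (@lebesgue_measure R).
Local Notation L1R f := (mu.-integrable setT (EFin \o (f : R -> R))).
Implicit Types (a f g t : R -> R).

Lemma EFin_Rintegral f : L1R f -> (\int[mu]_x (f x)%:E = (\int[mu]_x f x)%:E)%E.
Proof. by move=> fi; rewrite /Rintegral fineK// integrable_fin_num. Qed.

Lemma integrable_measurable f : L1R f -> measurable_fun setT f.
Proof. by case/integrableP => /measurable_EFinP. Qed.

Lemma integrable_bounded_mul (M : R) a g : L1R a -> measurable_fun setT g ->
  (forall x, `|g x| <= M) -> L1R (fun x => a x * g x).
Proof.
move=> ia mg gM; have ma := integrable_measurable ia.
have iM : L1R (fun x => M * a x).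
  by apply: (integrableZl measurableT M ia).
apply: le_integrable iM => //.
  by apply/measurable_EFinP; exact: measurable_funM.
move=> x _; rewrite /= lee_fin !normrM mulrC ler_wpM2r//.
by rewrite (le_trans (gM x))// ler_norm.
Qed.

(** For [t] the cosine and the sine, the even and odd parts of the Fourier
    integral of a real function; a general bounded continuous [t] covers both. *)
Definition trig_transform t a (w : R) : R := \int[mu]_x (a x * t (2 * pi * x * w)).

Section bounded_kernel.
Variable t : R -> R.
Hypothesis ct : continuous t.
Hypothesis t1 : forall x, `|t x| <= 1.

Lemma continuous_mul_phase (w : R) : continuous (fun x => t (2 * pi * x * w)).
Proof.
move=> x; apply: (@continuous_comp _ _ _ (fun x : R => 2 * pi * x * w) t).
  by apply: cvgMr_tmp; exact: mulrl_continuous.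
exact: ct.
Qed.

Lemma measurable_phase (w : R) : measurable_fun setT (fun x => t (2 * pi * x * w)).
Proof. by apply: continuous_measurable_fun; exact: continuous_mul_phase. Qed.

Lemma integrable_phase a w : L1R a -> L1R (fun x => a x * t (2 * pi * x * w)).
Proof.
by move=> ia; apply: (@integrable_bounded_mul 1) => //; exact: measurable_phase.
Qed.

Lemma trig_transform_bound a w : L1R a ->
  `|trig_transform t a w| <= \int[mu]_x `|a x|.
Proof.
move=> ia; have iw := integrable_phase w ia.
rewrite (le_trans (le_normr_Rintegral _ iw))//.
apply: le_Rintegral => //.
- exact: (integrable_norm iw).
- exact: (integrable_norm ia).
- by move=> x _; rewrite normrM ler_piMr.
Qed.

Lemma continuous_trig_transform a : L1R a -> continuous (trig_transform t a).
Proof.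
move=> ia w.
have := @continuity_under_integral R _ _ mu (fun l x => a x * t (2 * pi * x * l))
  setT measurableT (w - 1) (w + 1) _ _ (fun x => `|a x|).
apply => //.
- by move=> x _; exact: integrable_phase.
- apply: ae_all => y _ x _; apply: cvgMl_tmp.
  apply: (@continuous_comp _ _ _ (fun l : R => 2 * pi * y * l) t).
    exact: mulrl_continuous.
  exact: ct.
- exact: (integrable_norm ia).
- by move=> x _; apply: ae_all => y _; rewrite normrM ler_piMr.
- by rewrite inE/= in_itv/= ltrBlDr ltrDl ltr01.
Qed.

Lemma measurable_trig_transform a : L1R a -> measurable_fun setT (trig_transform t a).
Proof.
by move=> ia; apply: continuous_measurable_fun; exact: continuous_trig_transform.
Qed.

(** Fubini's theorem, the phase being symmetric in [x] and [w]. *)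
Lemma trig_transform_swap a f : L1R a -> L1R f ->
  \int[mu]_w (trig_transform t a w * f w) = \int[mu]_x (a x * trig_transform t f x).
Proof.
move=> ia jf; have ma := integrable_measurable ia.
have mf := integrable_measurable jf.
pose G (z : measurableTypeR R * measurableTypeR R) : \bar R :=
  (a z.1 * t (2 * pi * z.1 * z.2) * f z.2)%:E.
have mG : measurable_fun setT G.
  apply/measurable_EFinP; apply: measurable_funM; last exact: measurableT_comp.
  apply: measurable_funM; first exact: measurableT_comp.
  apply: measurableT_comp; first exact: continuous_measurable_fun.
  by apply: measurable_funM => //; apply: measurable_funM.
have iG : (mu \x mu)%E.-integrable setT G.
  apply/(integrable12ltyP _ _ mG).
  apply: (@le_lt_trans _ _ (\int[mu]_x (`|(a x)%:E| * \int[mu]_y `|(f y)%:E|)))%E.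
    apply: ge0_le_integral => //.
    - by move=> x _; apply: integral_ge0.
    - apply: (@measurable_fun_fubini_tonelli_F _ _ _ _ _ mu (fun z => `|G z|)%E) => //.
      exact: measurableT_comp.
    - apply: emeasurable_funM; last exact: measurable_cst.
      by do 2 apply: measurableT_comp => //.
    - move=> x _; rewrite -ge0_integralZl//; last first.
        by do 2 apply: measurableT_comp => //.
      apply: ge0_le_integral => //.
      + by apply: measurableT_comp => //; apply: measurableT_comp mG _.
      + by apply: measurable_funeM; do 2 apply: measurableT_comp => //.
      + move=> y _; rewrite /G /= lee_fin !normrM ler_wpM2r// ler_piMr//.
  rewrite ge0_integralZr//.
  - by apply: lte_mul_pinfty; [exact: integral_ge0|
      rewrite ge0_fin_numE ?integral_ge0//; case/integrableP: ia|
      case/integrableP: jf].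
  - by do 2 apply: measurableT_comp => //.
  - by apply: integral_ge0.
have E1 x : (\int[mu]_w G (x, w) = (a x * trig_transform t f x)%:E)%E.
  have i1 := integrable_phase x jf.
  rewrite /trig_transform -RintegralZl// -EFin_Rintegral; last first.
    by apply: (integrableZl measurableT (a x) i1).
  apply: eq_integral => w _; rewrite /G/=; congr EFin.
  rewrite -mulrA; congr (_ * _); rewrite mulrC; congr (_ * _).
  by congr (t _); ring.
have E2 w : (\int[mu]_x G (x, w) = (trig_transform t a w * f w)%:E)%E.
  have i1 := integrable_phase w ia.
  rewrite /trig_transform -RintegralZr// -EFin_Rintegral; last first.
    by apply: (integrableZr measurableT (f w) i1).
  by apply: eq_integral.
have := Fubini iG.
under eq_integral do rewrite E1.
under [X in _ = X -> _]eq_integral do rewrite E2.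
by rewrite /Rintegral => ->.
Qed.

End bounded_kernel.

Lemma continuous_cosR : continuous (@cos R). Proof. exact: continuous_cos. Qed.
Lemma continuous_sinR : continuous (@sin R). Proof. exact: continuous_sin. Qed.
Lemma norm_cos_le1 (x : R) : `|cos x| <= 1.
Proof. by rewrite ler_norml cos_geN1 cos_le1. Qed.
Lemma norm_sin_le1 (x : R) : `|sin x| <= 1.
Proof. by rewrite ler_norml sin_geN1 sin_le1. Qed.

Local Notation cosT := (trig_transform (@cos R)).
Local Notation sinT := (trig_transform (@sin R)).

Lemma integrable_trig_abel t a e : continuous t -> (forall x, `|t x| <= 1) ->
  0 < e -> L1R a -> L1R (fun w => abel e w * trig_transform t a w).
Proof.
move=> ct t1 e0 ia.
apply: (@integrable_bounded_mul (\int[mu]_x `|a x|)).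
- exact: integrable_abel.
- exact: measurable_trig_transform.
- by move=> w; exact: trig_transform_bound.
Qed.

(** The identity that underlies Plancherel's theorem: since the product
    formula turns the sum of squares of the two transforms into the cosine of
    a difference, exchanging integrals leaves the Poisson kernel. *)
Lemma trig_abel_poisson a e : 0 < e -> L1R a ->
  \int[mu]_w ((cosT a w ^+ 2 + sinT a w ^+ 2) * abel e w) =
  \int[mu]_x (a x * \int[mu]_y (a y * poisson e (x - y))).
Proof.
move=> e0 ia.
have ic := integrable_trig_abel continuous_cosR norm_cos_le1 e0 ia.
have is_ := integrable_trig_abel continuous_sinR norm_sin_le1 e0 ia.
pose fc w := abel e w * cosT a w; pose fs w := abel e w * sinT a w.
have i1 : L1R (fun w => cosT a w * fc w).
  under eq_fun do rewrite mulrC.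
  apply: (@integrable_bounded_mul (\int[mu]_x `|a x|)) => //.
    exact: measurable_trig_transform continuous_cosR norm_cos_le1 _ ia.
  by move=> w; exact: trig_transform_bound continuous_cosR norm_cos_le1 _ _ ia.
have i2 : L1R (fun w => sinT a w * fs w).
  under eq_fun do rewrite mulrC.
  apply: (@integrable_bounded_mul (\int[mu]_x `|a x|)) => //.
    exact: measurable_trig_transform continuous_sinR norm_sin_le1 _ ia.
  by move=> w; exact: trig_transform_bound continuous_sinR norm_sin_le1 _ _ ia.
transitivity (\int[mu]_w (cosT a w * fc w + sinT a w * fs w)).
  by apply: eq_Rintegral => w _; rewrite /fc /fs; ring.
rewrite RintegralD//.
rewrite (trig_transform_swap continuous_cosR norm_cos_le1)//.
rewrite (trig_transform_swap continuous_sinR norm_sin_le1)//.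
rewrite -RintegralD//; last 2 first.
- apply: (@integrable_bounded_mul (\int[mu]_x `|fc x|)) => //.
    exact: measurable_trig_transform continuous_cosR norm_cos_le1 _ ic.
  by move=> w; exact: trig_transform_bound continuous_cosR norm_cos_le1 _ _ ic.
- apply: (@integrable_bounded_mul (\int[mu]_x `|fs x|)) => //.
    exact: measurable_trig_transform continuous_sinR norm_sin_le1 _ is_.
  by move=> w; exact: trig_transform_bound continuous_sinR norm_sin_le1 _ _ is_.
apply: eq_Rintegral => x _; rewrite -mulrDr; congr (_ * _).
pose kc w := abel e w * cos (2 * pi * w * x).
pose ks w := abel e w * sin (2 * pi * w * x).
have ikc : L1R kc by apply: integrable_phase continuous_cosR norm_cos_le1 _ _ _;
  exact: integrable_abel.
have iks : L1R ks by apply: integrable_phase continuous_sinR norm_sin_le1 _ _ _;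
  exact: integrable_abel.
rewrite [cosT fc x](_ : _ = \int[mu]_w (cosT a w * kc w)); last first.
  by apply: eq_Rintegral => w _; rewrite /fc /kc; ring.
rewrite [sinT fs x](_ : _ = \int[mu]_w (sinT a w * ks w)); last first.
  by apply: eq_Rintegral => w _; rewrite /fs /ks; ring.
rewrite (trig_transform_swap continuous_cosR norm_cos_le1)//.
rewrite (trig_transform_swap continuous_sinR norm_sin_le1)//.
rewrite -RintegralD//; last 2 first.
- apply: (@integrable_bounded_mul (\int[mu]_x `|kc x|)) => //.
    exact: measurable_trig_transform continuous_cosR norm_cos_le1 _ ikc.
  by move=> w; exact: trig_transform_bound continuous_cosR norm_cos_le1 _ _ ikc.
- apply: (@integrable_bounded_mul (\int[mu]_x `|ks x|)) => //.
    exact: measurable_trig_transform continuous_sinR norm_sin_le1 _ iks.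
  by move=> w; exact: trig_transform_bound continuous_sinR norm_sin_le1 _ _ iks.
apply: eq_Rintegral => y _; rewrite -mulrDr; congr (_ * _).
rewrite /trig_transform -RintegralD//; last 2 first.
- exact: integrable_phase continuous_cosR norm_cos_le1 _ _ ikc.
- exact: integrable_phase continuous_sinR norm_sin_le1 _ _ iks.
rewrite /poisson -integral_abel_cos//; apply: eq_Rintegral => w _.
rewrite /kc /ks.
rewrite (_ : 2 * pi * (x - y) * w = 2 * pi * w * x - 2 * pi * w * y); last by ring.
by rewrite cosB; ring.
Qed.

End TrigTransforms.


(** * The Plancherel identity with an Abel weight *)

Section RealPlancherel.
Context {R : realType}.
Local Notation mu := (@lebesgue_measure R).
Local Notation L1R f := (mu.-integrable setT (EFin \o (f : R -> R))).
Implicit Types (a f g t : R -> R) (e : R).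
Local Notation cosT := (trig_transform (@cos R)).
Local Notation sinT := (trig_transform (@sin R)).
Local Notation RR := (measurableTypeR R).
Local Notation mu2 := (mu \x mu)%E.

(** The square of the L^2 modulus of continuity of [a]. *)
Definition translation_modulus a (t : R) : \bar R :=
  (\int[mu]_x ((a x - a (t + x)) ^+ 2)%:E)%E.

Lemma continuous_poisson_sub e x : 0 < e -> continuous (fun y => poisson e (x - y)).
Proof.
move=> e0 y; apply: (@continuous_comp _ _ _ (fun y : R => x - y) (poisson e)).
  by apply: cvgB; [exact: cvg_cst|exact: cvg_id].
exact: continuous_poisson.
Qed.

Lemma measurable_poisson_diff e : 0 < e ->
  measurable_fun setT (fun z : RR * RR => poisson e (z.1 - z.2)).
Proof.
move=> e0; apply: (@measurableT_comp _ _ _ _ _ _ (poisson e)).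
  by apply: continuous_measurable_fun; exact: continuous_poisson.
exact: measurable_funB.
Qed.

Lemma integral_poisson_diff e x : 0 < e ->
  (\int[mu]_y (poisson e (x - y))%:E = 1)%E.
Proof.
move=> e0; rewrite -(integral_poisson e0).
rewrite -(@ge0_integral_shift R (- x) (fun y => (poisson e y)%:E)); last 2 first.
- apply/measurable_EFinP; apply: continuous_measurable_fun.
  exact: continuous_poisson.
- by move=> y; rewrite lee_fin ltW// poisson_gt0.
by apply: eq_integral => y _; rewrite -poissonN opprB.
Qed.

Lemma integral2_sqr_poisson a e : 0 < e -> measurable_fun setT a ->
  (\int[mu2]_z (a z.1 ^+ 2 * poisson e (z.1 - z.2))%:E =
    \int[mu]_x (a x ^+ 2)%:E)%E /\
  (\int[mu2]_z (a z.2 ^+ 2 * poisson e (z.1 - z.2))%:E =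
    \int[mu]_x (a x ^+ 2)%:E)%E.
Proof.
move=> e0 ma; have K0 x : 0 <= poisson e x by rewrite ltW// poisson_gt0.
have mK x : measurable_fun setT (fun y : RR => (poisson e (x - y))%:E).
  apply/measurable_EFinP; apply: continuous_measurable_fun.
  exact: continuous_poisson_sub.
split.
  rewrite fubini_tonelli1/=; last 2 first.
  - apply/measurable_EFinP; apply: measurable_funM; last exact: measurable_poisson_diff.
    by apply: measurable_funX; exact: measurableT_comp.
  - by move=> z; rewrite lee_fin mulr_ge0// sqr_ge0.
  apply: eq_integral => x _; rewrite /fubini_F/=.
  under eq_integral do rewrite EFinM.
  rewrite ge0_integralZl ?lee_fin ?sqr_ge0//; last by move=> y _; rewrite lee_fin.
  by rewrite integral_poisson_diff// mule1.
rewrite fubini_tonelli2/=; last 2 first.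
- apply/measurable_EFinP; apply: measurable_funM; last exact: measurable_poisson_diff.
  by apply: measurable_funX; exact: measurableT_comp.
- by move=> z; rewrite lee_fin mulr_ge0// sqr_ge0.
apply: eq_integral => x _; rewrite /fubini_G/=.
under eq_integral => y _ do rewrite -poissonN opprB EFinM.
rewrite ge0_integralZl ?lee_fin ?sqr_ge0//; last by move=> y _; rewrite lee_fin.
by rewrite integral_poisson_diff// mule1.
Qed.

(** The substitution y = t + x separates the kernel, which then depends on
    t alone. *)
Lemma integral2_diff_poisson a e : 0 < e -> measurable_fun setT a ->
  (\int[mu2]_z ((a z.1 - a z.2) ^+ 2 * poisson e (z.1 - z.2))%:E =
    \int[mu]_t ((poisson e t)%:E * translation_modulus a t))%E.
Proof.
move=> e0 ma; have K0 x : 0 <= poisson e x by rewrite ltW// poisson_gt0.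
have mk : measurable_fun setT (poisson e).
  by apply: continuous_measurable_fun; exact: continuous_poisson.
rewrite fubini_tonelli1/=; last 2 first.
- apply/measurable_EFinP; apply: measurable_funM; last exact: measurable_poisson_diff.
  by apply: measurable_funX; apply: measurable_funB; exact: measurableT_comp.
- by move=> z; rewrite lee_fin mulr_ge0// sqr_ge0.
pose h (z : RR * RR) : \bar R := ((a z.1 - a (z.2 + z.1)) ^+ 2 * poisson e z.2)%:E.
have mh : measurable_fun setT h.
  apply/measurable_EFinP; apply: measurable_funM; last exact: measurableT_comp.
  apply: measurable_funX; apply: measurable_funB; first exact: measurableT_comp.
  by apply: (@measurableT_comp _ _ _ _ _ _ a) => //; exact: measurable_funD.
have h0 z : (0 <= h z)%E by rewrite lee_fin mulr_ge0// sqr_ge0.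
transitivity (\int[mu]_x \int[mu]_t h (x, t))%E.
  apply: eq_integral => x _; rewrite /fubini_F/=.
  rewrite -(@ge0_integral_shift R x); last 2 first.
  - apply/measurable_EFinP; apply: measurable_funM.
      by apply: measurable_funX; apply: measurable_funB.
    by apply: continuous_measurable_fun; exact: continuous_poisson_sub.
  - by move=> y; rewrite lee_fin mulr_ge0// sqr_ge0.
  apply: eq_integral => t _; rewrite /h/=; congr (_ * _)%:E.
  by rewrite opprD addrCA subrr addr0 poissonN.
rewrite (@fubini_tonelli _ _ _ _ R mu mu h)//.
apply: eq_integral => t _; rewrite /translation_modulus -ge0_integralZl//.
- by apply: eq_integral => x _; rewrite /h/= mulrC EFinM.
- apply/measurable_EFinP; apply: measurable_funX; apply: measurable_funB => //.
  by apply: measurableT_comp => //; exact: measurable_funD.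
- by move=> x _; rewrite lee_fin sqr_ge0.
- by rewrite lee_fin.
Qed.

(** By [trig_abel_poisson] and the identity
    2 a(x) a(y) = a(x)^2 + a(y)^2 - (a(x) - a(y))^2: the kernel has integral 1
    in each variable, so the two squares contribute the whole of the energy. *)
Lemma trig_abel_identity a e : 0 < e -> L1R a -> (\int[mu]_x (a x ^+ 2)%:E < +oo)%E ->
  (\int[mu]_w ((cosT a w ^+ 2 + sinT a w ^+ 2) * abel e w)%:E +
    (2^-1)%:E * \int[mu]_t ((poisson e t)%:E * translation_modulus a t) =
    \int[mu]_x (a x ^+ 2)%:E)%E.
Proof.
move=> e0 ia a2; have ma := integrable_measurable ia.
have K0 x : 0 <= poisson e x by rewrite ltW// poisson_gt0.
have [P1 P2] := integral2_sqr_poisson e0 ma.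
have m1 : measurable_fun setT (fun z : RR * RR => a z.1) by exact: measurableT_comp.
have m2 : measurable_fun setT (fun z : RR * RR => a z.2) by exact: measurableT_comp.
have mK := measurable_poisson_diff e0.
have i1 : mu2.-integrable setT (fun z => (a z.1 ^+ 2 * poisson e (z.1 - z.2))%:E).
  apply/integrableP; split.
    apply/measurable_EFinP; apply: measurable_funM; last exact: mK.
    exact: (measurable_funX 2).
  rewrite (_ : (\int[mu2]_z _)%E = \int[mu]_x (a x ^+ 2)%:E)%E// -P1.
  by apply: eq_integral => z _; rewrite gee0_abs// lee_fin mulr_ge0// sqr_ge0.
have i2 : mu2.-integrable setT (fun z => (a z.2 ^+ 2 * poisson e (z.1 - z.2))%:E).
  apply/integrableP; split.
    apply/measurable_EFinP; apply: measurable_funM; last exact: mK.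
    exact: (measurable_funX 2).
  rewrite (_ : (\int[mu2]_z _)%E = \int[mu]_x (a x ^+ 2)%:E)%E// -P2.
  by apply: eq_integral => z _; rewrite gee0_abs// lee_fin mulr_ge0// sqr_ge0.
have i12 := integrableD measurableT i1 i2.
have iQ : mu2.-integrable setT
    (fun z => (2^-1 * ((a z.1 - a z.2) ^+ 2 * poisson e (z.1 - z.2)))%:E).
  apply: le_integrable i12 => //.
    apply/measurable_EFinP; apply: measurable_funM => //; apply: measurable_funM => //.
    by apply: measurable_funX; exact: measurable_funB.
  move=> z _ /=; rewrite lee_fin !ger0_norm; last 2 first.
  - by rewrite addr_ge0// mulr_ge0// sqr_ge0.
  - by rewrite mulr_ge0// mulr_ge0// sqr_ge0.
  rewrite mulrA -mulrDl ler_wpM2r//.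
  have := sqr_ge0 (a z.1 + a z.2); nra.
have if_ : mu2.-integrable setT (fun z => (a z.1 * a z.2 * poisson e (z.1 - z.2))%:E).
  apply: le_integrable i12 => //.
    by apply/measurable_EFinP; apply: measurable_funM => //; apply: measurable_funM.
  move=> z _ /=; rewrite lee_fin normrM [leRHS]ger0_norm; last first.
    by rewrite addr_ge0// mulr_ge0// sqr_ge0.
  rewrite (ger0_norm (K0 _)) -mulrDl ler_wpM2r//.
  rewrite ler_norml; apply/andP; split.
    have := sqr_ge0 (a z.1 + a z.2); have := sqr_ge0 (a z.1); have := sqr_ge0 (a z.2); nra.
  have := sqr_ge0 (a z.1 - a z.2); have := sqr_ge0 (a z.1); have := sqr_ge0 (a z.2); nra.
have EJ : (\int[mu]_w ((cosT a w ^+ 2 + sinT a w ^+ 2) * abel e w)%:E =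
    \int[mu2]_z (a z.1 * a z.2 * poisson e (z.1 - z.2))%:E)%E.
  have mf := @integral12_prod_meas1 _ _ _ _ R mu mu _ if_.
  rewrite -mf EFin_Rintegral.
    rewrite trig_abel_poisson//.
    have inner x : (\int[mu]_y (a x * a y * poisson e (x - y))%:E =
        (a x * \int[mu]_y (a y * poisson e (x - y)))%:E)%E.
      have iy : L1R (fun y => a y * poisson e (x - y)).
        apply: (@integrable_bounded_mul _ (2 / e)) => //.
          by apply: continuous_measurable_fun; exact: continuous_poisson_sub.
        move=> y; rewrite ger0_norm// /poisson.
        rewrite ler_pdivrMr ?poisson_den_gt0// mulrAC ler_pdivlMr//.
        have := sqr_ge0 (2 * pi * (x - y)); nra.
      rewrite -RintegralZl// -EFin_Rintegral; last by apply: (integrableZl measurableT (a x) iy).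
      by apply: eq_integral => y _; rewrite mulrA.
    rewrite -EFin_Rintegral.
      by apply: eq_integral => x _; rewrite /fubini_F/= inner.
    have := integrable_fubini_F if_.
    by rewrite /fubini_F/=; under eq_fun do rewrite inner.
  have sq t : continuous t -> (forall x, `|t x| <= 1) ->
      L1R (fun w => abel e w * trig_transform t a w * trig_transform t a w).
    move=> ct t1; apply: (@integrable_bounded_mul _ (\int[mu]_x `|a x|)).
    - exact: integrable_trig_abel.
    - exact: measurable_trig_transform.
    - by move=> w; exact: trig_transform_bound.
  have := integrableD measurableT (sq _ continuous_cosR norm_cos_le1)
    (sq _ continuous_sinR norm_sin_le1).
  apply: eq_integrable => // w _ /=.
  by rewrite -EFinD; congr EFin; ring.
rewrite EJ -integral2_diff_poisson// -ge0_integralZl//; last 2 first.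
- apply/measurable_EFinP; apply: measurable_funM => //.
  by apply: measurable_funX; exact: measurable_funB.
- by move=> z _; rewrite lee_fin mulr_ge0// sqr_ge0.
rewrite -integralD//.
rewrite -[RHS]mul1e (_ : 1%E = (2^-1)%:E * (1 + 1))%E; last first.
  by rewrite -EFinD -EFinM; congr EFin; field.
rewrite -muleA ge0_muleDl// !mul1e -{1}P1 -P2.
rewrite -integralD// -ge0_integralZl//; last first.
  by move=> z _; rewrite adde_ge0// lee_fin mulr_ge0// sqr_ge0.
  by case/integrableP: i12.
by apply: eq_integral => z _ /=; rewrite -!EFinD -EFinM; congr EFin; field.
Qed.

End RealPlancherel.


(** * Translations of truncated continuous functions *)

Section TranslationContinuity.
Context {R : realType}.
Local Notation mu := (@lebesgue_measure R).
Local Notation N f := (cLnorm 2%:E f).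
Implicit Types (a b g : R -> R).
Local Open Scope ereal_scope.

Definition rLnorm a : \bar R := N (fun x => (a x)%:C%C).

Lemma rLnorm_sqr a : rLnorm a ^+ 2 = \int[mu]_x (a x ^+ 2)%:E.
Proof.
rewrite /rLnorm cLnorm_sqr; apply: eq_integral => x _.
by rewrite normc_real real_normK// num_real.
Qed.

Lemma realcB (x y : R) : ((x - y)%:C%C = x%:C%C - y%:C%C :> R[i])%R.
Proof. by rewrite -complexr0 /= /real_complex_def; congr Complex; rewrite ?subr0 ?oppr0 ?addr0. Qed.

Lemma rLnorm_triangle a b g :
  measurable_fun setT a -> measurable_fun setT b -> measurable_fun setT g ->
  rLnorm (fun x => a x - g x)%R <=
  rLnorm (fun x => a x - b x)%R + rLnorm (fun x => b x - g x)%R.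
Proof.
move=> ma mb mg; rewrite /rLnorm.
under eq_fun do rewrite realcB.
under [X in _ <= cLnorm _ X + _]eq_fun do rewrite realcB.
under [X in _ <= _ + cLnorm _ X]eq_fun do rewrite realcB.
by apply: cLnorm_triangle; exact: cmeasurable_real.
Qed.

Lemma rLnormB a b : rLnorm (fun x => a x - b x)%R = rLnorm (fun x => b x - a x)%R.
Proof.
rewrite /rLnorm; under eq_fun do rewrite realcB.
by under [in RHS]eq_fun do rewrite realcB; rewrite cLnormB.
Qed.

Lemma measurable_comp_shift a (t : R) : measurable_fun setT a ->
  measurable_fun setT (fun x => a (t + x)%R).
Proof.
move=> ma; apply: measurableT_comp => //.
by apply: measurable_funD => //; exact: measurable_cst.
Qed.

Lemma rLnorm_shift a (t : R) : measurable_fun setT a ->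
  rLnorm (fun x => a (t + x)%R) = rLnorm a.
Proof.
move=> ma; rewrite /rLnorm !cLnorm_sqrt; congr sqrte.
rewrite -[RHS](ge0_integral_shift t).
- by apply: eq_integral => x _; rewrite addrC.
- by apply: measurable_EFin_normc_sqr; exact: cmeasurable_real.
- by move=> x; rewrite lee_fin sqr_ge0.
Qed.

Definition cutoff (n : R) a (x : R) : R := if (`|x| <= n)%R then a x else 0%R.

Lemma measurable_cutoff n a : measurable_fun setT a -> measurable_fun setT (cutoff n a).
Proof.
move=> ma; apply: measurable_fun_ifT => //.
by apply: measurable_fun_ler => //; exact: measurableT_comp.
Qed.

Lemma L2_bounded_support (f : R -> R[i]) (c n : R) : cmeasurable f ->
  (forall x, Normc.normc (f x) <= c)%R -> (forall x, n < `|x| -> f x = 0)%R -> L2 f.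
Proof.
move=> mf fc f0; split => //; change (N f < +oo); rewrite cLnorm_sqrt.
have c0 : (0 <= c)%R := le_trans (normc_ge0 _) (fc 0%R).
suff : \int[mu]_x (Normc.normc (f x) ^+ 2)%:E < +oo.
  by move=> fin; rewrite -ge0_fin_numE ?sqrte_ge0// sqrte_fin_num ?int_normc_sqr_ge0//
    ge0_fin_numE ?int_normc_sqr_ge0.
apply: (@le_lt_trans _ _ (\int[mu]_x ((c ^+ 2)%:E * (\1_(`[(- n)%R, n]%classic) x)%:E))).
  apply: ge0_le_integral => //.
  - by move=> x _; rewrite lee_fin sqr_ge0.
  - exact: measurable_EFin_normc_sqr.
  - apply: measurable_funeM; apply/measurable_EFinP.
    exact: measurable_indic.
  - move=> x _; rewrite -EFinM lee_fin indicE.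
    have [xn|xn] := leP `|x|%R n.
      rewrite (_ : (x \in _) = true) ?mulr1; last first.
        by apply/mem_set => /=; rewrite in_itv/= -ler_norml.
      by rewrite ler_pXn2r// ?nnegrE ?normc_ge0.
    by rewrite f0// Normc.normc0 expr0n/= mulr_ge0// sqr_ge0.
rewrite ge0_integralZl// ?lee_fin ?sqr_ge0//; last first.
  by apply/measurable_EFinP; exact: measurable_indic.
rewrite integral_indic// setIT lte_mul_pinfty ?lee_fin ?sqr_ge0//.
by rewrite /= lebesgue_measure_itv/=; case: ifPn => // _; rewrite -EFinD ltry.
Qed.

Lemma cutoff_bound n a (c : R) : (forall x, `|a x| <= c)%R ->
  forall x, (`|cutoff n a x| <= c)%R.
Proof.
move=> ac x; rewrite /cutoff; case: ifPn => // _.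
by rewrite normr0 (le_trans _ (ac 0%R)).
Qed.

Lemma L2_cutoff n a (c : R) : measurable_fun setT a -> (forall x, `|a x| <= c)%R ->
  L2 (fun x => (cutoff n a x)%:C%C).
Proof.
move=> ma ac; apply: (@L2_bounded_support _ c n).
- by apply: cmeasurable_real; exact: measurable_cutoff.
- by move=> x; rewrite normc_real; exact: cutoff_bound.
- by move=> x xn; rewrite /cutoff leNgt xn.
Qed.

(** A truncated continuous function is continuous except at two points, so
    dominated convergence excludes a sequence of translations tending to 0 along
    which the claim fails. *)
Lemma cutoff_translation (n c : R) g : continuous g -> (forall x, `|g x| <= c)%R ->
  forall e : R, (0 < e)%R -> exists2 d : R, (0 < d)%R & forall t, (`|t| < d)%R ->
    rLnorm (fun x => cutoff n g x - cutoff n g (t + x))%R < e%:E.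
Proof.
move=> cg gc e e0; apply/not_exists2P => H.
have c0 : (0 <= c)%R := le_trans (normr_ge0 _) (gc 0%R).
have mg : measurable_fun setT g by exact: continuous_measurable_fun.
have tk (k : nat) : exists t : R, (`|t| < k.+1%:R^-1)%R /\
    ~ (rLnorm (fun x => cutoff n g x - cutoff n g (t + x))%R < e%:E).
  have [] := H (k.+1%:R^-1)%R; first by rewrite invr_gt0.
  by move=> /existsNP[t /not_implyP[tk te]]; exists t.
pose t k := projT1 (cid (tk k)).
have tlt k : (`|t k| < k.+1%:R^-1)%R by rewrite /t; case: cid => ? [].
have tN k : ~ (rLnorm (fun x => cutoff n g x - cutoff n g (t k + x))%R < e%:E).
  by rewrite /t; case: cid => ? [].
have t0 : t k @[k --> \oo] --> (0 : R)%R.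
  apply/cvgr0Pnorm_lt => r r0; near=> k; apply: lt_trans (tlt k) _.
  by near: k; exact: near_infty_natSinv_lt (PosNum r0).
suff : exists k, rLnorm (fun x => cutoff n g x - cutoff n g (t k + x))%R < e%:E.
  by move=> [k]; exact: tN.
have := @cLnorm_dominated R (fun k x => (cutoff n g x - cutoff n g (t k + x))%:C%C)%R
  (fun x => (cutoff (n + 1) (fun=> 2 * c) x)%:C%C)%R.
move=> /(_ _ _ _ _ e e0).
have H1 : forall k, cmeasurable (fun x => (cutoff n g x - cutoff n g (t k + x))%:C%C)%R.
  move=> k; apply: cmeasurable_real; apply: measurable_funB.
    exact: measurable_cutoff.
  by apply: measurable_comp_shift; exact: measurable_cutoff.
have H2 : L2 (fun x => (cutoff (n + 1) (fun=> 2 * c) x)%:C%C)%R.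
  apply: (@L2_cutoff _ _ `|2 * c|%R) => //; exact: measurable_cst.
have H3 k x : (Normc.normc (cutoff n g x - cutoff n g (t k + x))%:C%C <=
    Normc.normc (cutoff (n + 1) (fun=> 2 * c) x)%:C%C)%R.
  rewrite !normc_real {3}/cutoff; case: ifPn => [_|].
    rewrite [leRHS]ger0_norm ?mulr_ge0//.
    by rewrite (le_trans (ler_normB _ _))// mulr_natl mulr2n lerD// cutoff_bound.
  rewrite -ltNge => xn.
  have tk1 : (`|t k| < 1)%R by rewrite (lt_le_trans (tlt k))// invf_le1// ler1n.
  have x1 : (`|x| <= n)%R = false by apply/negbTE; rewrite -ltNge; lra.
  have x2 : (`|t k + x| <= n)%R = false.
    apply/negbTE; rewrite -ltNge.
    have := ler_normB (t k + x)%R (t k); rewrite addrAC subrr add0r; lra.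
  by rewrite /cutoff x1 x2 subrr.
have H4 : {ae mu, forall x, Normc.normc (cutoff n g x - cutoff n g (t k + x))%:C%C
    @[k --> \oo] --> (0 : R)%R}.
  exists [set x | `|x|%R = n]; split.
  - rewrite (_ : [set x | _] = (@Num.norm R R) @^-1` [set n])//.
    by rewrite -[X in measurable X]setTI; exact: normr_measurable.
  - apply: countable_lebesgue_measure0.
    apply: (@sub_countable _ _ _ [set n; - n]%R); last first.
      exact/finite_set_countable/finite_set2.
    apply: subset_card_le => x /= xn.
    by have [x0|x0] := leP 0%R x; move: xn; rewrite ?(ger0_norm x0) ?(ltr0_norm x0) => <-;
      [left|right; rewrite opprK].
  - move=> x; apply: contra_notP => xn.
    have tx : (t k + x)%R @[k --> \oo] --> x.
      by rewrite -[X in _ --> X]add0r; apply: cvgD => //; exact: cvg_cst.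
    suff gx : cutoff n g y @[y --> x] --> cutoff n g x.
      have gtx : cutoff n g (t k + x)%R @[k --> \oo] --> cutoff n g x.
        exact: (@cvg_comp _ _ _ _ _ _ _ _ tx gx).
      have E : (fun k => `|cutoff n g x - cutoff n g (t k + x)|%R) =
          (fun k => Normc.normc (cutoff n g x - cutoff n g (t k + x))%:C%C).
        by apply/funext => k; rewrite normc_real.
      suff : (fun k => `|cutoff n g x - cutoff n g (t k + x)|%R) @ \oo --> (0 : R)%R.
        by rewrite E.
      rewrite -[X in _ --> X](normr0 R) -(subrr (cutoff n g x)).
      by apply: cvg_norm; apply: cvgB => //; exact: cvg_cst.
    have [xn'|xn'] := ltP `|x|%R n.
      have -> : cutoff n g x = g x by rewrite /cutoff ltW.
      apply: cvg_trans (cg x); apply: near_eq_cvg; near=> y.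
      rewrite /cutoff ltW//.
      by near: y; apply: (@cvgr_lt R R (nbhs (x : R)) _ (@Num.norm R R) `|x|%R) => //; exact: norm_continuous.
    have {}xn' : (n < `|x|)%R by rewrite lt_neqAle xn' andbT eq_sym; apply/eqP.
    have -> : cutoff n g x = 0%R by rewrite /cutoff leNgt xn'.
    have c0' : (fun=> 0%R : R) @ (x : R) --> (0 : R)%R by exact: cvg_cst.
    apply: cvg_trans c0'; apply: near_eq_cvg; near=> y.
    rewrite /cutoff leNgt (_ : (n < `|y|)%R)//.
    by near: y; apply: (@cvgr_gt R R (nbhs (x : R)) _ (@Num.norm R R) `|x|%R) => //; exact: norm_continuous.
by move=> /(_ H1 H2 H3 H4)[k _ /(_ k (leqnn k))] ?; exists k.
Unshelve. all: by end_near. Qed.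

End TranslationContinuity.


(** * Density of truncated continuous functions in L^2 *)

Section Density.
Context {R : realType}.
Local Notation mu := (@lebesgue_measure R).
Implicit Types (a b g : R -> R).

Definition clip (c y : R) : R := Num.max (- c) (Num.min c y).

Lemma clip_bound c y : 0 <= c -> `|clip c y| <= c.
Proof.
move=> c0; rewrite ler_norml /clip le_max lexx/= ge_max ge_min lexx/= andbT; lra.
Qed.

Lemma clip_id c y : `|y| <= c -> clip c y = y.
Proof.
rewrite ler_norml => /andP[h1 h2].
by rewrite /clip (min_idPr h2) (max_idPr h1).
Qed.

Lemma clip_dist c y z : `|clip c y - clip c z| <= `|y - z|.
Proof.
rewrite ler_norml /clip; have [n1|n1] := ler0P (y - z); apply/andP; split;
  case: (leP c y) => h1; case: (leP c z) => h2;
  do ?[case: (leP (- c) c) => h3]; do ?[case: (leP (- c) y) => h4];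
  do ?[case: (leP (- c) z) => h5]; lra.
Qed.

Lemma continuous_clip c : continuous (clip c).
Proof.
move=> y; apply/cvgrPdist_lt => e e0; near=> z.
apply: le_lt_trans (clip_dist _ _ _) _.
by near: z; exact: (@cvgr_dist_lt _ R R (nbhs y) _ id y (@cvg_id _ _)).
Unshelve. all: by end_near. Qed.

Lemma clip_sub c y : 0 <= c -> `|y - clip c y| <= `|y|.
Proof.
move=> c0; rewrite ler_norml /clip; have [n1|n1] := ler0P y; apply/andP; split;
  case: (leP c y) => h1; do ?[case: (leP (- c) c) => h3];
  do ?[case: (leP (- c) y) => h4]; lra.
Qed.

Lemma measurable_clip c a : measurable_fun setT a ->
  measurable_fun setT (fun x => clip c (a x)).
Proof.
move=> mf; apply: measurableT_comp => //.
by apply: continuous_measurable_fun; exact: continuous_clip.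
Qed.

(** Truncating both the argument and the value reduces the approximation of a
   square-integrable function to that of a bounded one on a bounded interval. *)
Lemma truncation_approx a (e : R) : L2 (fun x => (a x)%:C%C) -> 0 < e ->
  exists k : nat,
    (rLnorm (fun x => a x - cutoff k%:R (fun y => clip k%:R (a y)) x)%R < e%:E)%E.
Proof.
move=> La e0; have ma : measurable_fun setT a by have [[]] := La.
have := @cLnorm_dominated R
  (fun k x => (a x - cutoff k%:R (fun y => clip k%:R (a y)) x)%:C%C)
  (fun x => (a x)%:C%C).
move=> /(_ _ La _ _ e e0).
have H1 (k : nat) : cmeasurable
    (fun x => (a x - cutoff k%:R (fun y => clip k%:R (a y)) x)%:C%C).
  apply: cmeasurable_real; apply: measurable_funB => //.
  by apply: measurable_cutoff; exact: measurable_clip.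
have H2 (k : nat) x :
    Normc.normc (a x - cutoff k%:R (fun y => clip k%:R (a y)) x)%:C%C <=
    Normc.normc (a x)%:C%C.
  by rewrite !normc_real /cutoff; case: ifPn => _; rewrite ?subr0// clip_sub.
have H3 : {ae mu, forall x,
    Normc.normc (a x - cutoff k%:R (fun y => clip k%:R (a y)) x)%:C%C
    @[k --> \oo] --> (0 : R)}.
  apply: ae_all => x; apply/cvgr0Pnorm_lt => r r0; near=> k.
  rewrite normc_real /cutoff.
  have -> : `|x| <= k%:R by near: k; exact: nbhs_infty_ger.
  rewrite clip_id; last by near: k; exact: nbhs_infty_ger.
  by rewrite subrr !normr0.
by move=> /(_ H1 H2 H3)[k _ /(_ k (leqnn k))] ?; exists k.
Unshelve. all: by end_near. Qed.

Lemma bounded_integrable_itv (c k : R) a : measurable_fun setT a ->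
  (forall x, `|a x| <= c) -> mu.-integrable `[(- k), k] (EFin \o a).
Proof.
move=> ma ac.
apply: (@measurable_bounded_integrable _ _ R mu) => //.
- by rewrite /= lebesgue_measure_itv/=; case: ifPn => // _; rewrite -EFinD ltry.
- exact: measurable_funTS.
- exists c; split; first exact: num_real.
  by move=> M cM x _; apply: le_trans (ac x) _; exact: ltW.
Qed.

(** Continuous functions are dense in L^1 of a bounded interval, and clipping
    an approximant bounds the square of the error by 2 c times the error. *)
Lemma bounded_cutoff_approx a (k c e : R) : measurable_fun setT a -> 0 < c ->
  (forall x, `|a x| <= c) -> 0 < e ->
  exists2 g, continuous g /\ (forall x, `|g x| <= c) &
    (rLnorm (fun x => cutoff k a x - cutoff k g x)%R < e%:E)%E.
Proof.
move=> ma c0 ac e0.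
have ia := bounded_integrable_itv k ma ac.
have mukfin : (mu `[(- k)%R, k]%classic < +oo)%E.
  by rewrite /= lebesgue_measure_itv/=; case: ifPn => // _; rewrite -EFinD ltry.
have [g_ [cg ig]] := approximation_continuous_integrable (measurable_itv _) mukfin ia.
have ec0 : 0 < e ^+ 2 / (2 * c) by rewrite divr_gt0 ?exprn_gt0 ?mulr_gt0.
move=> /fine_cvgP[gfin /cvgr0Pnorm_lt /(_ _ ec0) gc].
have [n _ /(_ n (leqnn n))[gnfin gn]] : \forall n \near \oo,
   (\int[mu]_(z in `[(- k)%R, k]) `|(a z - g_ n z)%R%:E|)%E \is a fin_num /\
   `|(fine \o (fun n => \int[mu]_(z in `[(- k)%R, k]) `|(a z - g_ n z)%R%:E|)%E) n|
     < e ^+ 2 / (2 * c).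
  by near=> n; split; near: n.
have mg : measurable_fun setT (g_ n) by exact: continuous_measurable_fun.
exists (fun x => clip c (g_ n x)).
  split; last by move=> x; rewrite clip_bound// ltW.
  move=> x; apply: continuous_comp; [exact: cg|exact: continuous_clip].
have mI : measurable_fun setT (fun x => `|(a x - g_ n x)%:E|%E).
  by apply: measurableT_comp => //; apply/measurable_EFinP; exact: measurable_funB.
apply: lte_sqrE; first by rewrite lee_fin ltW.
rewrite rLnorm_sqr -EFin_expe.
apply: (@le_lt_trans _ _ ((2 * c)%:E *
    \int[mu]_(z in `[(- k)%R, k]) `|(a z - g_ n z)%R%:E|)%E); last first.
  rewrite -(fineK gnfin) -EFinM lte_fin -ltr_pdivlMl ?mulr_gt0// mulrC.
  by rewrite (le_lt_trans (ler_norm _)).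
rewrite -ge0_integralZl//; last 2 first.
- exact: measurable_funTS.
- by rewrite lee_fin mulr_ge0// ltW.
rewrite [leRHS]integral_mkcond; apply: ge0_le_integral => //.
- by move=> x _; rewrite lee_fin sqr_ge0.
- apply/measurable_EFinP; apply: measurable_funX; apply: measurable_funB.
    exact: measurable_cutoff.
  by apply: measurable_cutoff; exact: measurable_clip.
- apply/(measurable_restrictT _ _).1 => //.
  by apply: measurable_funTS; apply: measurable_funeM.
- move=> x _; rewrite patchE mem_setE in_itv/= -ler_norml /cutoff.
  case: ifPn => _; last by rewrite subrr expr0n.
  rewrite -EFinM lee_fin -real_normK ?num_real// expr2 ler_pM//.
    by rewrite (le_trans (ler_normB _ _))// mulr_natl mulr2n lerD// clip_bound// ltW.
  by rewrite -{1}(clip_id (ac x)); exact: clip_dist.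
Unshelve. all: by end_near. Qed.

Lemma L2_cutoff_approx a (e : R) : L2 (fun x => (a x)%:C%C) -> 0 < e ->
  exists n c g, [/\ continuous g, (forall x, `|g x| <= c) &
    (rLnorm (fun x => a x - cutoff n g x)%R < e%:E)%E].
Proof.
move=> La e0; have ma : measurable_fun setT a by have [[]] := La.
have e2 : 0 < e / 2 by rewrite divr_gt0.
have [k ak] := truncation_approx La e2.
have mc := measurable_clip k%:R ma.
have [|x|g [cg gc] ag] := @bounded_cutoff_approx _ k%:R (k%:R + 1) _ mc _ _ e2.
- by rewrite ltr_wpDl.
- by rewrite (le_trans (clip_bound _ _))// lerDl.
exists k%:R, (k%:R + 1), g; split => //.
apply: le_lt_trans (rLnorm_triangle ma (measurable_cutoff k%:R mc) _) _.
  by apply: measurable_cutoff; exact: continuous_measurable_fun.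
by rewrite [e]splitr EFinD lteD.
Qed.

End Density.


(** * Plancherel's identity for real functions *)

Section Plancherel.
Context {R : realType}.
Local Notation mu := (@lebesgue_measure R).
Local Notation L1R f := (mu.-integrable setT (EFin \o (f : R -> R))).
Local Notation cosT := (trig_transform (@cos R)).
Local Notation sinT := (trig_transform (@sin R)).
Implicit Types (a b g : R -> R) (e t : R).

Lemma measurable_realc a : L2 (fun x => (a x)%:C%C) -> measurable_fun setT a.
Proof. by case=> -[]. Qed.

Lemma rLnorm_fin a : L2 (fun x => (a x)%:C%C) -> (rLnorm a \is a fin_num)%E.
Proof. by case=> _ Na; rewrite ge0_fin_numE ?cLnorm_ge0. Qed.

(** Translations are isometries, so the property passes from truncated
    continuous functions to their limits. *)
Lemma translation_continuity a e : L2 (fun x => (a x)%:C%C) -> 0 < e ->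
  exists2 d : R, 0 < d & forall t, `|t| < d ->
    (rLnorm (fun x => a x - a (t + x))%R < e%:E)%E.
Proof.
move=> La e0; have ma := measurable_realc La.
have e3 : 0 < e / 3 by rewrite divr_gt0.
have [n [c [g [cg gc ag]]]] := L2_cutoff_approx La e3.
have [d d0 gd] := cutoff_translation n cg gc e3.
exists d => // t td.
have mg : measurable_fun setT (cutoff n g).
  by apply: measurable_cutoff; exact: continuous_measurable_fun.
have mat := measurable_comp_shift t ma.
have mgt := measurable_comp_shift t mg.
apply: le_lt_trans (rLnorm_triangle ma mg mat) _.
apply: (@le_lt_trans _ _ (rLnorm (fun x => a x - cutoff n g x)%R +
  (rLnorm (fun x => cutoff n g x - cutoff n g (t + x))%R +
   rLnorm (fun x => cutoff n g (t + x) - a (t + x))%R))%E).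
  by apply: leeD => //; exact: rLnorm_triangle.
rewrite (_ : e%:E = (e / 3)%:E + ((e / 3)%:E + (e / 3)%:E))%E; last first.
  by rewrite -!EFinD; congr EFin; field.
apply: lteD => //; apply: lteD; first exact: gd.
rewrite (@rLnorm_shift R (fun y => cutoff n g y - a y)); last exact: measurable_funB.
by rewrite rLnormB.
Qed.

Lemma translation_modulusE a t :
  translation_modulus a t = (rLnorm (fun x => a x - a (t + x))%R ^+ 2)%E.
Proof. by rewrite rLnorm_sqr. Qed.

Lemma translation_modulus_le a t : L2 (fun x => (a x)%:C%C) ->
  (translation_modulus a t <= (2%:E * rLnorm a) ^+ 2)%E.
Proof.
move=> La; have ma := measurable_realc La.
rewrite translation_modulusE lee_sqr ?cLnorm_ge0 ?mule_ge0 ?cLnorm_ge0//.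
have m0 : measurable_fun setT (cst 0 : R -> R) by [].
apply: le_trans (rLnorm_triangle ma m0 (measurable_comp_shift t ma)) _.
rewrite [X in (_ + X <= _)%E]rLnormB.
under eq_fun do rewrite subr0.
under [X in (_ + rLnorm X <= _)%E]eq_fun do rewrite subr0.
by rewrite rLnorm_shift// mule_natl mule2n.
Qed.

Lemma measurable_translation_modulus a : measurable_fun setT a ->
  measurable_fun setT (translation_modulus a).
Proof.
move=> ma.
apply: (@measurable_fun_fubini_tonelli_F _ _ (measurableTypeR R) (measurableTypeR R) R
  mu (fun z => ((a z.2 - a (z.1 + z.2)) ^+ 2)%:E)) => //.
  apply/measurable_EFinP; apply: measurable_funX; apply: measurable_funB.
    exact: measurableT_comp.
  by apply: (@measurableT_comp _ _ _ _ _ _ a) => //; exact: measurable_funD.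
by move=> z; rewrite lee_fin sqr_ge0.
Qed.

(** Away from the origin the kernel is of order e, relative to the
    integrable kernel of parameter 1. *)
Lemma poisson_tail e (d : R) t : 0 < e -> 0 < d -> d <= `|t| ->
  poisson e t <= e * (1 + d ^- 2) * poisson 1 t.
Proof.
move=> e0 d0 dt; rewrite /poisson.
have D0 := poisson_den_gt0 (2 * pi * t) e0.
have D1 := poisson_den_gt0 (2 * pi * t) (@ltr01 R).
have s : d ^+ 2 <= (2 * pi * t) ^+ 2.
  rewrite -(real_normK (num_real (_ * t))) ler_pXn2r// ?nnegrE ?(ltW d0)//.
  rewrite normrM (le_trans dt)// ler_peMl// ger0_norm ?mulr_ge0 ?pi_ge0//.
  have := pi_ge2 R; lra.
rewrite mulr1 expr1n ler_pdivrMr// mulrA.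
rewrite [leRHS]mulrAC ler_pdivlMr; last by rewrite expr1n in D1.
have d2 : 0 < d ^+ 2 by rewrite exprn_gt0.
set s2 := (2 * pi * t) ^+ 2 in D0 D1 s *; set q := d ^+ 2 in d2 s *.
have : 1 <= q^-1 * s2 by rewrite mulrC ler_pdivlMr// mul1r.
have : 0 < q^-1 by rewrite invr_gt0.
have : 0 < e ^+ 2 by rewrite exprn_gt0.
set p := q^-1; set E := e ^+ 2 => E0 p0 ps.
rewrite [leRHS](_ : _ = 2 * e * ((1 + p) * (E + s2))); last by ring.
rewrite ler_pM2l ?mulr_gt0//; nra.
Qed.

(** Near the origin the modulus is small and the kernel has integral 1; away
    from it the modulus is bounded and the kernel is small. *)
Lemma integral_poisson_modulus a (r : R) : L2 (fun x => (a x)%:C%C) -> 0 < r ->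
  exists2 e, 0 < e &
    (\int[mu]_t ((poisson e t)%:E * translation_modulus a t) <= r%:E)%E.
Proof.
move=> La r0; have ma := measurable_realc La.
pose M := fine ((2%:E * rLnorm a) ^+ 2)%E.
have Mfin : ((2%:E * rLnorm a) ^+ 2 \is a fin_num)%E.
  by rewrite expe2 !fin_numM// rLnorm_fin.
have M0 : 0 <= M by rewrite fine_ge0// expe2 !mule_ge0// cLnorm_ge0.
have r2 : 0 < Num.sqrt (r / 2) by rewrite sqrtr_gt0 divr_gt0.
have [d d0 ad] := translation_continuity La r2.
pose D := 1 + d ^- 2.
have D0 : 0 < D by rewrite ltr_pwDl// invr_ge0 sqr_ge0.
(* This value makes the contribution away from the origin at most r / 2. *)
pose e := r / 2 / (D * (M + 1)).
have e0 : 0 < e by rewrite divr_gt0 ?divr_gt0// mulr_gt0// ltr_wpDl.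
exists e => //.
have mp (c : R) : 0 < c -> measurable_fun setT (fun t => (poisson c t)%:E).
  by move=> c0; apply/measurable_EFinP; apply: continuous_measurable_fun;
    exact: continuous_poisson.
have p0 (c x : R) : 0 < c -> (0 <= (poisson c x)%:E)%E.
  by move=> c0; rewrite lee_fin ltW// poisson_gt0.
apply: (@le_trans _ _ (\int[mu]_t ((r / 2)%:E * (poisson e t)%:E +
    (M * (e * D))%:E * (poisson 1 t)%:E))%E).
  apply: ge0_le_integral => //.
  - by move=> t _; rewrite mule_ge0 ?p0// translation_modulusE expe2 mule_ge0// cLnorm_ge0.
  - apply: emeasurable_funM; first exact: mp.
    exact: measurable_translation_modulus.
  - by apply: emeasurable_funD; apply: measurable_funeM; exact: mp.
  - move=> t _; have [td|td] := ltP `|t| d.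
      apply: (@le_trans _ _ ((r / 2)%:E * (poisson e t)%:E)%E).
        rewrite muleC lee_wpmul2r ?p0// translation_modulusE.
        rewrite -(sqr_sqrtr (_ : 0 <= r / 2)); last by rewrite ltW// divr_gt0.
        rewrite EFin_expe lee_sqr ?cLnorm_ge0 ?lee_fin ?sqrtr_ge0//.
        by apply: ltW; exact: ad.
      by rewrite leeDl// mule_ge0 ?p0// lee_fin mulr_ge0// mulr_ge0// ltW.
    apply: (@le_trans _ _ ((M * (e * D))%:E * (poisson 1 t)%:E)%E); last first.
      by rewrite leeDr// mule_ge0 ?p0// lee_fin ltW// divr_gt0.
    rewrite EFinM -muleA -[X in (_ <= _ * X)%E]EFinM muleC lee_pmul ?p0//.
    - by rewrite translation_modulusE expe2 mule_ge0// cLnorm_ge0.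
    - by rewrite /M fineK//; exact: translation_modulus_le.
    - by rewrite lee_fin poisson_tail.
rewrite ge0_integralD//; last 4 first.
- by move=> t _; rewrite mule_ge0 ?p0// lee_fin ltW// divr_gt0.
- by apply: measurable_funeM; exact: mp.
- by move=> t _; rewrite mule_ge0 ?p0// lee_fin mulr_ge0// mulr_ge0// ltW.
- by apply: measurable_funeM; exact: mp.
have ip (c k : R) : 0 < c -> 0 <= k ->
    (\int[mu]_t (k%:E * (poisson c t)%:E) = k%:E)%E.
  move=> c0 k0; rewrite ge0_integralZl//; [|exact: mp|by move=> *; exact: p0].
  by rewrite integral_poisson// mule1.
have eD0 : 0 <= e * D by rewrite mulr_ge0// ltW.
rewrite ip; [|exact: e0|by rewrite divr_ge0// ltW].
rewrite ip; [|exact: ltr01|exact: mulr_ge0 M0 eD0].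
rewrite -EFinD lee_fin.
rewrite [leRHS](splitr r) lerD2l /e.
rewrite (_ : M * _ = r / 2 * (M / (M + 1))); last first.
  by field; rewrite !gt_eqF// ltr_wpDl.
rewrite ler_piMr ?divr_ge0 ?(ltW r0)// ler_pdivrMr ?mul1r ?lerDl//.
by rewrite ltr_wpDl.
Qed.

(** Plancherel for a real function. Fatou's lemma gives one inequality; the
    other holds because the translation modulus is negligible against a
    concentrated Poisson kernel. *)
Lemma plancherel_real a : L1R a -> L2 (fun x => (a x)%:C%C) ->
  (\int[mu]_w (cosT a w ^+ 2 + sinT a w ^+ 2)%:E = \int[mu]_x (a x ^+ 2)%:E)%E.
Proof.
move=> ia La; have ma := measurable_realc La.
have a2 : (\int[mu]_x (a x ^+ 2)%:E < +oo)%E.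
  rewrite -rLnorm_sqr expe2 lte_mul_pinfty ?cLnorm_ge0 ?rLnorm_fin//.
  by case: La.
pose h w := cosT a w ^+ 2 + sinT a w ^+ 2.
have h0 w : 0 <= h w by rewrite addr_ge0 ?sqr_ge0.
have mh : measurable_fun setT h.
  apply: measurable_funD; apply: measurable_funX.
    exact: measurable_trig_transform continuous_cosR norm_cos_le1 _ ia.
  exact: measurable_trig_transform continuous_sinR norm_sin_le1 _ ia.
have mabel e : measurable_fun setT (abel e).
  by apply: continuous_measurable_fun; exact: continuous_abel.
have mhk e : measurable_fun setT (fun w => (h w * abel e w)%:E).
  by apply/measurable_EFinP; exact: measurable_funM.
have hk0 e w : (0 <= (h w * abel e w)%:E)%E.
  by rewrite lee_fin mulr_ge0// ltW// abel_gt0.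
have pB0 e : 0 < e ->
    (0 <= (2^-1)%:E * \int[mu]_t ((poisson e t)%:E * translation_modulus a t))%E.
  move=> e0; rewrite mule_ge0//; apply: integral_ge0 => t _.
  by rewrite mule_ge0 ?lee_fin ?(ltW (poisson_gt0 t e0))// translation_modulusE expe2
    mule_ge0// cLnorm_ge0.
apply/eqP; rewrite eq_le; apply/andP; split.
  pose f (n : nat) w := (h w * abel n.+1%:R^-1 w)%:E.
  rewrite [leLHS](_ : _ = \int[mu]_w limn_einf (f^~ w))%E; last first.
    apply: eq_integral => w _.
    have fc : f^~ w @ \oo --> (h w)%:E.
      apply/fine_cvgP; split; first by apply: nearW.
      rewrite -[h w]mulr1; apply: cvgMl_tmp.
      rewrite -[X in _ --> X](@expR0 R) -oppr0 -(mul0r `|w|).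
      apply: (@cvg_comp _ _ _ (fun n : nat => - (n.+1%:R^-1 * `|w|)) expR).
        apply: cvgN; apply: cvgMr_tmp; exact: cvg_harmonic.
      exact: continuous_expR.
    by rewrite is_cvg_limn_einfE ?(cvg_lim _ fc)//; apply/cvg_ex; eexists; exact: fc.
  apply: le_trans (fatou mu measurableT (fun n => mhk _) _) _.
    by move=> n w _; exact: hk0.
  apply: limn_einf_le => n.
  have n0 : 0 < (n.+1%:R^-1 : R) by rewrite invr_gt0.
  by rewrite -(trig_abel_identity n0 ia a2) leeDl// pB0.
apply/lee_addgt0Pr => r r0.
have [e e0 er] := integral_poisson_modulus La r0.
rewrite -(trig_abel_identity e0 ia a2) leeD//.
  apply: ge0_le_integral => //.
  - by move=> w _; exact: hk0.
  - exact: mhk.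
  - exact/measurable_EFinP.
  - move=> w _; rewrite lee_fin; apply: ler_piMr; first exact: h0.
    by rewrite /abel -[leRHS]expR0 ler_expR oppr_le0 mulr_ge0// ltW.
apply: le_trans er; rewrite gee_pMl ?lee_fin ?invf_le1 ?ler1n//.
apply: integral_ge0 => t _.
by rewrite mule_ge0 ?lee_fin ?(ltW (poisson_gt0 t e0))// translation_modulusE expe2
    mule_ge0// cLnorm_ge0.
Qed.

End Plancherel.


(** * The Fourier integral on the intersection of L^1 and L^2 *)

Section ComplexIntegral.
Context {R : realType}.
Local Notation C := R[i].
Local Notation mu := (@lebesgue_measure R).
Local Notation L1R f := (mu.-integrable setT (EFin \o (f : R -> R))).
Local Notation cosT := (trig_transform (@cos R)).
Local Notation sinT := (trig_transform (@sin R)).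
Implicit Types (f g u v : R -> C).

Definition cintegrable f :=
  L1R (fun x => complex.Re (f x)) /\ L1R (fun x => complex.Im (f x)).

Lemma integrableD_real (a b : R -> R) : L1R a -> L1R b -> L1R (fun x => a x + b x).
Proof. by move=> ia ib; apply: (integrableD measurableT ia ib). Qed.

Lemma integrableZ_real (r : R) (a : R -> R) : L1R a -> L1R (fun x => r * a x).
Proof. by move=> ia; apply: (integrableZl measurableT r ia). Qed.

Lemma cintegralD f g : cintegrable f -> cintegrable g ->
  cintegral (fun x => f x + g x) = cintegral f + cintegral g.
Proof.
move=> [f1 f2] [g1 g2]; rewrite /cintegral; congr Complex.
  by rewrite -RintegralD//; apply: eq_Rintegral => x _; rewrite complex_ReD.
by rewrite -RintegralD//; apply: eq_Rintegral => x _; rewrite complex_ImD.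
Qed.

Lemma cintegralZ (c : C) f : cintegrable f ->
  cintegral (fun x => c * f x) = c * cintegral f.
Proof.
move=> [f1 f2]; rewrite /cintegral; case: c => p q /=.
apply/eqP; rewrite eq_complex /=; apply/andP; split; apply/eqP.
  rewrite -!RintegralZl// -RintegralB//; last 2 first.
  - exact: integrableZ_real.
  - exact: integrableZ_real.
  by apply: eq_Rintegral => x _; rewrite complex_ReM.
rewrite -!RintegralZl// -RintegralD//; last 2 first.
- exact: integrableZ_real.
- exact: integrableZ_real.
by apply: eq_Rintegral => x _; rewrite complex_ImM.
Qed.

Lemma cintegrable_L1 f : cLfun 1%:E f -> cintegrable f.
Proof.
move=> [[m1 m2] Nf].
have fi : (\int[mu]_x (Normc.normc (f x))%:E < +oo)%E.
  move: Nf; rewrite /cLnorm Lnorm1; apply: le_lt_trans.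
  apply: ge0_le_integral => //.
  - by move=> x _; rewrite lee_fin normc_ge0.
  - by apply/measurable_EFinP; exact: measurable_normc.
  - by apply: measurableT_comp => //; apply/measurable_EFinP; exact: measurable_normc.
  - by move=> x _; rewrite lee_fin ler_norm.
by split; apply/integrableP; split; [exact/measurable_EFinP| |exact/measurable_EFinP|];
  apply: le_lt_trans fi; apply: ge0_le_integral => //;
  do ?[by apply: measurableT_comp => //; apply/measurable_EFinP];
  do ?[by apply/measurable_EFinP; exact: measurable_normc];
  move=> x _; rewrite lee_fin ?ler_Re_normc ?ler_Im_normc.
Qed.

Lemma integrable_cos (a : R -> R) w : L1R a -> L1R (fun x => a x * cos (2 * pi * x * w)).
Proof. exact: integrable_phase continuous_cosR norm_cos_le1 _ _. Qed.

Lemma integrable_sin (a : R -> R) w : L1R a -> L1R (fun x => a x * sin (2 * pi * x * w)).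
Proof. exact: integrable_phase continuous_sinR norm_sin_le1 _ _. Qed.

Lemma fourier_integralE u w : cintegrable u ->
  fourier_integral u w =
  Complex (cosT (fun x => complex.Re (u x)) w + sinT (fun x => complex.Im (u x)) w)
          (cosT (fun x => complex.Im (u x)) w - sinT (fun x => complex.Re (u x)) w).
Proof.
move=> [u1 u2]; rewrite /fourier_integral /cintegral.
congr Complex.
  rewrite /trig_transform -RintegralD//; last 2 first.
  - exact: integrable_cos.
  - exact: integrable_sin.
  by apply: eq_Rintegral => x _; rewrite complex_ReM /= cosN sinN mulrN opprK.
rewrite /trig_transform -RintegralB//; last 2 first.
- exact: integrable_cos.
- exact: integrable_sin.
by apply: eq_Rintegral => x _; rewrite complex_ImM /= cosN sinN mulrN addrC.
Qed.

Lemma expiD (s t : R) : expi (s + t) = expi s * expi t.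
Proof.
by apply/eqP; rewrite eq_complex /= cosD sinD [X in _ && (X == _)]addrC
  ![sin _ * cos _]mulrC !eqxx.
Qed.

Lemma normc_expi (t : R) : Normc.normc (expi t) = 1.
Proof. by rewrite /= cos2Dsin2 sqrtr1. Qed.

Lemma cintegrable_phase u w : cintegrable u ->
  cintegrable (fun x => u x * expi (- (2 * pi * x * w))).
Proof.
move=> [u1 u2].
have c1 := integrable_cos w u1.
have c2 := integrable_cos w u2.
have s1 := integrable_sin w u1.
have s2 := integrable_sin w u2.
split.
  have := integrableD_real c1 s2; apply: eq_integrable => // x _ /=.
  by rewrite complex_ReM /= cosN sinN mulrN opprK.
have := integrableD_real c2 (integrableZ_real (-1) s1).
apply: eq_integrable => // x _ /=.
by rewrite complex_ImM /= cosN sinN mulrN mulN1r addrC.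
Qed.

Lemma fourier_integralDZ (c : C) u v w : cintegrable u -> cintegrable v ->
  fourier_integral (fun x => c * u x + v x) w =
  c * fourier_integral u w + fourier_integral v w.
Proof.
move=> iu iv.
have pu := cintegrable_phase w iu; have pv := cintegrable_phase w iv.
rewrite /fourier_integral -cintegralZ// -cintegralD//.
  by congr cintegral; apply/funext => x; rewrite mulrDl mulrA.
move: pu => [p1 p2]; split.
  have := integrableD_real (integrableZ_real (complex.Re c) p1)
    (integrableZ_real (- complex.Im c) p2).
  by apply: eq_integrable => // x _ /=; rewrite [in RHS]complex_ReM mulNr.
have := integrableD_real (integrableZ_real (complex.Re c) p2)
    (integrableZ_real (complex.Im c) p1).
by apply: eq_integrable => // x _ /=; rewrite [in RHS]complex_ImM.
Qed.

Lemma ge0_integral_oppr (f : R -> \bar R) : measurable_fun setT f ->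
  (forall x, 0 <= f x)%E -> (\int[mu]_x f (- x)%R = \int[mu]_x f x)%E.
Proof.
move=> mf f0.
rewrite -[LHS]/(\int[mu]_(x in (-%R : measurableTypeR R -> measurableTypeR R)
   @^-1` setT) (f \o -%R) x)%E.
rewrite -ge0_integral_pushforward//=.
by apply: eq_measure_integral => //= A mA _; exact: lebesgue_measureN.
Qed.

Lemma integral_shift (c : R) (f : R -> \bar R) : measurable_fun setT f ->
  (\int[mu]_x f (x + c)%R = \int[mu]_x f x)%E.
Proof.
move=> mf; rewrite integralE [RHS]integralE; congr (_ - _)%E.
  rewrite -(ge0_integral_shift c (f := f^\+%E)).
  - by apply: eq_integral => x _; rewrite !funeposE.
  - exact: measurable_funepos.
  - by [].
rewrite -(ge0_integral_shift c (f := f^\-%E)).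
- by apply: eq_integral => x _; rewrite !funenegE.
- exact: measurable_funeneg.
- by [].
Qed.

Lemma cintegral_shift (c : R) f : cmeasurable f ->
  cintegral (fun x => f (x + c)) = cintegral f.
Proof.
move=> [m1 m2]; rewrite /cintegral; congr Complex; rewrite /Rintegral; congr fine.
  by apply: (@integral_shift c (fun x => (complex.Re (f x))%:E)); exact/measurable_EFinP.
by apply: (@integral_shift c (fun x => (complex.Im (f x))%:E)); exact/measurable_EFinP.
Qed.

Lemma fourier_integral_shift u (k : int) w : cintegrable u ->
  fourier_integral (Defs.shift u k) w =
  expi (- (2 * pi * k%:~R * w)) * fourier_integral u w.
Proof.
move=> iu; have pu := cintegrable_phase w iu.
rewrite /fourier_integral -cintegralZ//.
have [/integrable_measurable mr /integrable_measurable mi] := pu.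
rewrite -[RHS](@cintegral_shift (- k%:~R)); last first.
  by apply: cmeasurableM; [exact: cmeasurable_cst|split].
congr cintegral; apply/funext => x; rewrite /Defs.shift mulrCA -expiD; congr (_ * expi _).
by ring.
Qed.

(** The real and imaginary parts of [u] interact only in terms that are odd
    in w; they cancel when the values at w and - w are averaged. *)
Lemma plancherel_L1 u : cLfun 1%:E u -> L2 u ->
  L2 (fourier_integral u) /\ cLnorm 2%:E (fourier_integral u) = cLnorm 2%:E u.
Proof.
move=> L1u L2u; have iu := cintegrable_L1 L1u; have [ia ib] := iu.
have [mu_ _] := L2u; have [ma mb] := mu_.
pose a x := complex.Re (u x); pose b x := complex.Im (u x).
have La : L2 (fun x => (a x)%:C%C).
  apply: L2_le L2u _ => [|x]; first exact: cmeasurable_real.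
  by rewrite normc_real ler_Re_normc.
have Lb : L2 (fun x => (b x)%:C%C).
  apply: L2_le L2u _ => [|x]; first exact: cmeasurable_real.
  by rewrite normc_real ler_Im_normc.
have mc (f : R -> R) : L1R f -> measurable_fun setT (cosT f).
  exact: measurable_trig_transform continuous_cosR norm_cos_le1 _.
have ms (f : R -> R) : L1R f -> measurable_fun setT (sinT f).
  exact: measurable_trig_transform continuous_sinR norm_sin_le1 _.
have FE : fourier_integral u = fun w => Complex (cosT a w + sinT b w) (cosT b w - sinT a w).
  by apply/funext => w; rewrite fourier_integralE.
have mF : cmeasurable (fourier_integral u).
  rewrite FE; split; [apply: measurable_funD|apply: measurable_funB];
    by [exact: mc|exact: ms].
pose E (w : R) := (Normc.normc (fourier_integral u w) ^+ 2)%:E.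
have mE : measurable_fun setT E by exact: measurable_EFin_normc_sqr.
have E0 w : (0 <= E w)%E by rewrite lee_fin sqr_ge0.
have mEN : measurable_fun setT (fun w : R => E (- w)%R).
  by apply: (@measurableT_comp _ _ _ _ _ _ E).
have msq (f : R -> R) : L1R f -> measurable_fun setT (fun w => (cosT f w ^+ 2 + sinT f w ^+ 2)%:E).
  move=> fi; apply/measurable_EFinP; apply: measurable_funD; apply: measurable_funX.
    exact: mc.
  exact: ms.
have EI : (\int[mu]_w E w = \int[mu]_x (Normc.normc (u x) ^+ 2)%:E)%E.
  transitivity ((2^-1)%:E * (\int[mu]_w E w + \int[mu]_w E (- w)%R))%E.
    rewrite ge0_integral_oppr// -mule2n -mule_natl muleA -EFinM mulVf// mul1e//.
  rewrite -ge0_integralD// -ge0_integralZl//; last 2 first.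
  - by apply: emeasurable_funD.
  - by move=> w _; rewrite adde_ge0.
  transitivity (\int[mu]_w ((cosT a w ^+ 2 + sinT a w ^+ 2)%:E +
      (cosT b w ^+ 2 + sinT b w ^+ 2)%:E))%E.
    apply: eq_integral => w _; rewrite /E FE !normc_sqr /=.
    rewrite -!EFinD -EFinM; congr EFin.
    have cN (f : R -> R) : cosT f (- w) = cosT f w.
      by apply: eq_Rintegral => x _; rewrite mulrN cosN.
    have sN (f : R -> R) : L1R f -> sinT f (- w) = - sinT f w.
      move=> fi; rewrite /trig_transform -[RHS]mulN1r -RintegralZl//; last exact: integrable_sin.
      by apply: eq_Rintegral => x _; rewrite mulrN sinN mulrN mulN1r.
    rewrite !cN !sN//.
    by field.
  rewrite ge0_integralD//; last 4 first.
  - by move=> w _; rewrite lee_fin addr_ge0 ?sqr_ge0.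
  - exact: msq.
  - by move=> w _; rewrite lee_fin addr_ge0 ?sqr_ge0.
  - exact: msq.
  rewrite !plancherel_real// -ge0_integralD//; last 4 first.
  - by move=> w _; rewrite lee_fin sqr_ge0.
  - by apply/measurable_EFinP; exact: measurable_funX.
  - by move=> w _; rewrite lee_fin sqr_ge0.
  - by apply/measurable_EFinP; exact: measurable_funX.
  by apply: eq_integral => x _; rewrite normc_sqr -EFinD.
have NE : cLnorm 2%:E (fourier_integral u) = cLnorm 2%:E u.
  by rewrite !cLnorm_sqrt -EI.
by split => //; split => //; change (cLnorm 2%:E (fourier_integral u) < +oo)%E;
  rewrite NE; case: L2u.
Qed.


End ComplexIntegral.


(** * The Fourier transform on L^2 *)

Section FourierL2.
Context {R : realType}.
Local Notation C := R[i].
Local Notation mu := (@lebesgue_measure R).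
Local Notation N f := (cLnorm 2%:E f).
Implicit Types (f g h u v : R -> C) (e : R).

Lemma L2_cvg_bound (u : nat -> R -> C) g (M : R) :
  (forall n, (N (fun x => u n x - g x)%R <= (M * 2^-1 ^+ n)%:E)%E) -> L2_cvg u g.
Proof.
move=> ug; apply/L2_cvgP => e e0.
have : (fun n => M * 2^-1 ^+ n) @ \oo --> (0 : R).
  rewrite -[X in _ --> X](mulr0 M); apply: cvgMl_tmp.
  by apply: cvg_expr; rewrite ger0_norm// invf_lt1// ltr1n.
move=> /cvgr0Pnorm_lt /(_ e e0); apply: filterS => n nlt.
by rewrite (le_lt_trans (ug n))// lte_fin (le_lt_trans (ler_norm _)).
Qed.

Lemma L2_cvgDZ (c : C) (u v : nat -> R -> C) f g :
  (forall n, cmeasurable (u n)) -> cmeasurable f ->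
  (forall n, cmeasurable (v n)) -> cmeasurable g ->
  L2_cvg u f -> L2_cvg v g ->
  L2_cvg (fun n x => c * u n x + v n x) (fun x => c * f x + g x).
Proof.
move=> mu_ mf mv mg /L2_cvgP uf /L2_cvgP vg; apply/L2_cvgP => e e0.
pose c' := Normc.normc c + 1.
have c0 : 0 < c' by rewrite ltr_wpDl ?normc_ge0.
have e1 : 0 < e / 2 / c' by rewrite !divr_gt0.
have e2 : 0 < e / 2 by rewrite divr_gt0.
near=> n.
rewrite (_ : (fun x => _) = (fun x => c * (u n x - f x) + (v n x - g x))); last first.
  by apply/funext => x; ring.
have muf : cmeasurable (fun x => u n x - f x) by exact: cmeasurableB.
apply: le_lt_trans (cLnormD (cmeasurableM (cmeasurable_cst c) muf) (cmeasurableB (mv n) mg)) _.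
rewrite (_ : e%:E = (e / 2)%:E + (e / 2)%:E)%E; last by rewrite -EFinD -splitr.
apply: lteD; last by near: n; exact: vg.
rewrite cLnormZ//.
have un : (N (fun x => u n x - f x)%R < (e / 2 / c')%:E)%E by near: n; exact: uf.
apply: (@le_lt_trans _ _ ((Normc.normc c)%:E * (e / 2 / c')%:E)%E).
  by rewrite lee_wpmul2l ?lee_fin ?normc_ge0// ltW.
rewrite -EFinM lte_fin mulrCA gtr_pMr// ltr_pdivrMr// mul1r /c'.
by rewrite ltrDl.
Unshelve. all: by end_near. Qed.

Lemma cLnorm_cvg (u : nat -> R -> C) g : (forall n, cmeasurable (u n)) -> cmeasurable g ->
  L2_cvg u g -> forall e, 0 < e -> \forall n \near \oo,
    (N (u n) <= N g + e%:E)%E /\ (N g <= N (u n) + e%:E)%E.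
Proof.
move=> mu_ mg /L2_cvgP ug e e0; near=> n.
have un : (N (fun x => u n x - g x)%R < e%:E)%E by near: n; exact: ug.
have mun : cmeasurable (fun x => u n x - g x) by exact: cmeasurableB.
split.
  rewrite [X in (N X <= _)%E](_ : _ = (fun x => g x + (u n x - g x))); last first.
    by apply/funext => x; rewrite addrC subrK.
  by rewrite (le_trans (cLnormD mg mun))// leeD2l// ltW.
rewrite [X in (N X <= _)%E](_ : _ = (fun x => u n x + (g x - u n x))); last first.
  by apply/funext => x; rewrite addrC subrK.
rewrite (le_trans (cLnormD (mu_ n) (cmeasurableB mg (mu_ n))))// leeD2l//.
by rewrite cLnormB ltW.
Unshelve. all: by end_near. Qed.

Lemma cLnorm_cvg_eq (u v : nat -> R -> C) f g :
  (forall n, cmeasurable (u n)) -> cmeasurable f ->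
  (forall n, cmeasurable (v n)) -> cmeasurable g ->
  L2_cvg u f -> L2_cvg v g -> (forall n, N (u n) = N (v n)) -> N f = N g.
Proof.
move=> mu_ mf mv mg uf vg uv.
have fge e : 0 < e -> (N f <= N g + e%:E)%E /\ (N g <= N f + e%:E)%E.
  move=> e0; have e2 : 0 < e / 2 by rewrite divr_gt0.
  have uc := cLnorm_cvg mu_ mf uf e2; have vc := cLnorm_cvg mv mg vg e2.
  have [n _ /(_ n (leqnn n)) [[u1 u2] [v1 v2]]] := filterI uc vc.
  rewrite (_ : e%:E = (e / 2)%:E + (e / 2)%:E)%E; last by rewrite -EFinD -splitr.
  rewrite !addeA; split.
    by apply: le_trans u2 _; rewrite uv leeD2r.
  by apply: le_trans v2 _; rewrite -uv leeD2r.
by apply/eqP; rewrite eq_le; apply/andP; split; apply/lee_addgt0Pr => e e0;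
  have [] := fge e e0.
Qed.

Lemma L2_integrable_itv f (n : R) : L2 f ->
  cLfun 1%:E (fun x => if `|x| <= n then f x else 0) /\
  L2 (fun x => if `|x| <= n then f x else 0).
Proof.
move=> Lf; have [mf _] := Lf.
have L2u : L2 (fun x => if `|x| <= n then f x else 0).
  apply: (L2_le _ Lf) => [|x]; last by case: ifPn; rewrite ?Normc.normc0 ?normc_ge0.
  have mn : measurable_fun setT (fun x : R => `|x| <= n).
    by apply: measurable_fun_ler => //; exact: measurableT_comp.
  have [m1 m2] := mf; split.
    rewrite (_ : (fun x => _) = (fun x => if `|x| <= n then complex.Re (f x) else 0)).
      exact: measurable_fun_ifT.
    by apply/funext => x; case: ifPn.
  rewrite (_ : (fun x => _) = (fun x => if `|x| <= n then complex.Im (f x) else 0)).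
    exact: measurable_fun_ifT.
  by apply/funext => x; case: ifPn.
split => //; have [mu_ _] := L2u; split => //; rewrite /cLnorm Lnorm1.
pose I := \1_(`[(- n), n]%classic) : R -> R.
apply: (@le_lt_trans _ _ (\int[mu]_x ((I x)%:E + (Normc.normc (f x) ^+ 2)%:E))%E).
  apply: ge0_le_integral => //.
  - by apply: measurableT_comp => //; apply/measurable_EFinP; exact: measurable_normc.
  - apply: emeasurable_funD; last exact: measurable_EFin_normc_sqr.
    by apply/measurable_EFinP; exact: measurable_indic.
  - move=> x _ /=; rewrite lee_fin ger0_norm ?normc_ge0// /I indicE.
    have [xn|xn] := leP `|x| n.
      rewrite (_ : (x \in _) = true); last by apply/mem_set => /=; rewrite in_itv/= -ler_norml.
      rewrite (_ : true%:R = 1 :> R)//; set t := Normc.normc _.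
      have := sqr_ge0 (t - 1); nra.
    by rewrite Normc.normc0 addr_ge0// sqr_ge0.
rewrite ge0_integralD//; last 3 first.
- by apply/measurable_EFinP; exact: measurable_indic.
- by move=> x _; rewrite lee_fin sqr_ge0.
- exact: measurable_EFin_normc_sqr.
rewrite integral_indic// setIT lte_add_pinfty//.
  by rewrite /= lebesgue_measure_itv/=; case: ifPn => // _; rewrite -EFinD ltry.
have /integrableP[_] := L2_integrable_sqr Lf; apply: le_lt_trans.
rewrite le_eqVlt; apply/orP; left; apply/eqP; apply: eq_integral => x _.
by rewrite gee0_abs// lee_fin sqr_ge0.
- by move=> x _; rewrite lee_fin.
Qed.

Lemma L2_approx_L1 f e : L2 f -> 0 < e ->
  exists2 u, cLfun 1%:E u /\ L2 u & (N (fun x => u x - f x)%R < e%:E)%E.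
Proof.
move=> Lf e0.
pose u (n : nat) x := if `|x| <= n%:R then f x else 0.
have Lu n : cLfun 1%:E (u n) /\ L2 (u n) := L2_integrable_itv n%:R Lf.
have := @cLnorm_dominated R (fun n x => u n x - f x) f.
move=> /(_ _ Lf _ _ e e0).
have H1 n : cmeasurable (fun x => u n x - f x).
  by apply: cmeasurableB; [case: (Lu n) => _ []|case: Lf].
have H2 n x : Normc.normc (u n x - f x) <= Normc.normc (f x).
  rewrite /u; case: ifPn => _; first by rewrite subrr Normc.normc0 normc_ge0.
  by rewrite sub0r normcN.
have H3 : {ae mu, forall x, Normc.normc (u n x - f x) @[n --> \oo] --> (0 : R)}.
  apply: ae_all => x; apply/cvgr0Pnorm_lt => r r0; near=> n.
  rewrite /u (_ : `|x| <= n%:R); last by near: n; exact: nbhs_infty_ger.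
  by rewrite subrr Normc.normc0 normr0.
by move=> /(_ H1 H2 H3)[n _ /(_ n (leqnn n))] ?; exists (u n).
Unshelve. all: by end_near. Qed.

Lemma cLfun1P u : cLfun 1%:E u <->
  cmeasurable u /\ (\int[mu]_x (Normc.normc (u x))%:E < +oo)%E.
Proof.
have E : (cLnorm 1%:E u = \int[mu]_x (Normc.normc (u x))%:E)%E.
  rewrite /cLnorm Lnorm1; apply: eq_integral => x _ /=.
  by rewrite ger0_norm// normc_ge0.
by rewrite -E.
Qed.

Lemma cLfun1_DZ (c : C) u v : cLfun 1%:E u -> cLfun 1%:E v ->
  cLfun 1%:E (fun x => c * u x + v x).
Proof.
move=> /cLfun1P[mu_ iu] /cLfun1P[mv iv]; apply/cLfun1P.
have mcu : cmeasurable (fun x => c * u x + v x).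
  by apply: cmeasurableD => //; apply: cmeasurableM => //; exact: cmeasurable_cst.
have mn f : cmeasurable f -> measurable_fun setT (fun x => (Normc.normc (f x))%:E).
  by move=> mf; apply/measurable_EFinP; exact: measurable_normc.
split => //.
apply: (@le_lt_trans _ _ (\int[mu]_x ((Normc.normc c)%:E * (Normc.normc (u x))%:E +
  (Normc.normc (v x))%:E))%E).
  apply: ge0_le_integral => //.
  - by move=> x _; rewrite lee_fin normc_ge0.
  - exact: mn.
  - by apply: emeasurable_funD; [apply: measurable_funeM; exact: mn|exact: mn].
  - move=> x _; rewrite -EFinM -EFinD lee_fin -Normc.normcM.
    exact: le_normcD.
rewrite ge0_integralD//; last 4 first.
- by move=> x _; rewrite mule_ge0// lee_fin normc_ge0.
- by apply: measurable_funeM; exact: mn.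
- by move=> x _; rewrite lee_fin normc_ge0.
- exact: mn.
rewrite ge0_integralZl; [|by []|exact: mn|by move=> x _; rewrite lee_fin normc_ge0|
  by rewrite lee_fin normc_ge0].
rewrite lte_add_pinfty// lte_mul_pinfty// ?lee_fin ?normc_ge0//.
Qed.

(** The transforms of rapidly convergent truncations form a Cauchy sequence,
    by Plancherel's identity applied to their differences. *)
Lemma is_fourier_exists f : L2 f -> exists g, is_fourier f g.
Proof.
move=> Lf; have [mf _] := Lf.
have h n : 0 < (2^-1 ^+ n / 2 / 2 : R) by rewrite !divr_gt0 ?exprn_gt0// invr_gt0.
pose u n := projT1 (cid2 (L2_approx_L1 Lf (h n))).
have Lu n : cLfun 1%:E (u n) /\ L2 (u n) by rewrite /u; case: cid2.
have mu_ n : cmeasurable (u n) by have [_ []] := Lu n.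
have uf n : (N (fun x => u n x - f x)%R < (2^-1 ^+ n / 2 / 2)%:E)%E.
  by rewrite /u; case: cid2.
have FB n m : fourier_integral (fun x => u n x - u m x) =
    (fun w => fourier_integral (u n) w - fourier_integral (u m) w).
  apply/funext => w; rewrite (_ : (fun x => _) = (fun x => -1 * u m x + u n x)).
    rewrite fourier_integralDZ; first by rewrite mulN1r addrC.
      by apply: cintegrable_L1; case: (Lu m).
    by apply: cintegrable_L1; case: (Lu n).
  by apply/funext => x; rewrite mulN1r addrC.
have L1B n m : cLfun 1%:E (fun x => u n x - u m x).
  rewrite (_ : (fun x => _) = (fun x => -1 * u m x + u n x)); last first.
    by apply/funext => x; rewrite mulN1r addrC.
  by apply: cLfun1_DZ; [case: (Lu m)|case: (Lu n)].
have PF n : L2 (fourier_integral (u n)).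
  by have [L1 L2_] := Lu n; have [] := plancherel_L1 L1 L2_.
have Nu n : (N (fun w => fourier_integral (u n.+1) w - fourier_integral (u n) w)%R
    <= (2^-1 ^+ n)%:E)%E.
  have [L1 LL1] := Lu n.+1; have [L0 LL0] := Lu n.
  have [_] := plancherel_L1 (L1B n.+1 n) (L2B LL1 LL0).
  rewrite FB => ->.
  apply: le_trans (cLnorm_triangle (mu_ n.+1) mf (mu_ n)) _.
  rewrite [X in (_ + X <= _)%E]cLnormB.
  apply: le_trans (leeD (ltW (uf n.+1)) (ltW (uf n))) _.
  rewrite -EFinD lee_fin exprS.
  have : 0 < (2^-1 ^+ n : R) by rewrite exprn_gt0.
  lra.
have [g Lg gu] := L2_complete PF Nu.
exists g; split => //; exists u; split => //.
  apply: (@L2_cvg_bound _ _ 1) => n; rewrite (le_trans (ltW (uf n)))// lee_fin mul1r.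
  have : 0 < (2^-1 ^+ n : R) by rewrite exprn_gt0.
  lra.
exact: (@L2_cvg_bound _ _ 2).
Qed.

Lemma is_fourier_fourier f : L2 f -> is_fourier f (fourier f).
Proof. by move=> /is_fourier_exists; rewrite /fourier; exact: xgetPex. Qed.

Lemma is_fourier_isometry f g : L2 f -> is_fourier f g -> N g = N f.
Proof.
move=> [mf _] [[mg _] [u [Lu uf ug]]].
apply: cLnorm_cvg_eq ug uf _ => //.
- by move=> n; have [L1 LL1] := Lu n; have [[]] := plancherel_L1 L1 LL1.
- by move=> n; have [_ []] := Lu n.
- by move=> n; have [L1 LL1] := Lu n; have [] := plancherel_L1 L1 LL1.
Qed.

Lemma is_fourier_DZ (c : C) f f' g g' : L2 f -> L2 f' ->
  is_fourier f g -> is_fourier f' g' ->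
  is_fourier (fun x => c * f x + f' x) (fun x => c * g x + g' x).
Proof.
move=> [mf _] [mf' _] [Lg [u [Lu uf ug]]] [Lg' [u' [Lu' uf' ug']]].
have [mg _] := Lg; have [mg' _] := Lg'.
have mu_ n : cmeasurable (u n) by have [_ []] := Lu n.
have mu' n : cmeasurable (u' n) by have [_ []] := Lu' n.
have mF n : cmeasurable (fourier_integral (u n)).
  by have [L1 LL1] := Lu n; have [[]] := plancherel_L1 L1 LL1.
have mF' n : cmeasurable (fourier_integral (u' n)).
  by have [L1 LL1] := Lu' n; have [[]] := plancherel_L1 L1 LL1.
split; first by apply: L2D => //; exact: L2Z.
exists (fun n x => c * u n x + u' n x); split.
- move=> n; have [L1 LL1] := Lu n; have [L1' LL1'] := Lu' n; split.
    exact: cLfun1_DZ.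
  by apply: L2D => //; exact: L2Z.
- exact: L2_cvgDZ.
- rewrite (_ : (fun n => _) = (fun n w => c * fourier_integral (u n) w +
      fourier_integral (u' n) w)); first exact: L2_cvgDZ.
  apply/funext => n; apply/funext => w; rewrite fourier_integralDZ//.
    by apply: cintegrable_L1; case: (Lu n).
  by apply: cintegrable_L1; case: (Lu' n).
Qed.

(** The difference of two transforms of [f] is a transform of 0, so its norm
    vanishes. *)
Lemma is_fourier_unique f g g' : L2 f -> is_fourier f g -> is_fourier f g' ->
  {ae mu, forall w, g w = g' w}.
Proof.
move=> Lf fg fg'; have Lg := fg.1; have Lg' := fg'.1.
have := is_fourier_DZ (-1) Lf Lf fg fg'.
move=> /(is_fourier_isometry (L2D (L2Z _ Lf) Lf)).
rewrite [X in _ = N X](_ : _ = fun=> 0); last by apply/funext => x; rewrite mulN1r addNr.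
rewrite cLnorm0 => /cLnorm_eq0 H.
have {H} := H (cmeasurableD (L2Z (-1) Lg).1 Lg'.1).
by apply: ae_imp => w; rewrite mulN1r addrC => /subr0_eq.
Qed.

Lemma cmeasurable_expi (r : R) : cmeasurable (fun w => expi (r * w)).
Proof.
split; apply: continuous_measurable_fun => w.
  apply: (@continuous_comp _ _ _ (fun w : R => r * w) (@cos R)).
    exact: mulrl_continuous.
  exact: continuous_cos.
apply: (@continuous_comp _ _ _ (fun w : R => r * w) (@sin R)).
  exact: mulrl_continuous.
exact: continuous_sin.
Qed.

Lemma cmeasurable_shift f k : cmeasurable f -> cmeasurable (Defs.shift f k).
Proof.
move=> [m1 m2]; split.
  exact: (measurableT_comp m1 (measurable_shift (- k%:~R))).
exact: (measurableT_comp m2 (measurable_shift (- k%:~R))).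
Qed.

Lemma cLnorm_shift f k : cmeasurable f -> N (Defs.shift f k) = N f.
Proof.
move=> mf; rewrite !cLnorm_sqrt; congr sqrte.
apply: (@ge0_integral_shift _ (- k%:~R) (fun x => (Normc.normc (f x) ^+ 2)%:E)).
  exact: measurable_EFin_normc_sqr.
by move=> x; rewrite lee_fin sqr_ge0.
Qed.

Lemma L2_shift f k : L2 f -> L2 (Defs.shift f k).
Proof.
move=> [mf Nf]; split; first exact: cmeasurable_shift.
by change (N (Defs.shift f k) < +oo)%E; rewrite cLnorm_shift.
Qed.

(** The factor by which a translation by [k] acts on the Fourier side. *)
Definition character (k : int) (w : R) : C := expi (- (2 * pi * k%:~R * w)).

Lemma cmeasurable_character k : cmeasurable (character k).
Proof.
rewrite (_ : character k = fun w => expi (- (2 * pi * k%:~R) * w)).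
  exact: cmeasurable_expi.
by apply/funext => w; rewrite mulNr.
Qed.

Lemma L2_mul_character k g : L2 g ->
  L2 (fun w => character k w * g w) /\ (N (fun w => character k w * g w)%R <= N g)%E.
Proof.
move=> Lg; rewrite -[X in (_ <= X)%E]mul1e.
apply: (@L2_bounded_mul _ 1) => //; first exact: cmeasurable_character.
by move=> w; rewrite normc_expi.
Qed.

Lemma is_fourier_shift f g k : L2 f -> is_fourier f g ->
  is_fourier (Defs.shift f k) (fun w => character k w * g w).
Proof.
move=> Lf [Lg [u [Lu uf ug]]]; split; first by have [] := L2_mul_character k Lg.
have mu_ n : cmeasurable (u n) by have [_ []] := Lu n.
exists (fun n => Defs.shift (u n) k); split.
- move=> n; have [L1 L2u] := Lu n; split; last exact: L2_shift.
  move/cLfun1P : L1 => [mun iun]; apply/cLfun1P; split; first exact: cmeasurable_shift.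
  rewrite [X in (X < _)%E](_ : _ = \int[mu]_x (Normc.normc (u n x))%:E)%E//.
  apply: (@ge0_integral_shift _ (- k%:~R) (fun x => (Normc.normc (u n x))%:E)).
    by apply/measurable_EFinP; exact: measurable_normc.
  by move=> x; rewrite lee_fin normc_ge0.
- apply/L2_cvgP => e e0; move/L2_cvgP : uf => /(_ e e0); apply: filterS => n.
  rewrite -(@cLnorm_shift (fun x => u n x - f x) k)//.
  by apply: cmeasurableB => //; case: Lf.
- apply/L2_cvgP => e e0; move/L2_cvgP : ug => /(_ e e0); apply: filterS => n.
  apply: le_lt_trans.
  have [L1 LL1] := Lu n; have [LF _] := plancherel_L1 L1 LL1.
  have [_] := L2_mul_character k (L2B LF Lg); apply: le_trans.
  rewrite le_eqVlt; apply/orP; left; apply/eqP; congr (cLnorm 2%:E _).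
  apply/funext => w; rewrite fourier_integral_shift ?mulrBr//.
  exact: cintegrable_L1.
Qed.

End FourierL2.


(** * Sign iteration, thresholds and arcs of the circle *)

Section ScalarLemmas.
Context {R : realType}.
Implicit Types (x y : R).

(** The Newton iteration for the inverse square root of [x ^+ 2], multiplied by
    [x]: a sequence of odd polynomials in x that converges to the sign of x on
    the interval from -1 to 1. *)
Fixpoint sign_iter (n : nat) x : R :=
  if n is m.+1 then sign_iter m x * (3 - sign_iter m x ^+ 2) / 2 else x.

Lemma sign_iterN n x : sign_iter n (- x) = - sign_iter n x.
Proof. by elim: n => //= n ->; rewrite sqrrN mulNr mulNr. Qed.

(** The iterates stay above x, and each step multiplies the distance to 1 of
    an iterate y by (1 - y) (2 + y) / 2, which is at most 1 - x / 2. *)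
Lemma sign_iter_pos n x : 0 <= x <= 1 ->
  [/\ 0 <= sign_iter n x, x <= sign_iter n x, sign_iter n x <= 1 &
      1 - sign_iter n x <= (1 - x / 2) ^+ n].
Proof.
move=> /andP[x0 x1]; elim: n => [|n [h0 h1 h2 h3]] /=.
  by split => //; rewrite expr0; lra.
set y := sign_iter n x in h0 h1 h2 h3 *.
have y2 : y ^+ 2 <= 1 by rewrite expr_le1.
have yy : y <= y * (3 - y ^+ 2) / 2.
  by rewrite -mulrA ler_peMr//; lra.
split.
- by rewrite (le_trans h0).
- by rewrite (le_trans h1).
- rewrite -subr_ge0 (_ : _ - _ = (1 - y) ^+ 2 * (2 + y) / 2); last by field.
  by rewrite divr_ge0// mulr_ge0// ?sqr_ge0//; lra.
- rewrite [leRHS]exprS (_ : 1 - _ = ((1 - y) * (2 + y) / 2) * (1 - y)); last by field.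
  apply: ler_pM => //; first by rewrite divr_ge0// mulr_ge0//; lra.
    by rewrite subr_ge0.
  nra.
Qed.

Lemma norm_sign_iter n x : `|x| <= 1 -> `|sign_iter n x| <= 1.
Proof.
move=> x1; have [x0|x0] := leP 0 x.
  have [|h0 _ h1 _] := @sign_iter_pos n x; last by rewrite ger0_norm.
  by rewrite x0 -(ger0_norm x0).
have [|h0 _ h1 _] := @sign_iter_pos n (- x).
  by rewrite oppr_ge0 (ltW x0)/= -(ltr0_norm x0).
by move: h0 h1; rewrite sign_iterN -normrN => ? ?; rewrite ger0_norm.
Qed.

Lemma sign_iter_cvg x : `|x| <= 1 -> sign_iter n x @[n --> \oo] --> Num.sg x.
Proof.
have pos y : 0 < y -> y <= 1 -> sign_iter n y @[n --> \oo] --> (1 : R).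
  move=> y0 y1; apply/cvgrPdist_lt => e e0.
  have : (1 - y / 2) ^+ n @[n --> \oo] --> (0 : R).
    by apply: cvg_expr; rewrite ger0_norm; lra.
  move=> /cvgr0Pnorm_lt /(_ e e0); apply: filterS => n; apply: le_lt_trans.
  have [|h0 _ h1 h2] := @sign_iter_pos n y; first by rewrite (ltW y0).
  by rewrite ger0_norm ?subr_ge0// (le_trans h2)// ler_norm.
move=> x1; have [x0|x0|->] := ltgtP x 0.
- rewrite ltr0_sg//.
  have -> : (fun n => sign_iter n x) = (fun n => - sign_iter n (- x)).
    by apply/funext => n; rewrite sign_iterN opprK.
  apply: cvgN; apply: pos; first by rewrite oppr_gt0.
  by rewrite -(ltr0_norm x0).
- by rewrite gtr0_sg//; apply: pos => //; rewrite -(gtr0_norm x0).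
- rewrite sgr0 (_ : (fun n => _) = fun=> 0); first exact: cvg_cst.
  by apply/funext; elim => //= n ->; rewrite mul0r mul0r.
Qed.

(** The number of positive integers below y is its integer part. This is what
    approximates a function by averages of indicators of its level sets. *)
Lemma sum_threshold (n : nat) y : 0 <= y <= n%:R ->
  `|\sum_(j < n) (j.+1%:R <= y)%R%:R - y| <= 1.
Proof.
elim: n => [|n IH] /andP[y0 yn].
  by rewrite big_ord0 sub0r normrN ger0_norm// (le_trans yn).
rewrite big_ord_recr/=; have [yn'|yn'] := leP y n%:R.
  rewrite (_ : (n.+1%:R <= y) = false) ?addr0; first by apply: IH; rewrite y0.
  by apply/negbTE; rewrite -ltNge (le_lt_trans yn')// ltr_nat.
rewrite (eq_bigr (fun=> 1)) => [|i _]; last first.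
  by rewrite (le_trans _ (ltW yn'))// ler_nat.
rewrite sumr_const card_ord; move: yn; rewrite -natr1 ler_norml => yn.
by case: (_ <= y) => /=; apply/andP; split; lra.
Qed.

Lemma periodicz (V : zmodType) (a : R -> V) (k : int) w :
  periodic a 1 -> a (w + k%:~R) = a w.
Proof.
move=> pa; have nat_case (n : nat) y : a (y + n%:R) = a y by exact: periodicn.
case: k => n; first exact: nat_case.
by rewrite NegzE mulrNz -[w in RHS](subrK n.+1%:R) nat_case.
Qed.

Lemma cos_periodz x (k : int) : cos (x + 2 * pi * k%:~R) = cos x.
Proof.
have pi2 : 2 * pi != 0 :> R by rewrite mulf_neq0 ?pnatr_eq0// gt_eqF ?pi_gt0.
have xE : 2 * pi * (x / (2 * pi)) = x by rewrite [LHS]mulrC mulfVK.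
have p1 : periodic (fun y : R => cos (2 * pi * y)) 1.
  by move=> y; rewrite mulrDr mulr1 [X in _ + X]mulr_natl cosD2pi.
by rewrite -{1}xE -mulrDr (periodicz _ _ p1) xE.
Qed.

Lemma sin_periodz (x : R) (k : int) : sin (x + 2 * pi * k%:~R) = sin x.
Proof. by rewrite -!cosBpihalf addrAC cos_periodz. Qed.

Lemma ler_cos_mirror x y : 0 <= x <= pi -> x <= y <= 2 * pi - x -> cos y <= cos x.
Proof.
move=> /andP[x0 x1] /andP[xy yx].
have mono a b : 0 <= a <= pi -> 0 <= b <= pi -> a <= b -> cos b <= cos a.
  move=> ha hb ab; rewrite leNgt ltr_cos ?in_itv//=.
  by rewrite -leNgt.
have [ypi|ypi] := leP y pi; first by apply: mono => //; apply/andP; split; lra.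
have -> : cos y = cos (2 * pi - y).
  by rewrite -[RHS]cosN opprB -[RHS](cos_periodz _ 1) mulr1 subrK.
by apply: mono; [apply/andP; split; lra|apply/andP; split; lra|lra].
Qed.

Definition frac_part (w : R) : R := w - (Num.floor w)%:~R.

Lemma frac_part_itv w : 0 <= frac_part w < 1.
Proof.
have /andP[h1 h2] := floor_itv w.
by rewrite /frac_part subr_ge0 h1 ltrBlDl /=; move: h2; rewrite intrD.
Qed.

(** An arc of the circle is the positivity set of a trigonometric polynomial
    of degree one. *)
Lemma frac_part_gt w x : 0 <= x < 1 ->
  (x < frac_part w) = (cos (pi * (1 - x)) < cos (2 * pi * w - pi * (1 + x))).
Proof.
move=> /andP[x0 x1]; have /andP[f0 f1] := frac_part_itv w.
have pi0 := pi_gt0 R.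
have -> : cos (2 * pi * w - pi * (1 + x)) = cos (2 * pi * frac_part w - pi * (1 + x)).
  rewrite -[RHS](cos_periodz _ (Num.floor w)); congr cos.
  by rewrite /frac_part; ring.
set f := frac_part w in f0 f1 *.
apply/idP/idP => [xf|].
  have [y0|y0] := leP 0 (2 * pi * f - pi * (1 + x)).
    rewrite ltr_cos ?in_itv/=; nra.
  by rewrite -[ltRHS]cosN ltr_cos ?in_itv/=; nra.
apply: contraTT; rewrite -!leNgt => fx.
rewrite -cosN; apply: ler_cos_mirror; apply/andP; split; nra.
Qed.

End ScalarLemmas.


(** * Periodic multipliers of subspaces stable under characters *)

Section Multipliers.
Context {R : realType}.
Local Notation C := R[i].
Local Notation mu := (@lebesgue_measure R).
Local Notation N f := (cLnorm 2%:E f).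
Implicit Types (u v : R -> C) (a b g : R -> R) (A B : set R).

(** Stability under modification on null sets is contained in the last
    condition, which involves norms only. *)
Definition closed_invariant (W : set (R -> C)) :=
  [/\ W `<=` L2,
      forall (c : C) (v w : R -> C), W v -> W w -> W (fun x => c * v x + w x),
      forall k v, W v -> W (fun x => character k x * v x) &
      forall v, L2 v -> (forall e : R, 0 < e ->
        exists2 w, W w & (N (fun x => v x - w x)%R < e%:E)%E) -> W v].

Variable W : set (R -> C).
Hypothesis HW : closed_invariant W.

Let WL2 v : W v -> L2 v. Proof. by case: HW => H _ _ _; exact: H. Qed.
Let Wlin (c : C) v (w : R -> C) : W v -> W w -> W (fun x => c * v x + w x).
Proof. by case: HW => _ H _ _; exact: H. Qed.
Let Wchar k v : W v -> W (fun x => character k x * v x).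
Proof. by case: HW => _ _ H _; exact: H. Qed.
Let Wclosed v : L2 v -> (forall e : R, 0 < e ->
        exists2 w, W w & (N (fun x => v x - w x)%R < e%:E)%E) -> W v.
Proof. by case: HW => _ _ _ H; exact: H. Qed.

Lemma closed_invariantZ (c : C) v : W v -> W (fun x => c * v x).
Proof.
move=> Wv; rewrite (_ : (fun x => _) = (fun x => (c - 1) * v x + v x)); first exact: Wlin.
by apply/funext => x; ring.
Qed.

(** The bound is part of the definition because limits of multipliers are
    taken by dominated convergence. *)
Definition multiplier a :=
  (exists M : R, forall w, `|a w| <= M) /\
  forall v, W v -> W (fun w => (a w)%:C%C * v w).

Lemma multiplier_cst (r : R) : multiplier (fun=> r).
Proof.
split; first by exists `|r|.
by move=> v; exact: closed_invariantZ.
Qed.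

Lemma realcD (x y : R) : (x + y)%:C%C = x%:C%C + y%:C%C :> C.
Proof. exact: rmorphD. Qed.
Lemma realcM (x y : R) : (x * y)%:C%C = x%:C%C * y%:C%C :> C.
Proof. exact: rmorphM. Qed.

Lemma multiplierD a b : multiplier a -> multiplier b -> multiplier (fun w => a w + b w).
Proof.
move=> [[M aM] aW] [[M' bM] bW]; split.
  by exists (M + M') => w; rewrite (le_trans (ler_normD _ _))// lerD.
move=> v Wv.
rewrite (_ : (fun w => _) = (fun w => 1 * ((a w)%:C%C * v w) + (b w)%:C%C * v w)).
  by apply: Wlin; [exact: aW|exact: bW].
by apply/funext => w; rewrite realcD mul1r mulrDl.
Qed.

Lemma multiplierM a b : multiplier a -> multiplier b -> multiplier (fun w => a w * b w).
Proof.
move=> [[M aM] aW] [[M' bM] bW]; split.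
  by exists (M * M') => w; rewrite normrM ler_pM.
move=> v Wv.
rewrite (_ : (fun w => _) = (fun w => (a w)%:C%C * ((b w)%:C%C * v w))).
  by apply: aW; exact: bW.
by apply/funext => w; rewrite realcM mulrA.
Qed.

Lemma multiplierZ (r : R) a : multiplier a -> multiplier (fun w => r * a w).
Proof. by move=> ma; apply: (multiplierM (multiplier_cst r)). Qed.

Lemma multiplier_lim (f : nat -> R -> R) (M : R) g : (forall n, multiplier (f n)) ->
  (forall n w, `|f n w| <= M) -> (forall w, f n w @[n --> \oo] --> g w) -> multiplier g.
Proof.
move=> mf fM fg.
have gM w : `|g w| <= M.
  by apply: (cvgr_to_le (cvg_norm (fg w))); apply: nearW.
split; first by exists M.
move=> v Wv; have [mv Nv] := WL2 Wv.
have mfv n : cmeasurable (fun w => (f n w)%:C%C * v w).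
  by have [] := WL2 ((mf n).2 v Wv).
have cvg_re (p : C -> R) (r : R -> R) : (forall n, measurable_fun setT
      (fun w => p ((f n w)%:C%C * v w))) ->
    (forall (t : R) z, p (t%:C%C * z) = t * p z) ->
    measurable_fun setT (fun w => p ((g w)%:C%C * v w)).
  move=> mp pZ; apply: (measurable_fun_cvg mp) => w _.
  under eq_fun do rewrite pZ.
  by rewrite pZ; apply: cvgMr_tmp.
have mgv : cmeasurable (fun w => (g w)%:C%C * v w).
  split; apply: cvg_re => //.
  - by move=> n; have [] := mfv n.
  - by move=> t z; rewrite complex_ReM /= mul0r subr0.
  - by move=> n; have [] := mfv n.
  - by move=> t z; rewrite complex_ImM /= mul0r addr0.
have M0 : 0 <= M := le_trans (normr_ge0 _) (gM 0).
have L2M : L2 (fun w => ((2 * M)%:C)%C * v w) by apply: L2Z; split.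
have Lgv : L2 (fun w => (g w)%:C%C * v w).
  apply: L2_le mgv L2M _ => w; rewrite !Normc.normcM ler_wpM2r ?normc_ge0//.
  by rewrite !normc_real (le_trans (gM w))// ger0_norm; lra.
apply: Wclosed => // e e0.
have := @cLnorm_dominated R (fun n w => (g w)%:C%C * v w - (f n w)%:C%C * v w)
  (fun w => ((2 * M)%:C)%C * v w).
move=> /(_ _ L2M _ _ e e0).
have H1 n : cmeasurable (fun w => (g w)%:C%C * v w - (f n w)%:C%C * v w).
  exact: cmeasurableB.
have E n w : Normc.normc ((g w)%:C%C * v w - (f n w)%:C%C * v w) =
    `|g w - f n w| * Normc.normc (v w).
  by rewrite -mulrBl -realcB Normc.normcM normc_real.
have H2 n w : Normc.normc ((g w)%:C%C * v w - (f n w)%:C%C * v w) <=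
    Normc.normc (((2 * M)%:C)%C * v w).
  rewrite E Normc.normcM ler_wpM2r ?normc_ge0// normc_real [leRHS]ger0_norm ?mulr_ge0//.
  by rewrite (le_trans (ler_normB _ _))// mulr_natl mulr2n lerD.
have H3 : {ae mu, forall w, Normc.normc ((g w)%:C%C * v w - (f n w)%:C%C * v w)
    @[n --> \oo] --> (0 : R)}.
  apply: ae_all => w.
  have h1 : `|g w - f n w| @[n --> \oo] --> (0 : R).
    rewrite -[X in _ --> X](@normr0 R R) -(subrr (g w)).
    by apply: cvg_norm; apply: cvgB; [exact: cvg_cst|exact: fg].
  have h2 : `|g w - f n w| * Normc.normc (v w) @[n --> \oo] --> (0 : R).
    by rewrite -[X in _ --> X](mul0r (Normc.normc (v w))); apply: cvgMr_tmp.
  apply: cvg_trans h2; apply: near_eq_cvg; apply: nearW => n.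
  by rewrite E.
move=> /(_ H1 H2 H3)[n _ /(_ n (leqnn n)) nlt].
by exists (fun w => (f n w)%:C%C * v w) => //; apply (mf n).2.
Qed.

Lemma multiplier_trig (r s : R) :
  multiplier (fun w => r * cos (2 * pi * w) + s * sin (2 * pi * w)).
Proof.
split.
  exists (`|r| + `|s|) => w; rewrite (le_trans (ler_normD _ _))// !normrM lerD//.
    by rewrite ler_piMr// norm_cos_le1.
  by rewrite ler_piMr// norm_sin_le1.
move=> v Wv.
(* Euler's formulas for the cosine and the sine. *)
pose c1 : C := Complex (r / 2) (s / 2); pose c2 : C := Complex (r / 2) (- s / 2).
rewrite (_ : (fun w => _) = (fun w => c1 * (character 1 w * v w) +
    c2 * (character (-1) w * v w))).
  by apply: Wlin; [exact: Wchar|apply: closed_invariantZ; exact: Wchar].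
apply/funext => w; rewrite !mulrA -mulrDl; congr (_ * _).
rewrite /character /c1 /c2 (_ : 2 * pi * 1%:~R * w = 2 * pi * w); last by rewrite mulr1.
rewrite (_ : - (2 * pi * (-1)%:~R * w) = 2 * pi * w); last by rewrite mulrN1 mulNr opprK.
rewrite /expi cosN sinN.
by apply/eqP; rewrite eq_complex /=; apply/andP; split; apply/eqP; field.
Qed.

(** Up to a rescaling, the iterates of [sign_iter] at the multiplier are
    polynomials in it. They converge to its sign s, and (s + s^2) / 2 is the
    indicator of s = 1. *)
Lemma multiplier_gt0 a : multiplier a -> multiplier (\1_[set w | 0 < a w]).
Proof.
move=> ma; have [[M aM] _] := ma.
have M0 : 0 <= M := le_trans (normr_ge0 _) (aM 0).
pose b w := (M + 1)^-1 * a w.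
have mb : multiplier b by exact: multiplierZ.
have b1 w : `|b w| <= 1.
  rewrite normrM ger0_norm ?invr_ge0 ?addr_ge0// mulrC ler_pdivrMr ?ltr_wpDl// mul1r.
  by rewrite (le_trans (aM w))// lerDl.
have ms n : multiplier (fun w => sign_iter n (b w)).
  elim: n => //= n IH.
  have m2 : multiplier (fun w => -1 * (sign_iter n (b w) * sign_iter n (b w))).
    by apply: multiplierZ; exact: multiplierM.
  have := multiplierZ 2^-1 (multiplierM IH (multiplierD (multiplier_cst 3) m2)).
  by congr multiplier; apply/funext => w; rewrite expr2; field.
have msg : multiplier (fun w => Num.sg (b w)).
  apply: (@multiplier_lim (fun n w => sign_iter n (b w)) 1) => //.
  - by move=> n w; exact: norm_sign_iter.
  - by move=> w; exact: sign_iter_cvg.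
have := multiplierZ 2^-1 (multiplierD msg (multiplierM msg msg)).
congr multiplier; apply/funext => w; rewrite indicE.
have M1 : 0 < (M + 1)^-1 by rewrite invr_gt0 ltr_wpDl.
rewrite (_ : (w \in _) = (0 < b w)); last first.
  rewrite /b pmulr_rgt0//; apply/idP/idP => [/set_mem//|aw].
  exact/mem_set.
by case: (sgrP (b w)) => ? /=; field.
Qed.

Definition multiplier_set A := multiplier (\1_A).

Lemma multiplier_setC A : multiplier_set A -> multiplier_set (~` A).
Proof.
move=> mA; have := multiplierD (multiplier_cst 1) (multiplierZ (-1) mA).
congr multiplier; apply/funext => w; rewrite !indicE in_setC.
by case: (w \in A) => /=; ring.
Qed.

Lemma multiplier_setI A B : multiplier_set A -> multiplier_set B ->
  multiplier_set (A `&` B).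
Proof. by move=> mA mB; rewrite /multiplier_set indicI; exact: multiplierM. Qed.

Lemma multiplier_setU A B : multiplier_set A -> multiplier_set B ->
  multiplier_set (A `|` B).
Proof.
move=> mA mB; rewrite -[_ `|` _]setCK setCU; apply: multiplier_setC.
by apply: multiplier_setI; exact: multiplier_setC.
Qed.

Lemma multiplier_set0 : multiplier_set set0.
Proof. by rewrite /multiplier_set indic0; exact: multiplier_cst. Qed.

Lemma multiplier_bigcup (F : nat -> set R) : (forall n, multiplier_set (F n)) ->
  multiplier_set (\bigcup_n F n).
Proof.
move=> mF.
have mU n : multiplier_set (\big[setU/set0]_(i < n) F i).
  elim: n => [|n IH]; first by rewrite big_ord0; exact: multiplier_set0.
  by rewrite big_ord_recr; exact: multiplier_setU.
apply: (multiplier_lim mU (M := 1)) => [n w|w].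
  by rewrite indicE; case: (_ \in _); rewrite ?normr0 ?normr1.
have [[n _ Fn]|nF] := pselect ((\bigcup_n F n) w).
  apply: cvg_near_cst; exists n.+1 => // k /= nk; apply/eqP.
  rewrite !indicE !mem_set//; first by exists n.
  by rewrite -bigcup_mkord; exists n.
apply: cvg_near_cst; apply: nearW => k; apply/eqP.
rewrite !indicE !memNset//; apply: contra_not nF.
by rewrite -bigcup_mkord => -[i _ Fi]; exists i.
Qed.

(** The sets whose periodization has a multiplier as indicator form a
    sigma-algebra, and [frac_part_gt] provides the half-lines. *)
Lemma multiplier_periodic_preimage A : measurable A ->
  multiplier_set (frac_part @^-1` A).
Proof.
suff : (@ocitv R).-sigma.-measurable `<=` [set A | multiplier_set (@frac_part R @^-1` A)] by apply.
rewrite RGenOInfty.measurableE; apply: smallest_sub; first split.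
- by rewrite /= preimage_set0; exact: multiplier_set0.
- by move=> B /= mB; rewrite setTD preimage_setC; exact: multiplier_setC.
- by move=> F mF /=; rewrite preimage_bigcup; exact: multiplier_bigcup.
move=> _ [x ->] /=.
have [x0|x0] := ltP x 0.
  rewrite (_ : _ @^-1` _ = ~` set0).
    by apply: multiplier_setC; exact: multiplier_set0.
  rewrite setC0; apply/seteqP; split=> w //= _; rewrite in_itv/= andbT.
  by have /andP[h _] := frac_part_itv w; exact: lt_le_trans x0 h.
have [x1|x1] := leP 1 x.
  rewrite (_ : _ @^-1` _ = set0); first exact: multiplier_set0.
  apply/seteqP; split=> w //=; rewrite in_itv/= andbT => xw.
  have /andP[_] := frac_part_itv w; lra.
have := multiplier_gt0 (multiplierD (multiplier_trig (cos (pi * (1 + x))) (sin (pi * (1 + x))))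
  (multiplier_cst (- cos (pi * (1 - x))))).
rewrite /multiplier_set; congr (multiplier (\1__)); apply/seteqP.
split=> w /=; rewrite in_itv/= andbT frac_part_gt ?x0// cosB subr_gt0;
  by rewrite ![cos (2 * pi * w) * _]mulrC ![sin (2 * pi * w) * _]mulrC.
Qed.

Lemma periodic_frac_part a w : periodic a 1 -> a (frac_part w) = a w.
Proof.
by move=> pa; rewrite /frac_part -mulrNz periodicz.
Qed.

Lemma multiplier_unit_interval a : measurable_fun setT a -> periodic a 1 ->
  (forall w, 0 <= a w <= 1) -> multiplier a.
Proof.
move=> ma pa a01.
pose A (c : R) := [set w | c <= a w].
have mA c : multiplier_set (A c).
  have -> : A c = @frac_part R @^-1` (A c).
    by apply/seteqP; split=> w /=; rewrite /A/= periodic_frac_part.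
  apply: multiplier_periodic_preimage; rewrite /A -[X in measurable X]setTI.
  by apply: measurable_fun_le => //; exact: measurable_cst.
(* The integer part of (n + 1) a, divided by n + 1. *)
pose f (n : nat) w := n.+1%:R^-1 * \sum_(j < n.+1) (\1_(A (j.+1%:R / n.+1%:R)) w : R).
have mf n : multiplier (f n).
  apply: multiplierZ.
  suff : forall k, multiplier (fun w =>
    \sum_(j < k) (\1_(A (j.+1%:R / n.+1%:R)) w : R)) by [].
  elim=> [|k IH].
    by under eq_fun do rewrite big_ord0; exact: multiplier_cst.
  by under eq_fun do rewrite big_ord_recr; apply: multiplierD; [exact: IH|exact: mA].
have fa n w : `|f n w - a w| <= n.+1%:R^-1.
  have n0 : 0 < n.+1%:R :> R by [].
  rewrite (_ : _ - _ = n.+1%:R^-1 *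
      (\sum_(j < n.+1) (j.+1%:R <= n.+1%:R * a w)%R%:R - n.+1%:R * a w)); last first.
    rewrite mulrBr mulKf ?gt_eqF//; congr (_ * _ - _); apply: eq_bigr => j _.
    rewrite indicE; congr (nat_of_bool _)%:R.
    apply/idP/idP => [/set_mem|h]; first by rewrite /A/= ler_pdivrMr// mulrC.
    by apply/mem_set; rewrite /A/= ler_pdivrMr// mulrC.
  rewrite normrM ger0_norm ?invr_ge0// ler_piMr ?invr_ge0// sum_threshold//.
  by have /andP[h1 h2] := a01 w; rewrite mulr_ge0//= ler_piMr.
apply: (multiplier_lim mf (M := 2)) => [n w|w].
  have := fa n w; have /andP[h1 h2] := a01 w.
  have : (n.+1%:R^-1 : R) <= 1 by rewrite invf_le1// ler1n.
  move: (f n w) (a w) (n.+1%:R^-1 : R) h1 h2 => p q t q0 q1 t1.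
  rewrite !ler_norml => /andP[? ?]; apply/andP; split; lra.
apply/cvgrPdistC_lt => e e0; near=> n.
apply: le_lt_trans (fa n w) _.
by near: n; exact: (near_infty_natSinv_lt (PosNum e0)).
Unshelve. all: by end_near. Qed.

Lemma multiplier_bounded a : measurable_fun setT a -> periodic a 1 ->
  (exists M : R, forall w, `|a w| <= M) -> multiplier a.
Proof.
move=> ma pa [M aM].
(* An affine map takes the range of [a] into the unit interval. *)
pose K := `|M| + 1; have K0 : 0 < K by rewrite ltr_wpDl.
have aK w : - K <= a w <= K.
  by rewrite -ler_norml (le_trans (aM w))// (le_trans (ler_norm _))// lerDl.
have mb : multiplier (fun w => (a w + K) / (2 * K)).
  apply: multiplier_unit_interval.
  - by apply: measurable_funM => //; apply: measurable_funD.
  - by move=> w; rewrite pa.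
  - move=> w; have /andP[h1 h2] := aK w.
    rewrite divr_ge0 ?mulr_ge0 ?(ltW K0)//=; last by lra.
    rewrite ler_pdivrMr ?mulr_gt0//; lra.
have := multiplierD (multiplierZ (2 * K) mb) (multiplier_cst (- K)).
by congr multiplier; apply/funext => w; field; rewrite gt_eqF.
Qed.

(** Cutting [c] off where its modulus exceeds n reduces the claim to bounded
    multipliers; dominated convergence removes the cutoff. *)
Lemma closed_invariant_periodic (c : R -> C) v : cmeasurable c -> periodic c 1 ->
  W v -> L2 (fun w => c w * v w) -> W (fun w => c w * v w).
Proof.
move=> [mc1 mc2] pc Wv Lcv; have mcc : cmeasurable c by split.
pose cn (n : nat) w : C := if Normc.normc (c w) <= n%:R then c w else 0.
have Wn n : W (fun w => cn n w * v w).
  have mn : measurable_fun setT (fun w => Normc.normc (c w) <= n%:R).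
    by apply: measurable_fun_ler => //; exact: measurable_normc.
  have m1 : multiplier (fun w => complex.Re (cn n w)).
    apply: multiplier_bounded.
    - rewrite (_ : (fun w => _) = (fun w => if Normc.normc (c w) <= n%:R then complex.Re (c w) else 0)).
        exact: measurable_fun_ifT.
      by apply/funext => w; rewrite /cn; case: ifPn.
    - by move=> w; rewrite /cn pc.
    - exists n%:R => w; rewrite (le_trans (ler_Re_normc _))// /cn.
      by case: ifPn => // _; rewrite Normc.normc0.
  have m2 : multiplier (fun w => complex.Im (cn n w)).
    apply: multiplier_bounded.
    - rewrite (_ : (fun w => _) = (fun w => if Normc.normc (c w) <= n%:R then complex.Im (c w) else 0)).
        exact: measurable_fun_ifT.
      by apply/funext => w; rewrite /cn; case: ifPn.
    - by move=> w; rewrite /cn pc.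
    - exists n%:R => w; rewrite (le_trans (ler_Im_normc _))// /cn.
      by case: ifPn => // _; rewrite Normc.normc0.
  rewrite (_ : (fun w => _) = (fun w => Complex 0 1 * ((complex.Im (cn n w))%:C%C * v w) +
     (complex.Re (cn n w))%:C%C * v w)).
    by apply: Wlin; [exact: m2.2|exact: m1.2].
  apply/funext => w; rewrite mulrA -mulrDl; congr (_ * _).
  rewrite {1}[cn n w]complexE; apply/eqP; rewrite eq_complex /=; apply/andP.
  by split; apply/eqP; ring.
apply: Wclosed => // e e0.
have := @cLnorm_dominated R (fun n w => c w * v w - cn n w * v w) (fun w => c w * v w).
move=> /(_ _ Lcv _ _ e e0).
have H1 n : cmeasurable (fun w => c w * v w - cn n w * v w).
  by apply: cmeasurableB; [case: Lcv|case: (WL2 (Wn n))].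
have H2 n w : Normc.normc (c w * v w - cn n w * v w) <= Normc.normc (c w * v w).
  rewrite /cn; case: ifPn => _; first by rewrite subrr Normc.normc0 normc_ge0.
  by rewrite mul0r subr0.
have H3 : {ae mu, forall w, Normc.normc (c w * v w - cn n w * v w) @[n --> \oo] --> (0 : R)}.
  apply: ae_all => w; apply/cvgr0Pnorm_lt => r r0; near=> n.
  rewrite /cn (_ : Normc.normc (c w) <= n%:R); last by near: n; exact: nbhs_infty_ger.
  by rewrite subrr Normc.normc0 normr0.
move=> /(_ H1 H2 H3)[n _ /(_ n (leqnn n)) nlt].
by exists (fun w => cn n w * v w).
Unshelve. all: by end_near. Qed.

End Multipliers.


(** * Shift-invariant spaces and their Fourier images *)

Section ShiftSpace.
Context {R : realType}.
Local Notation C := R[i].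
Local Notation mu := (@lebesgue_measure R).
Local Notation N f := (cLnorm 2%:E f).
Implicit Types (f g h u v : R -> C).

(** Index lists of linear combinations may have repetitions; counting
    multiplicities brings two combinations to a common index list. *)
Lemma sum_undup_count (V : nmodType) (r r0 : seq int) (F : int -> V) :
  uniq r0 -> {subset r <= r0} ->
  \sum_(k <- r) F k = \sum_(k <- r0) F k *+ count_mem k r.
Proof.
move=> u0; elim: r => [|a r IH] sr.
  by rewrite big_nil big1.
rewrite big_cons IH; last by move=> x xr; apply: sr; rewrite inE xr orbT.
under [RHS]eq_bigr do rewrite /= mulrnDr.
rewrite big_split/=; congr (_ + _).
rewrite (bigD1_seq a) ?sr ?mem_head//= eqxx mulr1n big1 ?addr0// => i ia.
by rewrite eq_sym (negbTE ia).
Qed.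

Lemma shift_spanDZ f (c : C) g h : shift_span f g -> shift_span f h ->
  shift_span f (fun x => c * g x + h x).
Proof.
move=> [r1 [c1 ->]] [r2 [c2 ->]].
pose r0 := undup (r1 ++ r2).
exists r0, (fun k => c * (c1 k *+ count_mem k r1) + c2 k *+ count_mem k r2).
apply/funext => x.
rewrite (@sum_undup_count _ r1 r0) ?undup_uniq//; last first.
  by move=> y yr; rewrite mem_undup mem_cat yr.
rewrite (@sum_undup_count _ r2 r0) ?undup_uniq//; last first.
  by move=> y yr; rewrite mem_undup mem_cat yr orbT.
rewrite mulr_sumr -big_split/=; apply: eq_bigr => k _.
by rewrite mulrDl -!mulrnAl -mulrA.
Qed.

Lemma shift_span_shift f k g : shift_span f g -> shift_span f (Defs.shift g k).
Proof.
move=> [r [c ->]]; exists [seq j + k | j <- r], (fun j => c (j - k)).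
apply/funext => x; rewrite big_map /Defs.shift; apply: eq_bigr => j _.
by rewrite addrK intrD; congr (_ * f _); ring.
Qed.

Lemma shift_span_self f : shift_span f f.
Proof.
exists [:: 0], (fun=> 1); apply/funext => x.
by rewrite big_seq1 mul1r /Defs.shift subr0.
Qed.

Lemma shift_span_L2 f g : L2 f -> shift_span f g -> L2 g.
Proof.
move=> Lf [r [c ->]]; apply: L2_sum => k; apply: L2Z; exact: L2_shift.
Qed.

(** Taking closures is idempotent. *)
Lemma closure_approx (W : set (R -> C)) v : cmeasurable v -> W `<=` L2 ->
  (forall e : R, 0 < e -> exists2 w, (L2 w /\ forall d : R, 0 < d ->
      exists2 h, W h & (N (fun x => w x - h x)%R < d%:E)%E) &
    (N (fun x => v x - w x)%R < e%:E)%E) ->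
  forall e : R, 0 < e -> exists2 h, W h & (N (fun x => v x - h x)%R < e%:E)%E.
Proof.
move=> mv WL H e e0; have e2 : 0 < e / 2 by rewrite divr_gt0.
have [w [[mw _] wW] vw] := H _ e2.
have [h Wh wh] := wW _ e2; exists h => //.
have [mh _] := WL _ Wh.
apply: le_lt_trans (cLnorm_triangle mv mw mh) _.
rewrite (_ : e%:E = (e / 2)%:E + (e / 2)%:E)%E; last by rewrite -EFinD -splitr.
exact: lteD.
Qed.

Lemma shift_space_self f : L2 f -> shift_space f f.
Proof.
move=> Lf; split => // e e0; exists f; first exact: shift_span_self.
rewrite (_ : (f \- f)%R = fun=> 0); first by rewrite cLnorm0 lte_fin.
by apply/funext => x /=; rewrite subrr.
Qed.

Lemma shift_space_closed f v : L2 f -> L2 v ->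
  (forall e : R, 0 < e ->
    exists2 w, shift_space f w & (N (fun x => v x - w x)%R < e%:E)%E) ->
  shift_space f v.
Proof.
move=> Lf Lv H; split => //; apply: closure_approx => //.
- by case: Lv.
- by move=> g; exact: shift_span_L2.
Qed.

Lemma shift_space_DZ f (c : C) g h : L2 f -> shift_space f g -> shift_space f h ->
  shift_space f (fun x => c * g x + h x).
Proof.
move=> Lf [Lg gf] [Lh hf]; split; first by apply: L2D => //; exact: L2Z.
move=> e e0; pose c' := Normc.normc c + 1.
have c0 : 0 < c' by rewrite ltr_wpDl ?normc_ge0.
have e1 : 0 < e / 2 / c' by rewrite !divr_gt0.
have e2 : 0 < e / 2 by rewrite divr_gt0.
have [g' sg' gg'] := gf _ e1; have [h' sh' hh'] := hf _ e2.
exists (fun x => c * g' x + h' x); first exact: shift_spanDZ.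
have Lg' := shift_span_L2 Lf sg'; have Lh' := shift_span_L2 Lf sh'.
have Lgg := L2B Lg Lg'; have Lhh := L2B Lh Lh'.
rewrite (_ : (_ \- _)%R = (fun x => c * (g x - g' x) + (h x - h' x))); last first.
  by apply/funext => x /=; ring.
apply: le_lt_trans (cLnormD (L2Z c Lgg).1 Lhh.1) _.
rewrite (_ : e%:E = (e / 2)%:E + (e / 2)%:E)%E; last by rewrite -EFinD -splitr.
apply: lteD; last exact: hh'.
rewrite cLnormZ; last exact: Lgg.1.
apply: (@le_lt_trans _ _ ((Normc.normc c)%:E * (e / 2 / c')%:E)%E).
  by rewrite lee_wpmul2l ?lee_fin ?normc_ge0// ltW.
rewrite -EFinM lte_fin mulrCA gtr_pMr// ltr_pdivrMr// mul1r /c'.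
by rewrite ltrDl.
Qed.

Lemma shift_space_shift f k g : L2 f -> shift_space f g ->
  shift_space f (Defs.shift g k).
Proof.
move=> Lf [Lg gf]; split; first exact: L2_shift.
move=> e e0; have [h sh gh] := gf e e0.
exists (Defs.shift h k); first exact: shift_span_shift.
have mgh := (L2B Lg (shift_span_L2 Lf sh)).1.
by rewrite -(cLnorm_shift k mgh) in gh.
Qed.

Lemma shift_space_ae f g h : L2 f -> shift_space f g -> cmeasurable h ->
  {ae mu, forall x, h x = g x} -> shift_space f h.
Proof.
move=> Lf [Lg gf] mh hg; split; first exact: L2_ae_eq mh Lg hg.
move=> e e0; have [w sw gw] := gf e e0; exists w => //.
have mw := (shift_span_L2 Lf sw).1.
rewrite (_ : N _ = N (g \- w)%R)//; apply: ae_eq_cLnorm.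
- exact: cmeasurableB.
- by apply: cmeasurableB => //; case: Lg.
- by apply: ae_imp hg => x /= ->.
Qed.

Lemma shift_space_sum f I (r : seq I) (G : I -> R -> C) : L2 f ->
  (forall i, shift_space f (G i)) -> shift_space f (fun x => \sum_(i <- r) G i x).
Proof.
move=> Lf sG; elim: r => [|i r IH].
  under eq_fun do rewrite big_nil.
  have := shift_space_DZ (-1) Lf (shift_space_self Lf) (shift_space_self Lf).
  by rewrite (_ : (fun x => _) = (fun=> 0))//; apply/funext => x; rewrite mulN1r addNr.
under eq_fun do rewrite big_cons.
have := shift_space_DZ 1 Lf (sG i) IH.
by under eq_fun do rewrite mul1r.
Qed.

Lemma shift_space_sub f g : L2 f -> shift_space f g -> shift_space g `<=` shift_space f.
Proof.
move=> Lf sg h [Lh hg]; apply: shift_space_closed => // e e0.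
have [w [r [c ->]] hw] := hg e e0; exists (fun x => \sum_(k <- r) c k * Defs.shift g k x) => //.
apply: shift_space_sum => // k.
have := shift_space_DZ (c k - 1) Lf (shift_space_shift k Lf sg) (shift_space_shift k Lf sg).
rewrite (_ : (fun x => _) = (fun x => c k * Defs.shift g k x))//.
by apply/funext => x; ring.
Qed.

Lemma fourier_L2 f : L2 f -> L2 (fourier f).
Proof. by move=> /is_fourier_fourier[]. Qed.

Lemma fourier_isometry f g : L2 f -> L2 g ->
  N (fun w => fourier f w - fourier g w)%R = N (fun x => f x - g x)%R.
Proof.
move=> Lf Lg.
have := is_fourier_DZ (-1) Lg Lf (is_fourier_fourier Lg) (is_fourier_fourier Lf).
move=> /(is_fourier_isometry (L2D (L2Z _ Lg) Lf)).
under eq_fun do rewrite mulN1r addrC.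
by move=> ->; under eq_fun do rewrite mulN1r addrC.
Qed.

Lemma fourierDZ (c : C) f g : L2 f -> L2 g ->
  {ae mu, forall w, fourier (fun x => c * f x + g x) w = c * fourier f w + fourier g w}.
Proof.
move=> Lf Lg; have Lcf := L2D (L2Z c Lf) Lg.
apply: (is_fourier_unique Lcf); first exact: is_fourier_fourier.
by apply: is_fourier_DZ => //; exact: is_fourier_fourier.
Qed.

Lemma fourier_shift f k : L2 f ->
  {ae mu, forall w, fourier (Defs.shift f k) w = character k w * fourier f w}.
Proof.
move=> Lf; have Ls := L2_shift k Lf.
apply: (is_fourier_unique Ls); first exact: is_fourier_fourier.
by apply: is_fourier_shift => //; exact: is_fourier_fourier.
Qed.

Lemma fourier_sum I (r : seq I) (G : I -> R -> C) : (forall i, L2 (G i)) ->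
  {ae mu, forall w, fourier (fun x => \sum_(i <- r) G i x) w =
                    \sum_(i <- r) fourier (G i) w}.
Proof.
move=> LG; elim: r => [|i r IH].
  have H := fourierDZ (-1) (@L2_0 R) (@L2_0 R).
  apply: ae_imp H => w; rewrite [X in _ = X -> _](_ : _ = 0); last by ring.
  move=> H0; rewrite big_nil -[RHS]H0; congr (fourier _ w).
  by apply/funext => x; rewrite big_nil mulr0 addr0.
have H := fourierDZ 1 (LG i) (L2_sum r LG).
apply: ae_imp2 H IH => w H1 H2.
rewrite big_cons -H2 -[X in X + _]mul1r -H1; congr (fourier _ w).
by apply/funext => x; rewrite big_cons mul1r.
Qed.

Definition fourier_image f : set (R -> C) :=
  [set v | L2 v /\ exists2 g, shift_space f g & {ae mu, forall w, v w = fourier g w}].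

(** Closedness combines the isometry, by which approximations on the Fourier
    side come from a Cauchy sequence in the space, with completeness;
    translations become multiplications by characters. *)
Lemma fourier_image_closed_invariant f : L2 f -> closed_invariant (fourier_image f).
Proof.
move=> Lf; split.
- by move=> v [].
- move=> c v w [Lv [g sg vg]] [Lw [h sh wh]]; split; first by apply: L2D => //; exact: L2Z.
  exists (fun x => c * g x + h x); first exact: shift_space_DZ.
  have Lg := sg.1; have Lh := sh.1.
  have := fourierDZ c Lg Lh; apply: ae_imp2 (_ : {ae mu, forall x, v x = fourier g x /\ w x = fourier h x}).
    by move=> x [-> ->] ->.
  by apply: ae_imp2 vg wh.
- move=> k v [Lv [g sg vg]]; split; first by have [] := L2_mul_character k Lv.
  exists (Defs.shift g k); first exact: shift_space_shift.
  by apply: ae_imp2 vg (fourier_shift k sg.1) => w -> ->.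
- move=> v Lv H.
  have h n : 0 < (2^-1 ^+ n / 2 / 2 : R) by rewrite !divr_gt0 ?exprn_gt0// invr_gt0.
  pose w n := projT1 (cid2 (H _ (h n))).
  have Ww n : fourier_image f (w n) by rewrite /w; case: cid2.
  have vw n : (N (fun x => v x - w n x)%R < (2^-1 ^+ n / 2 / 2)%:E)%E.
    by rewrite /w; case: cid2.
  pose g n := projT1 (cid2 (Ww n).2).
  have sg n : shift_space f (g n) by rewrite /g; case: cid2.
  have wg n : {ae mu, forall x, w n x = fourier (g n) x} by rewrite /g; case: cid2.
  have Lg n := (sg n).1; have LFg n := fourier_L2 (Lg n).
  have vFg n : (N (fun x => v x - fourier (g n) x)%R < (2^-1 ^+ n / 2 / 2)%:E)%E.
    rewrite (_ : N _ = N (fun x => v x - w n x)%R)//; apply: ae_eq_cLnorm.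
    + by apply: cmeasurableB; [case: Lv|case: (LFg n)].
    + by apply: cmeasurableB; [case: Lv|case: (Ww n).1].
    + by apply: ae_imp (wg n) => x ->.
  have Ng n : (N (fun x => g n.+1 x - g n x)%R <= (2^-1 ^+ n)%:E)%E.
    rewrite -fourier_isometry//.
    apply: le_trans (cLnorm_triangle (LFg n.+1).1 Lv.1 (LFg n).1) _.
    rewrite [X in (X + _ <= _)%E]cLnormB.
    apply: le_trans (leeD (ltW (vFg n.+1)) (ltW (vFg n))) _.
    rewrite -EFinD lee_fin exprS.
    have : 0 < (2^-1 ^+ n : R) by rewrite exprn_gt0.
    lra.
  have [g0 Lg0 gg0] := L2_complete Lg Ng.
  have half e : 0 < e -> exists n : nat, (4 * 2^-1 ^+ n : R) < e.
    move=> e0; have : (2^-1 ^+ n : R) @[n --> \oo] --> (0 : R).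
      by apply: cvg_expr; rewrite ger0_norm// invf_lt1// ltr1n.
    move=> /cvgr0Pnorm_lt /(_ (e / 4)) [|n _ /(_ n (leqnn n)) ne]; first by rewrite divr_gt0.
    by exists n; rewrite mulrC -ltr_pdivlMr// (le_lt_trans (ler_norm _)).
  split => //; exists g0.
    apply: shift_space_closed => // e e0; have [n ne] := half e e0.
    exists (g n) => //; rewrite cLnormB (le_lt_trans (gg0 n))// lte_fin.
    apply: le_lt_trans ne; rewrite ler_wpM2r ?exprn_ge0//; lra.
  have LFg0 := fourier_L2 Lg0.
  suff : N (fun x => v x - fourier g0 x)%R = 0%E.
    move/(cLnorm_eq0 (cmeasurableB Lv.1 LFg0.1)); apply: ae_imp => x.
    exact: subr0_eq.
  apply/eqP; rewrite eq_le cLnorm_ge0 andbT; apply/lee_addgt0Pr => e e0.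
  have [n ne] := half e e0; rewrite add0e.
  apply: le_trans (cLnorm_triangle Lv.1 (LFg n).1 LFg0.1) _.
  rewrite fourier_isometry//.
  apply: le_trans (leeD (ltW (vFg n)) (gg0 n)) _.
  rewrite -EFinD lee_fin.
  have : 0 < (2^-1 ^+ n : R) by rewrite exprn_gt0.
  lra.
Qed.

End ShiftSpace.


(** * Periodic factors *)

Section PeriodicQuotient.
Context {R : realType}.
Local Notation C := R[i].
Local Notation mu := (@lebesgue_measure R).
Local Notation N f := (cLnorm 2%:E f).
Implicit Types (f g h u v : R -> C).

Lemma periodic_character k : periodic (@character R k) 1.
Proof.
move=> w; rewrite /character.
rewrite (_ : - (2 * pi * k%:~R * (w + 1)) =
  - (2 * pi * k%:~R * w) + 2 * pi * (- k)%:~R); last by rewrite mulrNz; ring.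
by rewrite /expi cos_periodz sin_periodz.
Qed.

Lemma shift_span_fourier f g : L2 f -> shift_span f g ->
  exists p : R -> C, [/\ cmeasurable p, periodic p 1 &
    {ae mu, forall w, fourier g w = p w * fourier f w}].
Proof.
move=> Lf [r [c ->]]; exists (fun w => \sum_(k <- r) c k * character k w); split.
- apply: cmeasurable_sum => k; apply: cmeasurableM; first exact: cmeasurable_cst.
  exact: cmeasurable_character.
- by move=> w; apply: eq_bigr => k _; rewrite periodic_character.
- have LG k : L2 (fun x => c k * Defs.shift f k x) by apply: L2Z; exact: L2_shift.
  have H1 := fourier_sum r LG.
  have H2 : {ae mu, forall w, \sum_(k <- r) fourier (fun x => c k * Defs.shift f k x) w =
      \sum_(k <- r) c k * character k w * fourier f w}.
    elim: r {H1} => [|k r IH]; first by apply: ae_all => w; rewrite !big_nil.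
    have Hk : {ae mu, forall w, fourier (fun x => c k * Defs.shift f k x) w =
        c k * character k w * fourier f w}.
      have Ls := L2_shift k Lf.
      have Hz := fourierDZ (c k - 1) Ls Ls.
      apply: ae_imp2 Hz (fourier_shift k Lf) => w Hz Hs.
      rewrite (_ : (fun x => _) = (fun x => (c k - 1) * Defs.shift f k x + Defs.shift f k x)).
        by rewrite Hz Hs; ring.
      by apply/funext => x; ring.
    by apply: ae_imp2 Hk IH => w Hw IHw; rewrite !big_cons Hw IHw.
  apply: ae_imp2 H1 H2 => w -> ->.
  by rewrite mulr_suml.
Qed.

(** Functions in the space generated by f are, on the Fourier side, periodic
    multiples of the transform of f: along a rapidly convergent sequence of
    trigonometric polynomial multiples the periodic factors converge at almost
    every point where the transform of f does not vanish. *)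
Lemma shift_space_fourier f g : L2 f -> shift_space f g ->
  exists a : R -> C, [/\ cmeasurable a, periodic a 1 &
    {ae mu, forall w, fourier g w = a w * fourier f w}].
Proof.
move=> Lf [Lg gf].
have h n : 0 < (2^-1 ^+ n : R) by rewrite exprn_gt0// invr_gt0.
pose u n := projT1 (cid2 (gf _ (h n))).
have su n : shift_span f (u n) by rewrite /u; case: cid2.
have gu n : (N (fun x => g x - u n x)%R < (2^-1 ^+ n)%:E)%E by rewrite /u; case: cid2.
have Lu n := shift_span_L2 Lf (su n).
pose p n := projT1 (cid (shift_span_fourier Lf (su n))).
have [mp pp up] : [/\ forall n, cmeasurable (p n), forall n, periodic (p n) 1 &
    forall n, {ae mu, forall w, fourier (u n) w = p n w * fourier f w}].
  by split=> n; rewrite /p; case: cid => q [].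
have LFf := fourier_L2 Lf; have LFg := fourier_L2 Lg.
have mpf n : cmeasurable (fun w => p n w * fourier f w).
  by apply: cmeasurableM; [exact: mp|case: LFf].
have cv : {ae mu, forall w, Normc.normc (p n w * fourier f w - fourier g w)
    @[n --> \oo] --> (0 : R)}.
  apply: (cLnorm_fast_cvg mpf LFg.1) => n.
  rewrite (_ : N _ = N (fun w => fourier (u n) w - fourier g w)%R).
    by rewrite fourier_isometry// cLnormB ltW.
  apply: ae_eq_cLnorm.
  - by apply: cmeasurableB => //; case: LFg.
  - by apply: cmeasurableB; [case: (fourier_L2 (Lu n))|case: LFg].
  - by apply: ae_imp (up n) => w ->.
pose re n w := complex.Re (p n w); pose im n w := complex.Im (p n w).
exists (fun w => Complex (rlim re w) (rlim im w)); split.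
- by split; apply: measurable_rlim => n; case: (mp n).
- move=> w; congr Complex; rewrite /rlim; congr fine; congr limn_esup;
    by apply/funext => n; rewrite /re /im pp.
apply: ae_imp cv => w cw.
have [f0|f0] := eqVneq (fourier f w) 0.
  rewrite f0 mulr0; rewrite f0 in cw; apply: Normc.eq0_normc.
  have c0 : (fun=> Normc.normc (fourier g w)) @ \oo --> (0 : R).
    apply: cvg_trans cw; apply: near_eq_cvg; apply: nearW => n.
    by rewrite mulr0 sub0r normcN.
  exact: (@cvg_unique _ (@Rhausdorff R) _ _ _ _ (@cvg_cst _ _ _ _ _) c0).
set q := fourier g w / fourier f w.
have cq : Normc.normc (p n w - q) @[n --> \oo] --> (0 : R).
  pose d := (Normc.normc (fourier f w))^-1.
  have c1 : Normc.normc (p n w * fourier f w - fourier g w) * d @[n --> \oo] --> (0 : R).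
    by rewrite -[X in _ --> X](mul0r d); apply: cvgMr_tmp.
  apply: cvg_trans c1; apply: near_eq_cvg; apply: nearW => n.
  rewrite /d -Normc.normcV -Normc.normcM; congr Normc.normc.
  by rewrite mulrBl mulfK.
have [c1 c2] := normc_cvg0 cq.
have -> : rlim re w = complex.Re q.
  apply: rlim_cvg; apply/subr_cvg0; move: c1.
  by under eq_fun do rewrite complex_ReB.
have -> : rlim im w = complex.Im q.
  apply: rlim_cvg; apply/subr_cvg0; move: c2.
  by under eq_fun do rewrite complex_ImB.
by rewrite -[Complex _ _]/(Complex (complex.Re q) (complex.Im q)); case E : q => [x y] /=;
  rewrite -E /q mulfVK.
Qed.

End PeriodicQuotient.


(** * Supports and determining sets *)

Section DeterminingSets.
Context {R : realType}.
Local Notation C := R[i].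
Local Notation mu := (@lebesgue_measure R).
Local Notation N f := (cLnorm 2%:E f).
Implicit Types (f g h u v : R -> C).

Lemma ae_shift (P : R -> Prop) (c : R) :
  {ae mu, forall w, P w} -> {ae mu, forall w, P (w + c)}.
Proof.
move=> [A [mA A0 PA]]; exists ((fun w => w + c) @^-1` A); split.
- by rewrite -[X in measurable X]setTI; exact: measurable_shift.
- by have := lebesgue_measure_shift c mA; rewrite /pushforward A0.
- by move=> w /= nP; apply: PA.
Qed.

Lemma ae_forall_countable (T : countType) (P : T -> R -> Prop) :
  (forall k, {ae mu, forall w, P k w}) -> {ae mu, forall w, forall k, P k w}.
Proof.
move=> H.
have : {ae mu, forall w, forall n : nat,
    if unpickle n is Some k then P k w else True}.
  apply: ae_foralln => n; case: (unpickle n) => [k|]; first exact: H.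
  exact: ae_all.
by apply: ae_imp => w Hw k; have := Hw (pickle k); rewrite pickleK.
Qed.

Lemma ae_integer_translates (P : R -> Prop) :
  {ae mu, forall w, P w} -> {ae mu, forall w, forall k : int, P (w + k%:~R)}.
Proof. by move=> H; apply: ae_forall_countable => k; exact: ae_shift. Qed.

Lemma grammian_supportP f w :
  grammian_support f w <-> exists k : int, fourier f (w + k%:~R) != 0.
Proof.
have sq0 k : (0 <= sqmod (fourier f (w + k%:~R)))%E by rewrite lee_fin sqr_ge0.
rewrite /grammian_support /grammian /=; split=> [|[k fk]].
  apply: contraPP => /forallNP H.
  rewrite esum1 ?ltxx// => k _; have /negP := H k; rewrite negbK => /eqP ->.
  by rewrite /sqmod Normc.normc0 expr0n.
apply: (@lt_le_trans _ _ (sqmod (fourier f (w + k%:~R)))).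
  by rewrite lte_fin exprn_gt0// lt_neqAle normc_ge0 andbT eq_sym normc_eq0.
apply: esum_ge; exists [set k]; last by rewrite fsbig_set1.
by split; [exact: finite_set1|].
Qed.

Lemma measurable_neq0 v : cmeasurable v -> measurable [set w | v w != 0].
Proof.
move=> mv; rewrite (_ : [set w | _] = (fun w => Normc.normc (v w)) @^-1` (~` [set 0])).
  rewrite -[X in measurable X]setTI; apply: measurable_normc => //.
  exact: measurableC.
apply/seteqP; split=> w /=; first by move=> v0 /eqP; rewrite normc_eq0; exact/negP.
by move=> /eqP; rewrite normc_eq0.
Qed.

Lemma measurable_grammian_support f : L2 f -> measurable (grammian_support f).
Proof.
move=> Lf; rewrite (_ : grammian_support f =
    \bigcup_(k in [set: int]) [set w | fourier f (w + k%:~R) != 0]).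
  apply: countable_bigcupT_measurable; first exact: countableP.
  move=> k; apply: measurable_neq0.
  have [[m1 m2] _] := fourier_L2 Lf; split.
    exact: (measurableT_comp m1 (measurable_shift k%:~R)).
  exact: (measurableT_comp m2 (measurable_shift k%:~R)).
apply/seteqP; split=> w.
  by move=> /grammian_supportP[k fk]; exists k.
by move=> [k _ fk]; apply/grammian_supportP; exists k.
Qed.

Lemma null_setY_ae (A B : set R) : measurable A -> measurable B ->
  lebesgue_measure (A `+` B) = 0%E <-> {ae mu, forall w, A w <-> B w}.
Proof.
move=> mA mB; have mAB : measurable (A `+` B) by apply: measurableU; exact: measurableD.
have E : A `+` B = ~` [set w | A w <-> B w].
  apply/seteqP; split=> w /=.
    by move=> [[Aw nB]|[Bw nA]] [h1 h2]; [exact: nB (h1 Aw)|exact: nA (h2 Bw)].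
  move=> nAB; have [Aw|nA] := pselect (A w); have [Bw|nB] := pselect (B w).
  - by exfalso; apply: nAB.
  - by left.
  - by right.
  - by exfalso; apply: nAB.
split.
  by move=> /(negligibleP mu mAB); rewrite E.
by move=> H; apply/(negligibleP mu mAB); rewrite E.
Qed.

Variables (phi : R -> C) (m : nat) (F : 'I_m -> R -> C).
Hypothesis Lphi : L2 phi.
Hypothesis sF : forall i, shift_space phi (F i).

Let LF i : L2 (F i). Proof. by case: (sF i). Qed.

Definition same_support :=
  {ae mu, forall w, (exists i, grammian_support (F i) w) <-> grammian_support phi w}.

(** The expression of the transform of phi through those of the F i bounds
    the support of phi, and the expression of each F i through phi bounds the
    others. Supports involve all integer translates of a point, so the almost
    everywhere identities are first transported to these. *)
Lemma determining_same_support :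
  determining_set (shift_space phi) F -> same_support.
Proof.
move=> /(_ phi (shift_space_self Lphi))[alpha [_ /ae_integer_translates Hphi]].
have : {ae mu, forall w, forall i : 'I_m, forall k : int,
    fourier phi (w + k%:~R) = 0 -> fourier (F i) (w + k%:~R) = 0}.
  apply: ae_forall_countable => i.
  have [b [_ _ /ae_integer_translates]] := shift_space_fourier Lphi (sF i).
  by apply: ae_imp => w Hw k h0; rewrite Hw h0 mulr0.
apply: ae_imp2 Hphi => w Hphi HF; split.
  move=> [i /grammian_supportP[k Fk]]; apply/grammian_supportP; exists k.
  by apply: contra_neq Fk; exact: HF.
move=> /grammian_supportP[k phik]; apply: contrapT => /forallNP nF.
move: phik; rewrite Hphi big1 ?eqxx// => i _.
have [->|Fk] := eqVneq (fourier (F i) (w + k%:~R)) 0; first by rewrite mulr0.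
by exfalso; apply: (nF i); apply/grammian_supportP; exists k.
Qed.

(** If the transforms of F i and g are b i and a times that of phi, take
    alpha i = a * conj (b i) / (sum_j |b j| ^ 2). The product of alpha i and the
    transform of F i is then that of g times a number of the unit interval, and
    these numbers add up to 1 almost everywhere where the transform of phi does
    not vanish, because the supports agree. *)
Lemma same_support_multipliers g : same_support -> shift_space phi g ->
  exists alpha : 'I_m -> R -> C,
    [/\ forall i, cmeasurable (alpha i) /\ periodic (alpha i) 1,
        forall i, L2 (fun w => alpha i w * fourier (F i) w) &
        {ae mu, forall w, fourier g w = \sum_(i < m) alpha i w * fourier (F i) w}].
Proof.
move=> supp sg.
have [a [ma pa ga]] := shift_space_fourier Lphi sg.
pose b i := projT1 (cid (shift_space_fourier Lphi (sF i))).
have [mb pb Fb] : [/\ forall i, cmeasurable (b i), forall i, periodic (b i) 1 &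
    forall i, {ae mu, forall w, fourier (F i) w = b i w * fourier phi w}].
  by split=> i; rewrite /b; case: cid => q [].
have {}Fb : {ae mu, forall w, forall i, fourier (F i) w = b i w * fourier phi w}.
  exact: ae_forall_countable.
pose s w : R := \sum_(j < m) Normc.normc (b j w) ^+ 2.
have s0 w : 0 <= s w by apply: sumr_ge0 => j _; exact: sqr_ge0.
have ms : measurable_fun setT s.
  by apply: measurable_sum => j; exact: measurable_normc_sqr.
have msV : measurable_fun setT (fun w => (s w)^-1).
  rewrite (_ : (fun w => _) = (fun w => s w `^ (-1))).
    exact: (measurableT_comp (@measurable_powR R (-1)) ms).
  by apply/funext => w; rewrite powR_inv1.
pose alpha i w : C := a w * (b i w)^* * ((s w)^-1)%:C%C.
have mconj v : cmeasurable v -> cmeasurable (fun w => (v w)^*).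
  move=> [m1 m2]; split.
    by rewrite (_ : (fun w => _) = (fun w => complex.Re (v w)))//; apply/funext => w; case: (v w).
  rewrite (_ : (fun w => _) = (fun w => - complex.Im (v w))); first exact: measurable_funN.
  by apply/funext => w; case: (v w).
have malpha i : cmeasurable (alpha i).
  apply: cmeasurableM; last exact: cmeasurable_real.
  by apply: cmeasurableM => //; exact: mconj.
have bb i w : (b i w)^* * b i w = (Normc.normc (b i w) ^+ 2)%:C%C.
  rewrite normc_sqr; case: (b i w) => x y /=.
  by apply/eqP; rewrite eq_complex /=; apply/andP; split; apply/eqP; ring.
pose t i w : R := Normc.normc (b i w) ^+ 2 / s w.
have aF : {ae mu, forall w, forall i, alpha i w * fourier (F i) w = (t i w)%:C%C * fourier g w}.
  apply: ae_imp2 ga Fb => w gw Fw i.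
  rewrite Fw gw /alpha /t realcM -bb; ring.
exists alpha; split.
- move=> i; split => // w; rewrite /alpha /s pa pb.
  by congr (_ * _ * (_^-1)%:C%C); apply: eq_bigr => j _; rewrite pb.
- move=> i; have Lg := fourier_L2 sg.1.
  have mt : cmeasurable (fun w => (t i w)%:C%C).
    by apply: cmeasurable_real; apply: measurable_funM => //; exact: measurable_normc_sqr.
  have [|Lt _] := @L2_bounded_mul _ 1 _ _ mt _ Lg.
    move=> w; rewrite normc_real ger0_norm ?divr_ge0 ?sqr_ge0//.
    rewrite /t; have [->|sw] := eqVneq (s w) 0; first by rewrite invr0 mulr0.
    rewrite ler_pdivrMr ?mul1r; last by rewrite lt_neqAle eq_sym sw s0.
    by rewrite /s (bigD1 i)//= lerDl sumr_ge0// => j _; exact: sqr_ge0.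
  apply: L2_ae_eq Lt _; last by apply: ae_imp aF => w ->.
  by apply: cmeasurableM => //; case: (fourier_L2 (LF i)).
- have H1 : {ae mu, forall w, (forall i, alpha i w * fourier (F i) w =
      (t i w)%:C%C * fourier g w) /\ (fourier g w = a w * fourier phi w)}.
    by apply: ae_imp2 aF ga.
  have H2 : {ae mu, forall w, ((exists i, grammian_support (F i) w) <->
      grammian_support phi w) /\
      forall k i, fourier (F i) (w + k%:~R) = b i (w + k%:~R) * fourier phi (w + k%:~R)}.
    by apply: ae_imp2 supp (ae_integer_translates Fb).
  apply: ae_imp2 H1 H2 => w [aFw gw] [sw Fw].
  under eq_bigr do rewrite aFw; rewrite -mulr_suml.
  have [phi0|phi0] := eqVneq (fourier phi w) 0; first by rewrite gw phi0 mulr0 mulr0.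
  rewrite -[LHS]mul1r; congr (_ * _); rewrite -rmorph_sum /t -mulr_suml -/(s w).
  suff sn0 : s w != 0 by rewrite divff.
  have /sw[i /grammian_supportP[k Fk]] : grammian_support phi w.
    by apply/grammian_supportP; exists 0; rewrite addr0.
  have bi : b i w != 0.
    by move: Fk; rewrite Fw periodicz//; apply: contra_neq => ->; rewrite mul0r.
  rewrite gt_eqF// /s (bigD1 i)//= ltr_pwDl//.
    by rewrite exprn_gt0// lt_neqAle normc_ge0 andbT eq_sym normc_eq0.
  by apply: sumr_ge0 => j _; exact: sqr_ge0.
Qed.

Lemma same_support_determining : same_support -> determining_set (shift_space phi) F.
Proof.
move=> supp g sg; have [alpha [H1 _ H2]] := same_support_multipliers supp sg.
by exists alpha.
Qed.

Lemma same_support_sum : same_support ->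
  shift_space phi = subspace_sum (fun i => shift_space (F i)).
Proof.
move=> supp; apply/seteqP; split=> g; last first.
  move=> [Lg [h [hF gh]]]; have [mg _] := Lg.
  apply: shift_space_ae gh => //; apply: shift_space_sum => // i.
  exact: (shift_space_sub Lphi (sF i)).
move=> sg; have Lg := sg.1; split => //.
have [alpha [ap aL ga]] := same_support_multipliers supp sg.
have img i : fourier_image (F i) (fun w => alpha i w * fourier (F i) w).
  have [ma pa] := ap i.
  apply: (closed_invariant_periodic (fourier_image_closed_invariant (LF i))) => //.
  split; first exact: fourier_L2.
  exists (F i); first exact: shift_space_self.
  exact: ae_all.
pose h i := projT1 (cid2 (img i).2).
have sh i : shift_space (F i) (h i) by rewrite /h; case: cid2.
have hF i : {ae mu, forall w, alpha i w * fourier (F i) w = fourier (h i) w}.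
  by rewrite /h; case: cid2.
have Lh i : L2 (h i) by case: (sh i).
exists h; split => //.
have Ls := L2_sum (index_enum 'I_m) Lh.
have eqF : {ae mu, forall w, fourier g w = fourier (fun x => \sum_(i < m) h i x) w}.
  have H := ae_forall_countable hF.
  have Hs := fourier_sum (index_enum 'I_m) Lh.
  have H3 : {ae mu, forall w, fourier (fun x => \sum_(i < m) h i x) w =
      \sum_(i < m) alpha i w * fourier (F i) w}.
    by apply: ae_imp2 H Hs => w Hw ->; apply: eq_bigr => i _; rewrite Hw.
  by apply: ae_imp2 ga H3 => w -> ->.
have : N (fun x => g x - \sum_(i < m) h i x)%R = 0%E.
  rewrite -fourier_isometry// -(@cLnorm0 R); apply: ae_eq_cLnorm.
  - by apply: cmeasurableB; [case: (fourier_L2 Lg)|case: (fourier_L2 Ls)].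
  - exact: cmeasurable_cst.
  - by apply: ae_imp eqF => w ->; rewrite subrr.
move/(cLnorm_eq0 (cmeasurableB Lg.1 Ls.1)); apply: ae_imp => x.
exact: subr0_eq.
Qed.

Lemma same_support_null :
  lebesgue_measure ((\bigcup_(i in [set: 'I_m]) grammian_support (F i)) `+`
    grammian_support phi) = 0%E <-> same_support.
Proof.
rewrite null_setY_ae; last 2 first.
- by apply: fin_bigcup_measurable => // i _; exact: measurable_grammian_support.
- exact: measurable_grammian_support.
have E w : (\bigcup_(i in [set: 'I_m]) grammian_support (F i)) w <->
    exists i, grammian_support (F i) w.
  by split=> [[i _ Fi]|[i Fi]]; exists i.
by split; apply: ae_imp => w; rewrite E.
Qed.

End DeterminingSets.

Theorem theorem3 (R : realType) (phi : R -> R[i])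
    (phi_L2 : L2 phi)
    (phi_frame : shift_frame phi (shift_space phi))
    (phi_sampling : sampling_space (shift_space phi))
    (m : nat) (F : 'I_m -> R -> R[i])
    (F_in_V : forall i : 'I_m, shift_space phi (F i)) :
  (determining_set (shift_space phi) F <->
     lebesgue_measure
       ((\bigcup_(i in [set: 'I_m]) grammian_support (F i)) `+`
        grammian_support phi) = 0%E) /\
  (determining_set (shift_space phi) F ->
     shift_space phi = subspace_sum (fun i : 'I_m => shift_space (F i))).
Proof.
have det_supp := determining_same_support phi_L2 F_in_V.
split; last first.
  by move=> /det_supp; exact: same_support_sum phi_L2 F_in_V.
split.
  by move=> /det_supp /(same_support_null phi_L2 F_in_V).
move=> /(same_support_null phi_L2 F_in_V).
exact: same_support_determining phi_L2 F_in_V.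
Qed.
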